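(* Let $\mathbf{v}_0\in V$ and let $\mathbf{f}\in H^1$ be time-independent. Let $\mathbf{u}$ be the solution of the 2D Navier–Stokes equations on $\mathbb{T}^2$ with viscosity $\nu>0$, forcing $\mathbf{f}$ and initial data $\mathbf{u}_0\in V$. Then, for any $\alpha,h,\mu>0$, the system $$(I-\alpha^2\Delta)\partial_t\mathbf{v}+(\mathbf{v}\cdot\nabla)\mathbf{v}+\nabla q=\nu\Delta\mathbf{v}+\mathbf{f}+\mu\,(I_h(\mathbf{u})-I_h(\mathbf{v})),\qquad \nabla\cdot\mathbf{v}=0,\qquad \mathbf{v}(\mathbf{x},0)=\mathbf{v}_0(\mathbf{x})$$ on $\mathbb{T}^2$ possesses a unique solution $\mathbf{v}\in L^\infty(0,T;V)$ for any $T>0$.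
   Context: The domain is $\Omega=\mathbb{T}^2=\mathbb{R}^2/\mathbb{Z}^2$ (periodic boundary conditions). $\mathcal{V}$ is the set of divergence-free, mean-free, smooth vector fields on $\mathbb{T}^2$; $H$ and $V$ are the closures of $\mathcal{V}$ in $L^2$ and $H^1$, respectively; $V$ carries the norm $\|\nabla\mathbf{u}\|_{L^2}$. The 2D Navier–Stokes equations with viscosity $\nu>0$, forcing $\mathbf{f}$ and initial data $\mathbf{u}_0$ are $$\partial_t\mathbf{u}+(\mathbf{u}\cdot\nabla)\mathbf{u}+\nabla p=\nu\Delta\mathbf{u}+\mathbf{f},\qquad \nabla\cdot\mathbf{u}=0,\qquad \mathbf{u}(\mathbf{x},0)=\mathbf{u}_0(\mathbf{x}).$$ For $\mathbf{u}_0\in V$ and $\mathbf{f}\in H$ they have a unique global solution with values in $V$. Solutions of both systems are understood in the usual functional sense for incompressible flow, i.e. the equation is tested against elements of $V$ (equivalently, the Leray–Helmholtz projection is applied), which eliminates the pressures $p,q$; these are recovered by de Rham's theorem. $I_h$ is a linear operator (an interpolant of observed data) satisfying, for some constants $c_1,h>0$, $$\|\phi-I_h(\phi)\|_{L^2}\le c_1h\|\nabla\phi\|_{L^2}\qquad\text{for all }\phi\in H^1.$$ *)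

(* Defs.v *)
From HB Require Import structures.
From mathcomp Require Import all_boot all_order all_algebra.
From mathcomp Require Import all_classical all_reals all_analysis.

Set Implicit Arguments.
Unset Strict Implicit.
Unset Printing Implicit Defensive.

Import Order.TTheory GRing.Theory Num.Theory.
Import numFieldNormedType.Exports.

Local Open Scope classical_set_scope.
Local Open Scope ring_scope.

(* A function on T^2 = R^2/Z^2 is a Z^2-periodic function on R^2; integrals and
   almost-everywhere statements on T^2 are taken on the fundamental domain
   [0,1) x [0,1).  A vector field is given by its two components.  As usual,
   elements of L^2 and H^1 are represented by functions and identified when they
   agree almost everywhere. *)

Notation plane R := (R * R)%type.
Notation field R := ('I_2 -> plane R -> R).

Section Torus.
Variable R : realType.
Implicit Types (f g : plane R -> R) (u v w : field R) (i j : 'I_2) (z : plane R).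

Definition fundamental_domain : set (measurableTypeR R * measurableTypeR R) :=
  `[0, 1[%classic `*` `[0, 1[%classic.

Lemma measurable_fundamental_domain : measurable fundamental_domain.
Proof. by apply: measurableX; exact: measurable_itv. Qed.

Definition torus_measure :
    {measure set (measurableTypeR R * measurableTypeR R) -> \bar R} :=
  mrestr (lebesgue_measure \x lebesgue_measure)%E measurable_fundamental_domain.

Definition torus_fun f := periodic f (1, 0) /\ periodic f (0, 1).

Definition L2 f := torus_fun f /\ f \in Lfun torus_measure 2%:E.

Definition basis_vector j : plane R := if j == 0 then (1, 0) else (0, 1).

(* R^o is R as a normed module over itself, which 'D needs *)
Definition partial j f : plane R -> R :=
  fun z => 'D_(basis_vector j) (f : (R^o * R^o)%type -> R^o) z.

Definition smooth f :=
  torus_fun f /\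
  forall s : seq 'I_2, let g := foldr partial f s in
    continuous g /\
    forall j z, derivable (g : (R^o * R^o)%type -> R^o) z (basis_vector j).

Definition is_weak_partial j f g :=
  forall phi, smooth phi ->
    \int[torus_measure]_z (f z * partial j phi z) =
    - \int[torus_measure]_z (g z * phi z).

Definition H1 f :=
  L2 f /\ forall j, exists g, L2 g /\ is_weak_partial j f g.

(* the weak derivative of f, determined up to a null set when f is in H^1 *)
Definition weak_partial j f : plane R -> R :=
  xget (fun=> 0) [set g | L2 g /\ is_weak_partial j f g].

Definition L2_field u := forall i, L2 (u i).
Definition H1_field u := forall i, H1 (u i).

Definition field_ae_eq u v := forall i, u i = v i %[ae torus_measure].

Definition dotL2 u v : R := \sum_(i < 2) \int[torus_measure]_z (u i z * v i z).

Definition dot_grad u v : R :=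
  \sum_(i < 2) \sum_(j < 2)
    \int[torus_measure]_z (weak_partial j (u i) z * weak_partial j (v i) z).

Definition normL2 u : R := Num.sqrt (dotL2 u u).
Definition norm_grad u : R := Num.sqrt (dot_grad u u).
Definition normH1 u : R := Num.sqrt (dotL2 u u + dot_grad u u).

(* the L^2 product of (u . nabla) v with w *)
Definition convection u v w : R :=
  \sum_(i < 2)
    \int[torus_measure]_z
      ((\sum_(j < 2) u j z * weak_partial j (v i) z) * w i z).

Definition smooth_solenoidal phi :=
  [/\ forall i, smooth (phi i),
      forall z, \sum_(i < 2) partial i (phi i) z = 0 &
      forall i, \int[torus_measure]_z phi i z = 0].

Definition V u :=
  H1_field u /\
  forall e : R, 0 < e -> exists2 phi, smooth_solenoidal phi & normH1 (u - phi) < e.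

(* Bochner measurability of v : (0,T) -> V, where V carries norm_grad *)
Definition V_simple (s : R -> field R) :=
  exists n (A : 'I_n -> set R) (c : 'I_n -> field R),
    [/\ forall k, measurable (A k),
        forall k, V (c k) &
        forall t i z, s t i z = \sum_(k < n) \1_(A k) t * c k i z].

Definition V_strongly_measurable (T : R) (v : R -> field R) :=
  exists s : nat -> R -> field R,
    (forall n, V_simple (s n)) /\
    {ae lebesgue_measure, forall t, t \in `]0, T[ ->
       norm_grad (s n t - v t) @[n --> \oo] --> 0}.

Definition Linfty_V (T : R) (v : R -> field R) :=
  [/\ {ae lebesgue_measure, forall t, t \in `]0, T[ -> V (v t)},
      V_strongly_measurable T v &
      exists M : R,
        {ae lebesgue_measure, forall t, t \in `]0, T[ -> norm_grad (v t) <= M}].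

(* dy/dt = r on (0,T) with y(0) = y0: y has an absolutely continuous
   representative, which takes the value y0 at 0 and has derivative r *)
Definition evolves (T : R) (y : R -> R) (y0 : R) (r : R -> R) :=
  lebesgue_measure.-integrable `]0, T[ (EFin \o r) /\
  {ae lebesgue_measure, forall t, t \in `]0, T[ ->
     y t = y0 + \int[lebesgue_measure]_(s in `]0, t[) r s}.

(* The equations are tested against w in V: the pressures drop out, and
   incompressibility is contained in the membership in V. *)

Definition NSE_solution (nu : R) (f u0 : field R) (u : R -> field R) :=
  forall T : R, 0 < T ->
    Linfty_V T u /\
    forall w, V w ->
      evolves T (fun t => dotL2 (u t) w) (dotL2 u0 w)
        (fun t => dotL2 f w - convection (u t) (u t) w
                  - nu * dot_grad (u t) w).

Definition Voigt_assimilation_solution (alpha nu mu : R)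
    (Ih : field R -> field R) (f : field R) (u : R -> field R) (v0 : field R)
    (T : R) (v : R -> field R) :=
  Linfty_V T v /\
  forall w, V w ->
    evolves T (fun t => dotL2 (v t) w + alpha ^+ 2 * dot_grad (v t) w)
      (dotL2 v0 w + alpha ^+ 2 * dot_grad v0 w)
      (fun t => dotL2 f w + mu * dotL2 (Ih (u t) - Ih (v t)) w
                - convection (v t) (v t) w - nu * dot_grad (v t) w).

(* Ih is linear on classes modulo a.e. equality; that it respects these classes
   follows from the other two conditions. *)
Definition interpolant (c1 h : R) (Ih : field R -> field R) :=
  [/\ forall phi, H1_field phi -> L2_field (Ih phi),
      forall (a : R) phi psi, H1_field phi -> H1_field psi ->
        field_ae_eq (Ih (fun i z => a * phi i z + psi i z))
                    (fun i z => a * Ih phi i z + Ih psi i z) &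
      forall phi, H1_field phi ->
        normL2 (phi - Ih phi) <= c1 * h * norm_grad phi].

End Torus.

(* Main.v *)
(** Tested against [V], the regularised equation is an ordinary differential equation in the
    Hilbert space [V] with inner product [a(v,w) = (v,w) + alpha^2 (grad v, grad w)]: by Riesz it
    reads [a(v',w) = rhs(t,v;w)], where [rhs] is linear in [w] and, by Ladyzhenskaya's inequality
    [|u|_4^4 <= 4 |u|_H1^4] on the torus, locally Lipschitz in [v] for the norm of [a].  The norm
    of [v] is bounded a priori by the energy inequality, because the convection term vanishes on
    the diagonal; cutting [rhs] off outside a large ball therefore does not change the solution,
    and Picard iteration in an exponentially weighted norm applies.

    The data enter only through [t |-> I_h(u(t))], which is bounded and weakly measurable off a
    Borel null set of times; on that null set the solution is redefined to be [u], so that the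
    right-hand side stays measurable.  Conversely a weak solution agrees almost everywhere with
    the Lipschitz curve obtained by integrating its own right-hand side, to which the uniqueness
    part of Picard's theorem applies. *)

From HB Require Import structures.
Require Import Defs.
From mathcomp Require Import all_boot all_order all_algebra.
From mathcomp Require Import all_classical all_reals all_analysis.
From mathcomp Require Import measurable_realfun ring lra.

Set Implicit Arguments.
Unset Strict Implicit.
Unset Printing Implicit Defensive.

Import Order.TTheory GRing.Theory Num.Theory.
Import numFieldNormedType.Exports.

Local Open Scope classical_set_scope.
Local Open Scope ring_scope.

(** * Semi-inner products *)

(** Two circumstances shape the development. Fields are functions, not classes, so every bilinear
    form is degenerate: the abstract theory concerns semi-inner products, curves are identified when
    their difference has norm 0, and [weak_partial] is linear only almost everywhere, which is where
    the fundamental lemma of the calculus of variations is needed. Moreover curves are known only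
    through scalar equations tested against a fixed vector, and no derivative of a curve is formed.
    Picard's operator is therefore built time by time from Riesz, and the energy inequality is a
    discrete Gronwall argument on a time grid, where testing against a frozen value costs an error
    quadratic in the step.

    Nothing ties [mu] to [h] because [mu I_h(v)] is handled as a bounded linear perturbation: [I_h]
    is bounded by [1 + c1 h] times the gradient norm, and the norm of [a] controls the gradient
    since [alpha > 0]. The energy may then grow exponentially, but at a rate independent of the
    truncation radius, so the radius can be chosen after the bound. *)

Section semi_hilbert.
Context {R : realType} {X : lmodType R}.
Variable a : X -> X -> R.

(** Definiteness is left out: a field that vanishes almost everywhere has norm 0 without being the
    zero function. *)
Record semi_inner : Prop := SemiInner {
  ipC : forall x y, a x y = a y x ;
  ip_linear : forall k x y z, a (k *: x + y) z = k * a x z + a y z ;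
  ip_ge0 : forall x, 0 <= a x x }.

Definition seminorm x := Num.sqrt (a x x).
Local Notation nrm := seminorm.

Definition seq_complete := forall s : nat -> X,
  (forall e : R, 0 < e -> exists N, forall m n, (N <= m)%N -> (N <= n)%N ->
     nrm (s m - s n) <= e) ->
  exists x, forall e : R, 0 < e -> exists N, forall n, (N <= n)%N ->
     nrm (s n - x) <= e.

Hypothesis aP : semi_inner.

Lemma ipDl x y z : a (x + y) z = a x z + a y z.
Proof. by have := ip_linear aP 1 x y z; rewrite scale1r mul1r. Qed.

Lemma ip0l z : a 0 z = 0.
Proof. by have := ipDl 0 0 z; rewrite addr0 => /eqP; rewrite -subr_eq0 opprD addNKr oppr_eq0 => /eqP. Qed.

Lemma ipZl k x z : a (k *: x) z = k * a x z.
Proof. by have := ip_linear aP k x 0 z; rewrite addr0 ip0l addr0. Qed.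

Lemma ipNl x z : a (- x) z = - a x z.
Proof. by rewrite -scaleN1r ipZl mulN1r. Qed.

Lemma ipBl x y z : a (x - y) z = a x z - a y z.
Proof. by rewrite ipDl ipNl. Qed.

Lemma ipDr x y z : a x (y + z) = a x y + a x z.
Proof. by rewrite (ipC aP) ipDl !(ipC aP x). Qed.

Lemma ipZr k x z : a x (k *: z) = k * a x z.
Proof. by rewrite (ipC aP) ipZl (ipC aP x). Qed.

Lemma ipNr x z : a x (- z) = - a x z.
Proof. by rewrite (ipC aP) ipNl (ipC aP x). Qed.

Lemma ipBr x y z : a x (y - z) = a x y - a x z.
Proof. by rewrite ipDr ipNr. Qed.

Lemma seminorm_ge0 x : 0 <= nrm x.
Proof. exact: sqrtr_ge0. Qed.

Lemma sqr_seminorm x : nrm x ^+ 2 = a x x.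
Proof. by rewrite sqr_sqrtr// (ip_ge0 aP). Qed.

Lemma cauchy_schwarz x y : `|a x y| <= nrm x * nrm y.
Proof.
have h t : 0 <= a x x + 2 * t * a x y + t ^+ 2 * a y y.
  have := ip_ge0 aP (x + t *: y).
  by rewrite ipDl !ipDr !ipZl !ipZr (ipC aP y x); congr (0 <= _); ring.
have {}h : a x y ^+ 2 <= a x x * a y y.
  have := ip_ge0 aP y; rewrite le_eqVlt => /predU1P[S0|S0].
    rewrite -S0 mulr0; have [->|Q0] := eqVneq (a x y) 0; first by rewrite expr0n.
    (* When [a y y = 0] the quadratic in [t] is affine, and this [t] would give it the value -1. *)
    have := h (- (a x x + 1) / (2 * a x y)); rewrite -S0 mulr0 addr0.
    have -> : 2 * (- (a x x + 1) / (2 * a x y)) * a x y = - (a x x + 1) by field.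
    by lra.
  have := h (- a x y / a y y).
  have -> : a x x + 2 * (- a x y / a y y) * a x y + (- a x y / a y y) ^+ 2 * a y y
     = (a x x * a y y - a x y ^+ 2) / a y y by field; rewrite gt_eqF.
  by rewrite pmulr_lge0 ?invr_gt0// subr_ge0.
by rewrite -sqrtr_sqr -sqrtrM ?(ip_ge0 aP)// ler_wsqrtr.
Qed.

Lemma ip_le x y : a x y <= nrm x * nrm y.
Proof. exact: le_trans (ler_norm _) (cauchy_schwarz _ _). Qed.

Lemma ler_seminormD x y : nrm (x + y) <= nrm x + nrm y.
Proof.
rewrite -(ler_pXn2r (n := 2)) ?nnegrE ?addr_ge0 ?seminorm_ge0//.
rewrite sqrrD !sqr_seminorm ipDl !ipDr (ipC aP y x).
by have := ip_le x y; lra.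
Qed.

Lemma seminormZ k x : nrm (k *: x) = `|k| * nrm x.
Proof.
by rewrite /nrm ipZl ipZr mulrA -expr2 sqrtrM ?sqr_ge0// sqrtr_sqr.
Qed.

Lemma seminormN x : nrm (- x) = nrm x.
Proof. by rewrite -scaleN1r seminormZ normrN1 mul1r. Qed.

Lemma seminorm0 : nrm 0 = 0.
Proof. by rewrite /nrm ip0l sqrtr0. Qed.

Lemma seminormBC x y : nrm (x - y) = nrm (y - x).
Proof. by rewrite -seminormN opprB. Qed.

Lemma ler_seminorm_dist x y z : nrm (x - z) <= nrm (x - y) + nrm (y - z).
Proof. by rewrite -{1}(subrK y x) -addrA ler_seminormD. Qed.

Lemma ler_dist_seminorm x y : `|nrm x - nrm y| <= nrm (x - y).
Proof.
rewrite ler_norml; apply/andP; split.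
  by have := ler_seminormD (y - x) x; rewrite subrK (seminormBC y); lra.
by have := ler_seminormD (x - y) y; rewrite subrK; lra.
Qed.

(** Norms are estimated by duality throughout, because curves are known only through their products
    with test vectors. *)
Lemma seminorm_le x K : 0 <= K -> (forall w, a x w <= K * nrm w) -> nrm x <= K.
Proof.
move=> K0 /(_ x); rewrite -sqr_seminorm.
have := seminorm_ge0 x; rewrite le_eqVlt => /predU1P[<-//|n0].
by rewrite expr2 ler_pM2r.
Qed.

Lemma seminorm_eq0 x w : nrm x = 0 -> a x w = 0.
Proof.
move=> x0; apply/normr0_eq0/eqP; rewrite eq_le normr_ge0 andbT.
by rewrite (le_trans (cauchy_schwarz _ _))// x0 mul0r.
Qed.

Hypothesis complete : seq_complete.

(** Direct method: [J] is bounded below by completing the square, a minimising sequence is Cauchy by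
    the parallelogram law, and first-order optimality at its limit is the representation. *)
Lemma riesz (l : X -> R) (C : R) :
  (forall k x y, l (k *: x + y) = k * l x + l y) ->
  (forall x, `|l x| <= C * nrm x) ->
  exists x, forall w, a x w = l w.
Proof.
move=> l_lin l_bnd.
have lZD k x y : l (x + k *: y) = l x + k * l y by rewrite addrC l_lin addrC.
pose J x := a x x - 2 * l x.
have J_lb x : - (C ^+ 2) <= J x.
  rewrite /J -sqr_seminorm; have := l_bnd x; have := ler_norm (l x).
  by have := sqr_ge0 (nrm x - C); nra.
have J_inf : has_inf (range J).
  by split; [exists (J 0), 0 | exists (- (C ^+ 2)) => _ [x _ <-]].
pose m := inf (range J).
have Jm x : m <= J x by apply: ge_inf; [exact: J_inf.2|exists x].
have /choice[s sP] : forall n : nat, exists x, J x <= m + n.+1%:R^-1.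
  move=> n; have [_ [x _ <-] /ltW] : exists2 y, range J y & y < m + n.+1%:R^-1.
    by apply: inf_adherent => //; rewrite invr_gt0.
  by exists x.
have inv_small (e : R) : 0 < e -> exists N, forall n, (N <= n)%N -> n.+1%:R^-1 <= e.
  move=> e0; exists (Num.truncn (e^-1)) => n Nn.
  rewrite invf_ple ?posrE// ltW// (lt_le_trans (truncnS_gt _))//.
  by rewrite ler_nat.
(* The parallelogram law reads [nrm (x - y) ^+ 2 = 2 J x + 2 J y - 4 J m'] with [m'] the midpoint,
   and [J m'] is at least [m]. *)
have J_par x y : nrm (x - y) ^+ 2 <= 2 * (J x - m) + 2 * (J y - m).
  have := Jm (2^-1 *: (x + y)).
  rewrite sqr_seminorm /J !ipZl !ipZr !ipBl !ipBr !ipDl !ipDr (ipC aP y x).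
  have -> : l (2^-1 *: (x + y)) = 2^-1 * (l x + l y).
    rewrite -[2^-1 *: _]addr0 l_lin.
    have := l_lin 1 0 0; rewrite scale1r addr0 mul1r => l0.
    have -> : l 0 = 0 by lra.
    by rewrite -{1}(scale1r y) lZD mul1r addr0.
  by lra.
have [|x xP] := complete (s := s).
  move=> e e0; have [N NP] := inv_small (e ^+ 2 / 4) ltac:(by rewrite divr_gt0 ?exprn_gt0).
  exists N => p q Np Nq.
  rewrite -(ler_pXn2r (n := 2)) ?nnegrE ?seminorm_ge0 ?(ltW e0)//.
  have J_le k : (N <= k)%N -> J (s k) <= m + e ^+ 2 / 4.
    by move=> /NP Nk; rewrite (le_trans (sP k))// lerD2l.
  by have := J_par (s p) (s q); have := J_le _ Np; have := J_le _ Nq; lra.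
exists x => w.
suff /eqP : a x w - l w = 0 by rewrite subr_eq0 => /eqP.
(* Optimality is obtained along the minimising sequence: [J] is at least [m] at [s n + t w] and at
   most [m + e / 2] at [s n]. The other [e / 2] pays for replacing [s n] by [x] in the linear term;
   the 1 in [K] keeps the divisor positive. *)
have key t : 0 <= 2 * t * (a x w - l w) + t ^+ 2 * a w w.
  apply/ler_addgt0Pl => e e0.
  set K := 2 * `|t| * nrm w + 1.
  have K0 : 0 < K by rewrite ltr_wpDl// !mulr_ge0 ?seminorm_ge0.
  have [N1 N1P] := inv_small (e / 2) ltac:(by rewrite divr_gt0).
  have [N2 N2P] := xP (e / 2 / K) ltac:(by rewrite !divr_gt0).
  pose n := maxn N1 N2.
  have : J (s n) <= m + e / 2.
    by rewrite (le_trans (sP n))// lerD2l N1P// leq_maxl.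
  have := N2P n (leq_maxr _ _).
  set xn := s n; move=> h2; have := Jm (xn + t *: w).
  rewrite /J -/xn !ipDl !ipDr !ipZl !ipZr lZD (ipC aP w xn).
  have : `|a (xn - x) w| * (2 * `|t|) <= e / 2.
    apply: (@le_trans _ _ (nrm (xn - x) * K)).
      rewrite /K mulrDr mulr1 ler_wpDr ?seminorm_ge0//.
      have := cauchy_schwarz (xn - x) w.
      move=> /(ler_wpM2r (x := 2 * `|t|)) => /(_ ltac:(by rewrite mulr_ge0)).
      by move/le_trans; apply; rewrite le_eqVlt; apply/orP; left; apply/eqP; ring.
    by rewrite -ler_pdivlMr.
  rewrite ipBl; have : t * (a xn w - a x w) <= `|a xn w - a x w| * `|t|.
    by rewrite mulrC -normrM ler_norm.
  by lra.
have : (a x w - l w) ^+ 2 <= 0 * a w w; last first.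
  by rewrite mul0r => h; apply/eqP; rewrite -sqrf_eq0 eq_le h sqr_ge0.
set D := a x w - l w in key *.
have := ip_ge0 aP w; rewrite le_eqVlt => /predU1P[S0|S0].
  have := key (- D); rewrite -S0 !mulr0 addr0.
  by nra.
have := key (- D / a w w).
have -> : 2 * (- D / a w w) * D + (- D / a w w) ^+ 2 * a w w = - (D ^+ 2 / a w w).
  by field; rewrite gt_eqF.
by rewrite oppr_ge0 pmulr_lle0 ?invr_gt0// mul0r.
Qed.

End semi_hilbert.

(** * Integrals over intervals *)

Section time_integral.
Context {R : realType}.
Local Notation mu := (@lebesgue_measure R).
Implicit Types (g F f : R -> R) (s t C : R).

Lemma Rintegral_FTC F f (a b : R) : a <= b -> continuous f ->
  (forall x : R, is_derive x 1 F (f x)) ->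
  \int[mu]_(x in `[a, b]) f x = F b - F a.
Proof.
rewrite le_eqVlt => /predU1P[->|ab] cf dF.
  by rewrite set_itv1 Rintegral_set1 subrr.
have cF (x : R) : {for x, continuous F}.
  by apply/differentiable_continuous/derivable1_diffP; case: (dF x).
rewrite /Rintegral (@continuous_FTC2 _ f F)//.
- exact: continuous_subspaceT.
- split=> //.
  + exact: cvg_at_right_filter (cF a).
  + exact: cvg_at_left_filter (cF b).
- by move=> x _; rewrite derive1E; case: (dF x).
Qed.

Lemma bounded_integrable g (A : set R) C : measurable A -> (mu A < +oo)%E ->
  measurable_fun A g -> (forall x, A x -> `|g x| <= C) -> mu.-integrable A (EFin \o g).
Proof.
move=> mA fA mg gC; apply: measurable_bounded_integrable => //.
by exists C; split; [exact: num_real|move=> M CM x /gC gx; exact: le_trans gx (ltW CM)].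
Qed.

Lemma itv_fin (b1 b2 : bool) (s t : R) :
  (mu [set` Interval (BSide b1 s) (BSide b2 t)] < +oo)%E.
Proof. by rewrite lebesgue_measure_itv/=; case: ifP => _; rewrite ltry. Qed.

Lemma bounded_integrable_itv g C (b1 b2 : bool) (s t : R) :
  measurable_fun setT g -> (forall x, `|g x| <= C) ->
  mu.-integrable [set` Interval (BSide b1 s) (BSide b2 t)] (EFin \o g).
Proof.
move=> mg gC; apply: (@bounded_integrable _ _ C) => //; first exact: itv_fin.
exact: measurable_funTS.
Qed.

Lemma Rintegral_itv_le g s t K C : s <= t -> measurable_fun setT g ->
  (forall x, `|g x| <= C) -> (forall x, s < x < t -> g x <= K) ->
  \int[mu]_(x in `]s, t[) g x <= K * (t - s).
Proof.
move=> st mg gC gK.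
have -> : K * (t - s) = \int[mu]_(x in `]s, t[) K.
  rewrite Rintegral_cst//= lebesgue_measure_itv/= lte_fin.
  by case: ltgtP st => // -> _; rewrite subrr.
apply: le_Rintegral => //.
- exact: bounded_integrable_itv gC.
- exact: (@bounded_integrable_itv _ `|K|).
Qed.

Lemma Rintegral_itv_diff g s t C : 0 <= s -> s <= t -> measurable_fun setT g ->
  (forall x, `|g x| <= C) ->
  \int[mu]_(x in `]0, t[) g x - \int[mu]_(x in `]0, s[) g x =
  \int[mu]_(x in `]s, t[) g x.
Proof.
move=> s0 st mg gC.
have gi b1 b2 (x y : R) : mu.-integrable [set` Interval (BSide b1 x) (BSide b2 y)] (EFin \o g).
  exact: bounded_integrable_itv gC.
rewrite (Rintegral_itv_bndo_bndc (gi false true 0 t)).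
rewrite (Rintegral_itv_bndo_bndc (gi false true 0 s)).
rewrite (Rintegral_itv_bndo_bndc (gi false true s t)).
by rewrite Rintegral_itvB ?bnd_simp.
Qed.

(** This convention lets curves live on all of R: those built below stay, up to norm 0, at their
    initial value for negative times. *)
Lemma Rintegral_neg g t : t <= 0 -> \int[mu]_(x in `]0, t[) g x = 0.
Proof. by move=> t0; rewrite set_itv_ge ?Rintegral_set0// bnd_simp -leNgt. Qed.

Lemma Rintegral_itv_lip g s t C : measurable_fun setT g ->
  (forall x, `|g x| <= C) ->
  `|\int[mu]_(x in `]0, t[) g x - \int[mu]_(x in `]0, s[) g x| <= C * `|t - s|.
Proof.
move=> mg gC; wlog st : s t / s <= t.
  move=> W; have [|/ltW ts] := leP s t; first exact: W.
  by rewrite distrC (distrC t); exact: W.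
have C0 : 0 <= C := le_trans (normr_ge0 (g 0)) (gC 0).
have pos s' t' : 0 <= s' -> s' <= t' ->
    `|\int[mu]_(x in `]0, t'[) g x - \int[mu]_(x in `]0, s'[) g x| <= C * `|t' - s'|.
  move=> s0 st'; rewrite (Rintegral_itv_diff s0 st' mg gC).
  rewrite (le_trans (le_normr_Rintegral _ _))//.
    exact: bounded_integrable_itv gC.
  rewrite (ger0_norm (x := t' - s')) ?subr_ge0//.
  apply: (@Rintegral_itv_le _ _ _ _ C) => //.
  - exact: measurableT_comp.
  - by move=> x; rewrite normr_id.
have [s0|s0] := leP 0 s; first exact: pos.
rewrite (Rintegral_neg _ (ltW s0)); have [t0|t0] := leP t 0.
  by rewrite Rintegral_neg// subrr normr0 mulr_ge0.
have := pos 0 t (lexx _) (ltW t0); rewrite (Rintegral_neg _ (lexx _)).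
move/le_trans; apply; rewrite ler_wpM2l// subr0 gtr0_norm// ger0_norm//; lra.
Qed.

Lemma Rintegral_exp_le g t c l C : 0 < l -> 0 <= t -> measurable_fun setT g ->
  (forall x, `|g x| <= C) -> 0 <= c ->
  (forall x, 0 < x < t -> g x <= c * expR (l * x)) ->
  \int[mu]_(x in `]0, t[) g x <= c / l * expR (l * t).
Proof.
move=> l0 t0 mg gC c0 ge.
pose f x := c * expR (l * x).
have dF (x : R) : is_derive x 1 (fun x => c / l * expR (l * x)) (f x).
  apply: is_derive_eq; rewrite /f /GRing.scale/=; field; lra.
have cf : continuous f.
  move=> x; apply: cvgM; first exact: cvg_cst.
  apply: (@continuous_comp R R R ( *%R l) expR); first exact: mulrl_continuous.
  exact: continuous_expR.
have cfi : mu.-integrable `[0, t] (EFin \o f).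
  apply: continuous_compact_integrable; first exact: segment_compact.
  exact: continuous_subspaceT.
have fi : mu.-integrable `]0, t[ (EFin \o f).
  by apply: (integrableS _ _ _ cfi) => //; exact: subset_itv_oo_cc.
apply: (@le_trans _ _ (\int[mu]_(x in `]0, t[) f x)).
  apply: le_Rintegral => //.
  exact: bounded_integrable_itv gC.
have -> : \int[mu]_(x in `]0, t[) f x = \int[mu]_(x in `[0, t]) f x.
  rewrite Rintegral_itv_bndo_bndc// Rintegral_itv_obnd_cbnd//.
  by apply: (integrableS _ _ _ cfi) => //; exact: subset_itv_oc_cc.
rewrite (Rintegral_FTC t0 cf dF) mulr0 expR0 mulr1.
by have := divr_ge0 c0 (ltW l0); lra.
Qed.

End time_integral.

(** * Picard iteration *)

Section picard.
Context {R : realType} {X : lmodType R}.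
Variable a : X -> X -> R.
Hypotheses (aP : semi_inner a) (complete : seq_complete a).
Local Notation nrm := (seminorm a).
Local Notation mu := (@lebesgue_measure R).

Lemma ler_geometric (x y K : R) : (forall n, x <= y + K / 2 ^+ n) -> x <= y.
Proof.
move=> h; apply/ler_addgt0Pl => e e0.
pose n := Num.truncn (`|K| / e); have := h n.
suff : K / 2 ^+ n <= e by lra.
rewrite ler_pdivrMr ?exprn_gt0// mulrC -ler_pdivrMr//.
rewrite (@le_trans _ _ (`|K| / e))//; first by rewrite ler_pM2r ?invr_gt0// ler_norm.
rewrite (le_trans (ltW (truncnS_gt _)))// -natrX ler_nat -/n.
exact: ltn_expl.
Qed.

Lemma geometric_limit (s : nat -> X) (K : R) :
  (forall n, nrm (s n.+1 - s n) <= K / 2 ^+ n) ->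
  exists x, forall n, nrm (s n - x) <= 2 * K / 2 ^+ n.
Proof.
move=> sK.
have K0 : 0 <= K.
  by have := le_trans (seminorm_ge0 a _) (sK 0); rewrite expr0 divr1.
have pos n : 0 < 2 ^+ n :> R by rewrite exprn_gt0.
(* The right-hand side is the exact partial geometric sum, so that the induction closes without
   loss. *)
have tail n m : nrm (s (n + m)%N - s n) <= 2 * K / 2 ^+ n - 2 * K / 2 ^+ (n + m)%N.
  elim: m => [|m IH]; first by rewrite addn0 !subrr (seminorm0 aP).
  rewrite (le_trans (ler_seminorm_dist aP _ (s (n + m)%N) _))//.
  have := sK (n + m)%N; rewrite addnS.
  suff -> : K / 2 ^+ (n + m)%N = 2 * K / 2 ^+ (n + m)%N - 2 * K / 2 ^+ (n + m)%N.+1 by lra.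
  by rewrite exprS; field; exact: lt0r_neq0 (pos _).
have tail' n m : (n <= m)%N -> nrm (s m - s n) <= 2 * K / 2 ^+ n.
  move=> /subnKC <-; rewrite (le_trans (tail _ _))//.
  by rewrite gerBl divr_ge0 ?mulr_ge0// ltW.
have [|x xP] := complete (s := s).
  move=> e e0; exists (Num.truncn (4 * K / e)) => m n Nm Nn.
  set N := Num.truncn _ in Nm Nn.
  rewrite (le_trans (ler_seminorm_dist aP _ (s N) _))// (seminormBC aP (s N)).
  have := tail' _ _ Nm; have := tail' _ _ Nn.
  suff : 2 * K / 2 ^+ N <= e / 2 by lra.
  rewrite ler_pdivrMr ?pos//.
  have : 4 * K / e <= 2 ^+ N.
    rewrite (le_trans (ltW (truncnS_gt _)))// -natrX ler_nat -/N.
    exact: ltn_expl.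
  by rewrite ler_pdivrMr//; lra.
exists x => n; apply/ler_addgt0Pl => e e0.
have [N NP] := xP e e0; pose m := maxn n N.
rewrite (le_trans (ler_seminorm_dist aP _ (s m) _))//.
rewrite (seminormBC aP (s n)) addrC lerD ?tail' ?leq_maxl//.
by rewrite NP ?leq_maxr.
Qed.

Definition lipschitz_curve (C : R) (v : R -> X) :=
  forall s t, nrm (v t - v s) <= C * `|t - s|.

Variables (G : R -> X -> X -> R) (v0 : X) (C L : R).
Hypotheses (C0 : 0 <= C) (L0 : 0 < L)
  (G_lin : forall s x k y z, G s x (k *: y + z) = k * G s x y + G s x z)
  (G_bnd : forall s x w, `|G s x w| <= C * nrm w)
  (G_lip : forall s x y w, `|G s x w - G s y w| <= L * nrm (x - y) * nrm w)
  (G_meas : forall C' v w, lipschitz_curve C' v ->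
     measurable_fun [set: R] (fun s => G s (v s) w)).

(** Riesz is applied at each time separately, so only scalar functions are integrated and no
    vector-valued integral is needed. The Lipschitz constant of the result is the bound [C] of [G],
    whatever [v] is. *)
Lemma picard_step (v : R -> X) :
  (forall w, measurable_fun [set: R] (fun s => G s (v s) w)) ->
  exists y, lipschitz_curve C y /\
    forall t w, a (y t) w = a v0 w + \int[mu]_(s in `]0, t[) G s (v s) w.
Proof.
move=> mG.
have Gi w t : mu.-integrable `]0, t[ (EFin \o (fun s => G s (v s) w)).
  by apply: (@bounded_integrable_itv _ _ (C * nrm w)).
have step t : exists y, forall w,
    a y w = a v0 w + \int[mu]_(s in `]0, t[) G s (v s) w.
  apply: (riesz aP complete (C := nrm v0 + C * `|t|)) => [k x y|w].
    rewrite (ipDr aP) (ipZr aP) (eq_Rintegral _ (fun s _ => G_lin _ _ _ _ _)).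
    rewrite RintegralD//; last first.
      exact: (integrableZl _ k (Gi x t)).
    by rewrite RintegralZl//; ring.
  rewrite (le_trans (ler_normD _ _))// mulrDl lerD ?(cauchy_schwarz aP)//.
  have := Rintegral_itv_lip 0 t (mG w) (fun s => G_bnd s (v s) w).
  by rewrite (Rintegral_neg _ (lexx _)) !subr0 mulrAC.
have [y yP] := choice step; exists y; split=> // s t.
apply: (seminorm_le aP) => [|w]; first by rewrite mulr_ge0.
rewrite (ipBl aP) !yP opprD addrACA subrr add0r mulrAC.
apply: le_trans (ler_norm _) _.
exact: Rintegral_itv_lip (mG w) (fun s => G_bnd s (v s) w).
Qed.

(* The weight e^(2 L t) makes the integral operator a contraction of ratio 1/2. *)
Lemma picard_contraction C1 C2 (x1 x2 : R -> X) (y1 y2 : X) (t D : R) :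
  0 <= D -> lipschitz_curve C1 x1 -> lipschitz_curve C2 x2 ->
  (forall w, a y1 w = a v0 w + \int[mu]_(s in `]0, t[) G s (x1 s) w) ->
  (forall w, a y2 w = a v0 w + \int[mu]_(s in `]0, t[) G s (x2 s) w) ->
  (forall s, 0 < s < t -> nrm (x1 s - x2 s) <= D * expR (2 * L * s)) ->
  nrm (y1 - y2) <= D / 2 * expR (2 * L * `|t|).
Proof.
move=> D0 x1C x2C y1P y2P xD.
have L20 : 0 < 2 * L by rewrite mulr_gt0.
apply: (seminorm_le aP) => [|w].
  by rewrite mulr_ge0 ?divr_ge0 ?expR_ge0.
rewrite (ipBl aP) y1P y2P opprD addrACA subrr add0r.
have [t0|/ltW t0] := leP t 0.
  by rewrite !Rintegral_neg// subrr !mulr_ge0 ?seminorm_ge0 ?invr_ge0 ?expR_ge0.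
have m1 := G_meas w x1C; have m2 := G_meas w x2C.
rewrite -RintegralB//;
  [|exact: bounded_integrable_itv m1 (fun s => G_bnd s _ w)
   |exact: bounded_integrable_itv m2 (fun s => G_bnd s _ w)].
rewrite (ger0_norm t0) (_ : D / 2 * _ * _ = (L * D * nrm w) / (2 * L) * expR (2 * L * t)).
  apply: (@Rintegral_exp_le _ _ _ _ _ (C * nrm w + C * nrm w)) => //.
  - exact: measurable_funB.
  - by move=> s; rewrite (le_trans (ler_normB _ _))// lerD.
  - by rewrite !mulr_ge0 ?seminorm_ge0// ltW.
  - move=> s st; rewrite (le_trans (ler_norm _))// (le_trans (G_lip _ _ _ _))//.
    rewrite [leRHS](_ : _ = L * (D * expR (2 * L * s)) * nrm w); last by ring.
    by rewrite ler_wpM2r ?seminorm_ge0// ler_pM2l// xD.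
by field; rewrite gt_eqF.
Qed.

Lemma picard : exists v, lipschitz_curve C v /\
  forall t w, a (v t) w = a v0 w + \int[mu]_(s in `]0, t[) G s (v s) w.
Proof.
have cstC : lipschitz_curve C (fun=> v0).
  by move=> s t; rewrite subrr (seminorm0 aP) mulr_ge0.
(* [Phi] is Picard's operator on Lipschitz curves, the only ones along which [G] is known to be
   measurable, and the identity elsewhere. *)
have /choice[Phi PhiP] : forall v : R -> X, exists y, lipschitz_curve C v ->
    lipschitz_curve C y /\
    forall t w, a (y t) w = a v0 w + \int[mu]_(s in `]0, t[) G s (v s) w.
  move=> v; have [vC|nC] := pselect (lipschitz_curve C v); last by exists v.
  by have [y yP] := picard_step (fun w => G_meas w vC); exists y.
pose u n := iter n Phi (fun=> v0).
have uC n : lipschitz_curve C (u n).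
  by elim: n => [//|n /PhiP[]].
have u0 n : nrm (u n 0 - v0) = 0.
  case: n => [|n]; first by rewrite subrr (seminorm0 aP).
  apply/eqP; rewrite eq_le seminorm_ge0 andbT; apply: (seminorm_le aP) => // w.
  by rewrite (ipBl aP) (PhiP _ (uC n)).2 (Rintegral_neg _ (lexx _)) addr0 subrr mul0r.
pose D := C / (2 * L).
have L20 : 0 < 2 * L by rewrite mulr_gt0.
have D0 : 0 <= D by rewrite divr_ge0// ltW.
(* [D] is chosen for the first step: the curve moves by at most [C * |t|], and [2 L |t|] is below
   its exponential. Each later step halves the weighted distance. *)
have uD n t : nrm (u n.+1 t - u n t) <= D * expR (2 * L * `|t|) / 2 ^+ n.
  elim: n t => [|n IH] t.
    rewrite expr0 divr1 (le_trans (ler_seminorm_dist aP _ (u 1%N 0) _))//.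
    rewrite u0 addr0 (le_trans (uC 1%N _ _))// subr0 /D -mulrA ler_wpM2l//.
    rewrite ler_pdivlMl//; apply: le_trans (expR_ge1Dx _).
    by rewrite lerDr.
  have [e1 e2] := ((PhiP _ (uC n.+1)).2 t, (PhiP _ (uC n)).2 t).
  have := @picard_contraction _ _ (u n.+1) (u n) _ _ t (D / 2 ^+ n) _ (uC _) (uC _) e1 e2.
  have -> : D / 2 ^+ n / 2 * expR (2 * L * `|t|) = D * expR (2 * L * `|t|) / 2 ^+ n.+1.
    by rewrite exprS; field; rewrite lt0r_neq0// exprn_gt0.
  apply; first by rewrite divr_ge0// exprn_ge0.
  move=> s /andP[s0 _]; rewrite (le_trans (IH s))// gtr0_norm//.
  by rewrite mulrAC.
clearbody D.
have /choice[v vP] : forall t, exists x, forall n,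
    nrm (u n t - x) <= 2 * (D * expR (2 * L * `|t|)) / 2 ^+ n.
  by move=> t; exact: geometric_limit.
exists v; have vC : lipschitz_curve C v.
  move=> s t; pose K := 2 * (D * expR (2 * L * `|t|)) + 2 * (D * expR (2 * L * `|s|)).
  apply: (@ler_geometric _ _ K) => n; rewrite /K mulrDl.
  rewrite (le_trans (ler_seminorm_dist aP _ (u n t) _))//.
  have := ler_seminorm_dist aP (u n t) (u n s) (v s).
  rewrite (seminormBC aP (v t)).
  by have := vP t n; have := vP s n; have := uC n s t; lra.
split=> // t w; have [_ /(_ t) vE] := PhiP _ vC.
rewrite -vE; apply/eqP; rewrite eq_sym -subr_eq0 -(ipBl aP); apply/eqP.
apply: (seminorm_eq0 aP); apply/eqP; rewrite eq_le seminorm_ge0 andbT.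
(* The image of [v] is within [D exp / 2 ^+ n] of [u n.+1] by contraction, and [u n.+1] is within
   twice that of [v]; hence the 3. *)
pose K := 3 * (D * expR (2 * L * `|t|)).
apply: (@ler_geometric _ _ K) => n; rewrite add0r.
have e2 := (PhiP _ (uC n)).2 t.
have := @picard_contraction _ _ v (u n) _ _ t (2 * D / 2 ^+ n) _ vC (uC _) vE e2.
move=> /(_ _ _)/le_trans h.
rewrite (le_trans (ler_seminorm_dist aP _ (u n.+1 t) _))//.
have -> : K / 2 ^+ n = 2 * D / 2 ^+ n / 2 * expR (2 * L * `|t|) +
    2 * (D * expR (2 * L * `|t|)) / 2 ^+ n by rewrite /K; field; rewrite lt0r_neq0// exprn_gt0.
apply: lerD.
  apply: h; rewrite ?divr_ge0 ?mulr_ge0 ?exprn_ge0//.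
  move=> s /andP[s0 _]; rewrite (seminormBC aP) (le_trans (vP s n))// gtr0_norm//.
  by rewrite mulrA mulrAC.
rewrite (le_trans (vP t n.+1))// exprS invfM mulrCA ler_piMl//.
  by rewrite ?divr_ge0 ?mulr_ge0 ?exprn_ge0 ?expR_ge0.
by rewrite invf_le1// ler1n.
Qed.

(** The contraction, applied repeatedly to a crude bound on the distance, halves it each time. *)
Lemma picard_unique C1 C2 (x1 x2 : R -> X) (T : R) :
  lipschitz_curve C1 x1 -> lipschitz_curve C2 x2 ->
  (forall t w, 0 < t < T -> a (x1 t) w = a v0 w + \int[mu]_(s in `]0, t[) G s (x1 s) w) ->
  (forall t w, 0 < t < T -> a (x2 t) w = a v0 w + \int[mu]_(s in `]0, t[) G s (x2 s) w) ->
  forall t, 0 < t < T -> nrm (x1 t - x2 t) = 0.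
Proof.
move=> x1C x2C x1E x2E t tT.
(* The equations hold only for positive times, so the values at 0 enter the crude bound as they
   are. *)
pose D := nrm (x1 0 - x2 0) + (`|C1| + `|C2|) * `|T|.
have D0 : 0 <= D by rewrite addr_ge0 ?mulr_ge0 ?seminorm_ge0 ?addr_ge0.
have bnd n s : 0 < s < T -> nrm (x1 s - x2 s) <= D / 2 ^+ n * expR (2 * L * s).
  elim: n s => [|n IH] s sT.
    rewrite expr0 divr1 (@le_trans _ _ D)//; last first.
      rewrite ler_peMr//; apply: le_trans (expR_ge1Dx _).
    by rewrite lerDl !mulr_ge0// ltW//; case/andP: sT.
    have /andP[s0 /ltW sT'] := sT; have T0 := le_trans (ltW s0) sT'.
    have := ler_seminorm_dist aP (x1 s) (x1 0) (x2 s).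
    have := ler_seminorm_dist aP (x1 0) (x2 0) (x2 s).
    have h C' x : lipschitz_curve C' x -> nrm (x s - x 0) <= `|C'| * `|T|.
      move=> /(_ 0 s) /le_trans; apply.
      rewrite subr0 (@le_trans _ _ (`|C'| * `|s|)) ?ler_wpM2r ?ler_norm//.
      by rewrite ler_wpM2l// ger0_norm ?(ltW s0)// ger0_norm.
    have := h _ _ x1C; have := h _ _ x2C; rewrite (seminormBC aP (x2 s)) /D; lra.
  have /andP[s0 sT'] := sT.
  have := picard_contraction (t := s) (D := D / 2 ^+ n) _ x1C x2C
    (fun w => x1E s w sT) (fun w => x2E s w sT).
  rewrite (gtr0_norm s0) (_ : D / 2 ^+ n.+1 = D / 2 ^+ n / 2); last first.
    by rewrite exprS; field; rewrite lt0r_neq0// exprn_gt0.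
  apply; first by rewrite divr_ge0 ?exprn_ge0.
  by move=> r /andP[r0 rs]; apply: IH; rewrite r0 (lt_trans rs).
apply/eqP; rewrite eq_le seminorm_ge0 andbT.
apply: (@ler_geometric _ _ (D * expR (2 * L * t))) => n.
by rewrite add0r mulrAC bnd.
Qed.
End picard.

(** * Energy estimate and truncation *)

Section semilinear.
Context {R : realType} {X : lmodType R}.
Variable a : X -> X -> R.
Hypotheses (aP : semi_inner a) (complete : seq_complete a).
Local Notation nrm := (seminorm a).
Local Notation mu := (@lebesgue_measure R).

Section energy.
Variables (G : R -> X -> X -> R) (v0 : X) (C L k : R) (v : R -> X).
Hypotheses (C0 : 0 <= C) (L0 : 0 <= L) (k0 : 0 <= k)
  (G_bnd : forall s x w, `|G s x w| <= C * nrm w)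
  (G_lip : forall s x y w, `|G s x w - G s y w| <= L * nrm (x - y) * nrm w)
  (G_meas : forall w, measurable_fun [set: R] (fun s => G s (v s) w))
  (G_energy : forall s x, G s x x <= k * (1 + nrm x ^+ 2))
  (v_lip : lipschitz_curve a C v)
  (v_eq : forall t w, a (v t) w = a v0 w + \int[mu]_(s in `]0, t[) G s (v s) w).

Let energy_step (T s t : R) : 0 <= s -> s <= t -> t <= T ->
  1 + nrm (v t) ^+ 2 <= expR (2 * k * (t - s)) * (1 + nrm (v s) ^+ 2) +
     (2 * L * C * (nrm v0 + C * T) + C ^+ 2) * (t - s) ^+ 2.
Proof.
move=> s0 st tT; set h := t - s; have h0 : 0 <= h by rewrite subr_ge0.
have v00 : nrm (v 0 - v0) = 0.
  apply/eqP; rewrite eq_le seminorm_ge0 andbT; apply: (seminorm_le aP) => // w.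
  by rewrite (ipBl aP) v_eq (Rintegral_neg _ (lexx _)) addr0 subrr mul0r.
have vs : nrm (v s) <= nrm v0 + C * T.
  have := ler_seminorm_dist aP (v s) v0 0; rewrite !subr0 => /le_trans; apply.
  rewrite addrC lerD2l (le_trans (ler_seminorm_dist aP _ (v 0) _))// v00 addr0.
  rewrite (le_trans (v_lip _ _))// subr0 ger0_norm// ler_wpM2l//.
  exact: le_trans tT.
have incr : nrm (v t - v s) <= C * h.
  by rewrite (le_trans (v_lip _ _))// ger0_norm.
have work : a (v t - v s) (v s) <=
    (k * (1 + nrm (v s) ^+ 2) + L * (C * h) * nrm (v s)) * h.
  rewrite (ipBl aP) !v_eq opprD addrACA subrr add0r.
  rewrite (Rintegral_itv_diff s0 st (G_meas _) (fun r => G_bnd r _ _)).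
  apply: (Rintegral_itv_le st (G_meas _) (fun r => G_bnd r _ _)) => r /andP[sr rt].
  have := G_lip r (v r) (v s) (v s); have := G_energy r (v s).
  have /ler_normlP[_] := lexx `|G r (v r) (v s) - G r (v s) (v s)|.
  have : L * nrm (v r - v s) * nrm (v s) <= L * (C * h) * nrm (v s).
    rewrite ler_wpM2r ?seminorm_ge0// ler_wpM2l// (le_trans (v_lip _ _))//.
    by rewrite ler_wpM2l// gtr0_norm ?subr_gt0// lerD2r ltW.
  by lra.
have -> : nrm (v t) ^+ 2 = nrm (v s) ^+ 2 + 2 * a (v t - v s) (v s) + nrm (v t - v s) ^+ 2.
  by rewrite !(sqr_seminorm aP) !(ipBl aP) !(ipBr aP) (ipC aP (v s) (v t)); ring.
have : nrm (v t - v s) ^+ 2 <= C ^+ 2 * h ^+ 2.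
  by rewrite -exprMn ler_pXn2r ?nnegrE ?seminorm_ge0 ?mulr_ge0.
have : L * (C * h) * nrm (v s) * h <= L * C * (nrm v0 + C * T) * h ^+ 2.
  rewrite [leLHS](_ : _ = L * C * nrm (v s) * h ^+ 2); last by ring.
  by rewrite ler_wpM2r ?sqr_ge0// ler_wpM2l// mulr_ge0.
have : (1 + 2 * k * h) * (1 + nrm (v s) ^+ 2) <= expR (2 * k * h) * (1 + nrm (v s) ^+ 2).
  by rewrite ler_wpM2r ?expR_ge1Dx// addr_ge0// sqr_ge0.
by nra.
Qed.

(** With [n] equal steps the quadratic defects add up to order [1 / n], while the factors
    [1 + 2 k h], bounded by exponentials, multiply to the stated one. *)
Lemma energy_bound (t : R) : 0 <= t ->
  1 + nrm (v t) ^+ 2 <= expR (2 * k * t) * (1 + nrm v0 ^+ 2).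
Proof.
move=> t0; set E := 2 * L * C * (nrm v0 + C * t) + C ^+ 2.
have E0 : 0 <= E by rewrite addr_ge0 ?sqr_ge0// !mulr_ge0// addr_ge0 ?seminorm_ge0// mulr_ge0.
have v00 : nrm (v 0) = nrm v0.
  apply/eqP; rewrite -(eqrXn2 (n := 2)) ?seminorm_ge0// !(sqr_seminorm aP).
  by rewrite v_eq (ipC aP) v_eq !(Rintegral_neg _ (lexx _)) !addr0.
have grid (n j : nat) (h := t / n%:R) : (0 < n)%N -> (j <= n)%N ->
    1 + nrm (v (j%:R * h)) ^+ 2 <=
    expR (2 * k * (j%:R * h)) * (1 + nrm v0 ^+ 2 + j%:R * (E * h ^+ 2)).
  move=> n0; have h0 : 0 <= h by rewrite divr_ge0.
  elim: j => [|j IH] jn; first by rewrite !mul0r mulr0 expR0 mul1r addr0 v00.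
  have := @energy_step t (j%:R * h) (j.+1%:R * h).
  rewrite -mulrBl -natrB// subSnn mul1r -/E.
  move=> /(_ _ _ _)/le_trans; apply.
  - by rewrite mulr_ge0.
  - by rewrite ler_wpM2r// ler_nat.
  - by rewrite /h mulrCA ler_piMr// ler_pdivrMr ?ltr0n// mul1r ler_nat.
  - rewrite (le_trans (y := expR (2 * k * h) * (expR (2 * k * (j%:R * h)) * (1 + nrm v0 ^+ 2 + j%:R * (E * h ^+ 2))) + E * h ^+ 2))//.
      by rewrite lerD2r ler_wpM2l ?expR_ge0// IH// ltnW.
    rewrite mulrA -expRD (_ : 2 * k * h + 2 * k * (j%:R * h) = 2 * k * (j.+1%:R * h)); last first.
      by rewrite -(natr1 j); ring.
    rewrite (_ : j.+1%:R * (E * h ^+ 2) = j%:R * (E * h ^+ 2) + E * h ^+ 2); last first.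
      by rewrite -(natr1 j); ring.
    rewrite [X in _ <= _ * X]addrA [leRHS]mulrDr lerD2l ler_peMl ?mulr_ge0 ?sqr_ge0//.
    apply: le_trans (expR_ge1Dx _).
    by rewrite lerDl !mulr_ge0.
(* The number of steps is a power of two so that the remaining error has the geometric form expected
   here. *)
apply: (@ler_geometric _ _ _ (expR (2 * k * t) * (E * t ^+ 2))) => m.
have n0 : (0 < 2 ^ m)%N by rewrite expn_gt0.
have := grid _ _ n0 (leqnn _); rewrite mulrC divfK; last by rewrite pnatr_eq0 -lt0n.
move/le_trans; apply; rewrite mulrDr lerD2l natrX le_eqVlt; apply/orP; left; apply/eqP; field.
by apply: lt0r_neq0; rewrite exprn_gt0.
Qed.
End energy.

Section truncation.
Variable r : R.
Hypothesis r0 : 0 < r.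

(** The radial retraction onto the ball of radius [r], with the two cases merged into a maximum. *)
Definition truncate (x : X) : X := (r / Num.max r (nrm x)) *: x.

Let max_gt0 x : 0 < Num.max r (nrm x).
Proof. by rewrite lt_max r0. Qed.

Let ratio x : 0 <= r / Num.max r (nrm x) <= 1.
Proof.
rewrite divr_ge0 ?(ltW r0) ?(ltW (max_gt0 x))//= ler_pdivrMr ?max_gt0//.
by rewrite mul1r le_max lexx.
Qed.

Let ratio' x : nrm x / Num.max r (nrm x) <= 1.
Proof. by rewrite ler_pdivrMr ?max_gt0// mul1r le_max lexx orbT. Qed.

Lemma truncate_id x : nrm x <= r -> truncate x = x.
Proof. by move=> xr; rewrite /truncate max_l// divff ?scale1r// gt_eqF. Qed.

Lemma seminorm_truncate x : nrm (truncate x) <= r.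
Proof.
have /andP[p0 _] := ratio x; rewrite (seminormZ aP) (ger0_norm p0).
by rewrite mulrAC -mulrA ler_piMr ?(ltW r0)// ratio'.
Qed.

(** Each term of the splitting [(r / p) (x - y) + (r / p - r / q) y] contributes one [nrm (x - y)],
    the second because [max r] of the norm is 1-Lipschitz. *)
Lemma truncate_lipschitz x y : nrm (truncate x - truncate y) <= 2 * nrm (x - y).
Proof.
rewrite /truncate; set p := Num.max r (nrm x); set q := Num.max r (nrm y).
have p0 : 0 < p := max_gt0 x; have q0 : 0 < q := max_gt0 y.
have -> : (r / p) *: x - (r / q) *: y = (r / p) *: (x - y) + (r / p - r / q) *: y.
  by rewrite scalerBr scalerBl addrA subrK.
have /andP[rp0 rp1] : 0 <= r / p <= 1 := ratio x.
have yq : nrm y / q <= 1 := ratio' y.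
rewrite (le_trans (ler_seminormD aP _ _))// !(seminormZ aP) mulr_natl mulr2n lerD//.
  by rewrite ger0_norm// ler_piMl// seminorm_ge0.
have -> : r / p - r / q = r / p * ((q - p) / q).
  by field; rewrite !lt0r_neq0.
rewrite normrM (ger0_norm rp0) normrM normfV (gtr0_norm q0).
rewrite (_ : _ * _ * _ = (r / p) * (nrm y / q) * `|q - p|); last by ring.
have yq0 : 0 <= nrm y / q by rewrite divr_ge0 ?seminorm_ge0// ltW.
rewrite -[leRHS]mul1r; apply: ler_pM; rewrite ?(mulr_ge0 rp0)//; first exact: mulr_ile1.
apply: le_trans (ler_dist_seminorm aP _ _); rewrite /p /q.
have [rx|rx] := leP r (nrm x); have [ry|ry] := leP r (nrm y).
- by rewrite distrC.
- by rewrite distrC; have := seminorm_ge0 a x; rewrite !ger0_norm; lra.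
- by rewrite [leRHS]distrC !ger0_norm; lra.
- by rewrite subrr normr0.
Qed.
End truncation.
End semilinear.

(** * Semilinear equations with a skew quadratic term *)

Lemma lipschitz_measurable {R : realType} (f : R -> R) (C : R) :
  (forall s t, `|f t - f s| <= C * `|t - s|) -> measurable_fun [set: R] f.
Proof.
move=> fC; apply: continuous_measurable_fun => x.
apply/cvgrPdist_le => e e0; near=> y.
rewrite distrC (le_trans (fC x y))// (le_trans (y := (`|C| + 1) * `|y - x|))//.
  by rewrite ler_wpM2r// (le_trans (ler_norm C))// lerDl.
rewrite -ler_pdivlMl ?ltr_wpDl//; near: y.
exists ((`|C| + 1)^-1 * e) => /=; first by rewrite mulr_gt0 ?invr_gt0 ?ltr_wpDl.
by move=> y; rewrite /ball_/= distrC => /ltW.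
Unshelve. all: by end_near. Qed.

Section semilinear_global.
Context {R : realType} {X : lmodType R}.
Variable a : X -> X -> R.
Hypotheses (aP : semi_inner a) (complete : seq_complete a).
Local Notation nrm := (seminorm a).
Local Notation mu := (@lebesgue_measure R).

Variables (L : R -> X -> R) (B : X -> X -> X -> R) (K : X -> X -> R) (CB CK : R).
Hypotheses
  (L_lin : forall s k y z, L s (k *: y + z) = k * L s y + L s z)
  (L_meas : forall w, measurable_fun [set: R] (fun s => L s w))
  (L_bnd : forall T : R, exists M : R, forall (s : R) w, s < T -> `|L s w| <= M * nrm w)
  (B_lin1 : forall k x y z w, B (k *: x + y) z w = k * B x z w + B y z w)
  (B_lin2 : forall k x y z w, B z (k *: x + y) w = k * B z x w + B z y w)
  (B_lin3 : forall k x y z w, B z w (k *: x + y) = k * B z w x + B z w y)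
  (B_bnd : forall x y w, `|B x y w| <= CB * nrm x * nrm y * nrm w)
  (B_skew : forall x, B x x x = 0)
  (K_lin1 : forall k x y w, K (k *: x + y) w = k * K x w + K y w)
  (K_lin2 : forall k x y w, K w (k *: x + y) = k * K w x + K w y)
  (K_bnd : forall x w, `|K x w| <= CK * nrm x * nrm w)
  (CB0 : 0 <= CB) (CK0 : 0 <= CK).

Definition rhs s x w := L s w + B x x w + K x w.

Let BB1 x y z w : B (x - y) z w = B x z w - B y z w.
Proof. by rewrite -scaleN1r addrC B_lin1 mulN1r addrC. Qed.

Let BB2 x y z w : B z (x - y) w = B z x w - B z y w.
Proof. by rewrite -scaleN1r addrC B_lin2 mulN1r addrC. Qed.

Let KB x y w : K (x - y) w = K x w - K y w.
Proof. by rewrite -scaleN1r addrC K_lin1 mulN1r addrC. Qed.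

Lemma rhs_lipschitz s x y w r : nrm x <= r -> nrm y <= r ->
  `|rhs s x w - rhs s y w| <= (2 * CB * r + CK) * nrm (x - y) * nrm w.
Proof.
move=> xr yr; have -> : rhs s x w - rhs s y w =
    B (x - y) x w + B y (x - y) w + K (x - y) w.
  by rewrite /rhs BB1 BB2 KB; ring.
have -> : (2 * CB * r + CK) * nrm (x - y) * nrm w =
  CB * nrm (x - y) * r * nrm w + CB * r * nrm (x - y) * nrm w +
  CK * nrm (x - y) * nrm w by ring.
apply: le_trans (ler_normD _ _) _; apply: lerD (K_bnd _ _).
apply: le_trans (ler_normD _ _) _.
apply: lerD; apply: le_trans (B_bnd _ _ _) _; rewrite !(ler_wpM2r (seminorm_ge0 _ _))//.
  by rewrite ler_wpM2l// mulr_ge0// seminorm_ge0.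
by rewrite ler_wpM2l.
Qed.

(** As the estimates involve only the norm, [rhs] does not see null vectors; this replaces passing
    to the quotient. *)
Lemma rhs_eq0 s x y w : nrm (x - y) = 0 -> rhs s x w = rhs s y w.
Proof.
move=> xy; apply/eqP; rewrite -subr_eq0 -normr_eq0 eq_le normr_ge0 andbT.
have := @rhs_lipschitz s x y w (Num.max (nrm x) (nrm y)).
by rewrite xy mulr0 mul0r; apply; rewrite le_max lexx ?orbT.
Qed.

Lemma rhs_lin s x k y z : rhs s x (k *: y + z) = k * rhs s x y + rhs s x z.
Proof. by rewrite /rhs L_lin B_lin3 K_lin2; ring. Qed.

Section truncated.
Variables (T r M : R).
Hypotheses (r0 : 0 < r) (M0 : 0 <= M)
  (L_bndT : forall s w, s < T -> `|L s w| <= M * nrm w).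

(** Picard's hypotheses are global: the forcing, bounded only up to finite times, is switched off
    after [T], and the state is retracted to a ball where the quadratic term is Lipschitz. *)
Definition truncated_rhs s x w :=
  (if s < T then L s w else 0) +
  (B (truncate a r x) (truncate a r x) w + K (truncate a r x) w).

Let C := M + CB * r * r + CK * r.

Let C0 : 0 <= C.
Proof. by rewrite /C !addr_ge0// ?mulr_ge0// ltW. Qed.

Lemma truncated_rhsE s x w : s < T -> nrm x <= r -> truncated_rhs s x w = rhs s x w.
Proof. by move=> sT xr; rewrite /truncated_rhs sT truncate_id// addrA. Qed.

Let G_lin s x k y z :
  truncated_rhs s x (k *: y + z) = k * truncated_rhs s x y + truncated_rhs s x z.
Proof.
by rewrite /truncated_rhs B_lin3 K_lin2; case: ifP => _; rewrite ?L_lin; ring.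
Qed.

Let G_bnd s x w : `|truncated_rhs s x w| <= C * nrm w.
Proof.
have tr := seminorm_truncate aP r0 x; have tr0 := seminorm_ge0 a (truncate a r x).
have w0 := seminorm_ge0 a w.
rewrite /C !mulrDl -addrA; apply: le_trans (ler_normD _ _) _; apply: lerD.
  by case: ifP => sT; [exact: L_bndT|rewrite normr0 mulr_ge0].
apply: le_trans (ler_normD _ _) _; apply: lerD.
  apply: le_trans (B_bnd _ _ _) _; rewrite ler_wpM2r//.
  by rewrite ler_pM// ?mulr_ge0// ler_wpM2l.
by apply: le_trans (K_bnd _ _) _; rewrite ler_wpM2r// ler_wpM2l.
Qed.

Let Lam := 2 * (2 * CB * r + CK) + 1.

Let Lam0 : 0 < Lam.
Proof. by rewrite ltr_wpDl// mulr_ge0// addr_ge0// !mulr_ge0// ltW. Qed.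

Let G_lip s x y w :
  `|truncated_rhs s x w - truncated_rhs s y w| <= Lam * nrm (x - y) * nrm w.
Proof.
have -> : truncated_rhs s x w - truncated_rhs s y w =
    rhs s (truncate a r x) w - rhs s (truncate a r y) w.
  by rewrite /truncated_rhs /rhs; case: ifP => _; ring.
apply: le_trans (rhs_lipschitz _ _ (seminorm_truncate aP r0 x) (seminorm_truncate aP r0 y)) _.
rewrite ler_wpM2r ?seminorm_ge0//.
have q0 : 0 <= 2 * CB * r + CK by rewrite addr_ge0// !mulr_ge0// ltW.
rewrite (le_trans (ler_wpM2l q0 (truncate_lipschitz aP r0 x y)))//.
rewrite /Lam [leRHS](_ : _ = (2 * CB * r + CK) * (2 * nrm (x - y)) + nrm (x - y)).
  by rewrite lerDl seminorm_ge0.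
by ring.
Qed.

Lemma truncated_rhs_measurable C' v w : lipschitz_curve a C' v ->
  measurable_fun [set: R] (fun s => truncated_rhs s (v s) w).
Proof.
move=> vC; apply: measurable_funD.
  apply: measurable_fun_ifT => //; apply: measurable_fun_ltr => //.
have h s t : `|(B (truncate a r (v t)) (truncate a r (v t)) w + K (truncate a r (v t)) w)
   - (B (truncate a r (v s)) (truncate a r (v s)) w + K (truncate a r (v s)) w)| <=
   Lam * C' * nrm w * `|t - s|.
  have := G_lip 0 (v t) (v s) w; rewrite /truncated_rhs.
  rewrite (_ : _ - _ = (B (truncate a r (v t)) (truncate a r (v t)) w +
     K (truncate a r (v t)) w) - (B (truncate a r (v s)) (truncate a r (v s)) w +
     K (truncate a r (v s)) w)); last by ring.
  move/le_trans; apply; rewrite [leRHS](_ : _ = Lam * (C' * `|t - s|) * nrm w); last by ring.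
  by rewrite ler_wpM2r ?seminorm_ge0// ler_wpM2l// ltW.
exact: lipschitz_measurable h.
Qed.

Let k := M + CK.

Let G_energy s x : truncated_rhs s x x <= k * (1 + nrm x ^+ 2).
Proof.
rewrite /truncated_rhs; set t := truncate a r x.
have x0 := seminorm_ge0 a x.
(* The cancellation survives the truncation: [t] is a positive multiple of [x], so [B t t x] is a
   multiple of [B t t t]. *)
have -> : B t t x = 0.
  have q0 : 0 < r / Num.max r (nrm x) by rewrite divr_gt0// lt_max r0.
  have : B t t t = r / Num.max r (nrm x) * B t t x.
    by rewrite {3}/t /truncate -[_ *: x]addr0 B_lin3; have := B_lin3 1 0 0 t t;
       rewrite scale1r addr0 mul1r; lra.
  rewrite B_skew => /esym/eqP; rewrite mulf_eq0 gt_eqF//= => /eqP ->//.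
have tx : nrm t <= nrm x.
  rewrite (seminormZ aP) ger0_norm ?divr_ge0 ?(ltW r0)//; last by rewrite le_max (ltW r0).
  by rewrite ler_piMl// ler_pdivrMr ?lt_max ?r0// mul1r le_max lexx.
have : K t x <= CK * nrm x * nrm x.
  rewrite (le_trans (ler_norm _))// (le_trans (K_bnd _ _))// ler_wpM2r//.
  by rewrite ler_wpM2l.
have : (if s < T then L s x else 0) <= M * nrm x.
  by case: ifP => sT; [exact: le_trans (ler_norm _) (L_bndT _ sT)|rewrite mulr_ge0].
have : M * nrm x <= M * (1 + nrm x ^+ 2) by rewrite ler_wpM2l//; have := sqr_ge0 (nrm x - 1); nra.
by rewrite /k mulrDl mulrDr; move: CK0; nra.
Qed.

(** The growth rate involves [M] and [CK] but not the radius [r], which can thus be fixed afterwards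
    in terms of this bound. *)
Lemma truncated_solution (v0 : X) : exists v, lipschitz_curve a C v /\
  (forall t w, a (v t) w = a v0 w + \int[mu]_(s in `]0, t[) truncated_rhs s (v s) w) /\
  forall t, 0 <= t -> 1 + nrm (v t) ^+ 2 <= expR (2 * (M + CK) * t) * (1 + nrm v0 ^+ 2).
Proof.
have [v [vC vE]] := picard aP complete v0 C0 Lam0 G_lin G_bnd G_lip truncated_rhs_measurable.
exists v; split=> //; split=> // t t0.
apply: (energy_bound aP C0 (ltW Lam0) _ G_bnd G_lip _ G_energy vC vE t0).
  by rewrite addr_ge0.
by move=> w; exact: truncated_rhs_measurable vC.
Qed.

Lemma truncated_unique (v0 : X) C1 C2 (x1 x2 : R -> X) S :
  lipschitz_curve a C1 x1 -> lipschitz_curve a C2 x2 ->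
  (forall t w, 0 < t < S ->
    a (x1 t) w = a v0 w + \int[mu]_(s in `]0, t[) truncated_rhs s (x1 s) w) ->
  (forall t w, 0 < t < S ->
    a (x2 t) w = a v0 w + \int[mu]_(s in `]0, t[) truncated_rhs s (x2 s) w) ->
  forall t, 0 < t < S -> nrm (x1 t - x2 t) = 0.
Proof. exact: (picard_unique aP Lam0 G_bnd G_lip truncated_rhs_measurable). Qed.

End truncated.

Lemma lipschitz_curve_bounded C' (x : R -> X) (s T : R) : lipschitz_curve a C' x -> 0 < s < T ->
  nrm (x s) <= nrm (x 0) + `|C'| * `|T|.
Proof.
move=> xC /andP[s0 sT]; have := ler_seminormD aP (x s - x 0) (x 0).
rewrite subrK addrC => /le_trans; apply; rewrite lerD2l (le_trans (xC _ _))//.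
rewrite subr0 (le_trans (y := `|C'| * `|s|)) ?ler_wpM2r ?ler_norm//.
by rewrite ler_wpM2l// gtr0_norm// gtr0_norm ?(ltW sT)// (lt_trans s0).
Qed.

Lemma rhs_measurable C' (x : R -> X) (T : R) w : lipschitz_curve a C' x ->
  measurable_fun `]0, T[ (fun s => rhs s (x s) w).
Proof.
move=> xC; pose r := nrm (x 0) + `|C'| * `|T| + 1.
have r0 : 0 < r by rewrite ltr_wpDl// addr_ge0 ?seminorm_ge0 ?mulr_ge0.
apply: (eq_measurable_fun (fun s => truncated_rhs T r s (x s) w)).
  move=> s; rewrite inE /= in_itv /= => /andP[s0 sT]; rewrite truncated_rhsE//.
  by rewrite (le_trans (lipschitz_curve_bounded xC (T := T) _)) ?s0// lerDl.
by apply: measurable_funTS; exact: truncated_rhs_measurable xC.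
Qed.

Lemma semilinear_local (v0 : X) (T : R) : 0 < T ->
  exists v C, lipschitz_curve a C v /\
    forall t w, 0 < t < T -> a (v t) w = a v0 w + \int[mu]_(s in `]0, t[) rhs s (v s) w.
Proof.
move=> T0; have [M MP] := L_bnd T.
pose N : R := `|M|; have L_bndT s w : s < T -> `|L s w| <= N * nrm w.
  by move=> /MP h; rewrite (le_trans (h w))// ler_wpM2r ?seminorm_ge0// ler_norm.
(* This is the a priori bound on [1 + nrm (v t) ^+ 2] at time [T]. It dominates [nrm (v t)] as well,
   so the truncation is inactive before [T]. *)
pose r := expR (2 * (N + CK) * T) * (1 + nrm v0 ^+ 2).
have r0 : 0 < r by rewrite mulr_gt0 ?expR_gt0// ltr_pwDl// sqr_ge0.
have N0 : 0 <= N by exact: normr_ge0.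
have [v [vC [vE vB]]] := truncated_solution r0 N0 L_bndT v0.
exists v; eexists; split; first exact: vC.
move=> t w /andP[t0 tT]; rewrite vE; congr (_ + _).
apply: eq_Rintegral => s; rewrite inE /= in_itv /= => /andP[s0 st].
have sT : s < T := lt_trans st tT.
rewrite truncated_rhsE//.
have := vB s (ltW s0); have : expR (2 * (N + CK) * s) * (1 + nrm v0 ^+ 2) <= r.
  rewrite ler_wpM2r ?addr_ge0 ?sqr_ge0// ler_expR ler_wpM2l ?(ltW sT)//.
  by rewrite mulr_ge0// addr_ge0.
by have := sqr_ge0 (nrm (v s) - 1); nra.
Qed.

Lemma semilinear_unique (v0 : X) C1 C2 (x1 x2 : R -> X) (T : R) :
  lipschitz_curve a C1 x1 -> lipschitz_curve a C2 x2 ->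
  (forall t w, 0 < t < T -> a (x1 t) w = a v0 w + \int[mu]_(s in `]0, t[) rhs s (x1 s) w) ->
  (forall t w, 0 < t < T -> a (x2 t) w = a v0 w + \int[mu]_(s in `]0, t[) rhs s (x2 s) w) ->
  forall t, 0 < t < T -> nrm (x1 t - x2 t) = 0.
Proof.
move=> x1C x2C x1E x2E.
have [M MP] := L_bnd T.
pose N : R := `|M|; have L_bndT s w : s < T -> `|L s w| <= N * nrm w.
  by move=> /MP h; rewrite (le_trans (h w))// ler_wpM2r ?seminorm_ge0// ler_norm.
(* A Lipschitz curve is bounded on []0, T[]; with this radius both curves also solve the truncated
   equation. *)
pose r : R := 1 + (nrm (x1 0) + `|C1| * `|T|) + (nrm (x2 0) + `|C2| * `|T|).
have b0 (C' : R) (x : R -> X) : 0 <= nrm (x 0) + `|C'| * `|T|.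
  by rewrite addr_ge0 ?seminorm_ge0 ?mulr_ge0.
have r0 : 0 < r by rewrite /r ltr_pwDl// ltr_pwDl.
have eqT C' (x : R -> X) : lipschitz_curve a C' x -> nrm (x 0) + `|C'| * `|T| <= r ->
  (forall t w, 0 < t < T -> a (x t) w = a v0 w + \int[mu]_(s in `]0, t[) rhs s (x s) w) ->
  forall t w, 0 < t < T -> a (x t) w = a v0 w + \int[mu]_(s in `]0, t[) truncated_rhs T r s (x s) w.
  move=> xC xr xE t w tT; rewrite xE//; congr (_ + _).
  apply: eq_Rintegral => s; rewrite inE /= in_itv /= => /andP[s0 st].
  have sT : s < T by apply: lt_trans st _; case/andP: tT.
  by rewrite truncated_rhsE// (le_trans (lipschitz_curve_bounded xC (T := T) _))// s0.
have e1 := eqT _ _ x1C _ x1E; have e2 := eqT _ _ x2C _ x2E.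
apply: (truncated_unique r0 _ L_bndT x1C x2C (e1 _) (e2 _)); first exact: normr_ge0.
  by have := b0 C2 x2; rewrite /r; lra.
by have := b0 C1 x1; rewrite /r; lra.
Qed.

(** The value at [t] is taken from the local solution on []0, n + 1[] with [n] the integer part of
    [t]. Local solutions agree only up to norm 0, which is why the statement also provides, for each
    [T], a genuinely Lipschitz representative [vT]. *)
Theorem semilinear_global (v0 : X) : exists v : R -> X, forall T : R, 0 < T ->
  exists vT C, [/\ lipschitz_curve a C vT,
    forall t, 0 < t < T -> nrm (v t - vT t) = 0 &
    forall t w, 0 < t < T -> a (vT t) w = a v0 w + \int[mu]_(s in `]0, t[) rhs s (vT s) w].
Proof.
have /choice[u uP] : forall n : nat, exists v, exists C, lipschitz_curve a C v /\
    forall t w, 0 < t < n.+1%:R -> a (v t) w = a v0 w + \int[mu]_(s in `]0, t[) rhs s (v s) w.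
  by move=> n; exact: semilinear_local.
exists (fun t => u (Num.truncn t) t) => T T0.
have Tn : T < (Num.truncn T).+1%:R := truncnS_gt _.
have [C [uC uE]] := uP (Num.truncn T).
exists (u (Num.truncn T)), C; split=> //; last first.
  by move=> t w /andP[t0 tT]; apply: uE; rewrite t0 (lt_trans tT).
move=> t /andP[t0 tT]; have [C' [uC' uE']] := uP (Num.truncn t).
pose S := Num.min (Num.truncn T).+1%:R (Num.truncn t).+1%:R : R.
apply: (semilinear_unique (T := S) uC' uC).
- by move=> s w /andP[s0]; rewrite lt_min => /andP[_ sS]; apply: uE'; rewrite s0.
- by move=> s w /andP[s0]; rewrite lt_min => /andP[sS _]; apply: uE; rewrite s0.
- by rewrite t0 lt_min (lt_trans tT)//= truncnS_gt.
Qed.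
End semilinear_global.

(** * Square-integrable functions *)

(** The abstract theory runs on a module, whereas [V] is a predicate on fields; [elements] below
    turns such a predicate into a module. *)
Record submodule (R : realType) (E : lmodType R) := Submodule {
  carrier :> E -> Prop ;
  carrier_closed : submod_closed (mem (carrier : set E) : {pred E}) }.

Section elements.
Variables (R : realType) (E : lmodType R) (S : submodule E).

Definition carrier_pred : {pred E} := fun x => x \in (carrier S : set E).

Fact carrier_pred_closed : submod_closed carrier_pred.
Proof. exact: carrier_closed. Qed.

HB.instance Definition _ :=
  GRing.isSubmodClosed.Build R E carrier_pred carrier_pred_closed.

Definition elements := {x : E | x \in carrier_pred}.

HB.instance Definition _ := [isSub of elements for @sval _ _].
HB.instance Definition _ := [Choice of elements by <:].
HB.instance Definition _ := [SubChoice_isSubLmodule of elements by <:].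

Lemma elementsP (x : elements) : S (val x).
Proof. by have := valP x; rewrite inE. Qed.

Definition to_elements x (Sx : S x) : elements := exist _ x (mem_set Sx).

Lemma submoduleP (k : R) x y : S x -> S y -> S (k *: x + y).
Proof.
move=> /mem_set Sx /mem_set Sy; apply/set_mem.
exact: (carrier_closed S).2.
Qed.

Lemma submodule0 : S 0.
Proof. exact/set_mem/(carrier_closed S).1. Qed.

Lemma submoduleZ (k : R) x : S x -> S (k *: x).
Proof. by move=> Sx; rewrite -[_ *: _]addr0; exact/submoduleP/submodule0. Qed.

Lemma submoduleB x y : S x -> S y -> S (x - y).
Proof. by move=> Sx Sy; rewrite -scaleN1r addrC; exact: submoduleP. Qed.

Section inner.
Variable b : E -> E -> R.

(** Relative to [S], because integral forms are bilinear only where the integrals converge. *)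
Record semi_inner_in : Prop := SemiInnerIn {
  in_C : forall x y, S x -> S y -> b x y = b y x ;
  in_linear : forall k x y z, S x -> S y -> S z ->
    b (k *: x + y) z = k * b x z + b y z ;
  in_ge0 : forall x, S x -> 0 <= b x x }.

Hypothesis bP : semi_inner_in.

Definition restrict_form (x y : elements) := b (val x) (val y).

Lemma restrict_form_semi_inner : semi_inner restrict_form.
Proof.
split.
- by move=> x y; apply: (in_C bP); exact: elementsP.
- by move=> k x y z; apply: (in_linear bP); exact: elementsP.
- by move=> x; apply: (in_ge0 bP); exact: elementsP.
Qed.

Lemma cauchy_schwarz_in x y : S x -> S y ->
  `|b x y| <= seminorm b x * seminorm b y.
Proof.
move=> Sx Sy.
exact: cauchy_schwarz restrict_form_semi_inner (to_elements Sx) (to_elements Sy).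
Qed.

Lemma ler_seminormD_in x y : S x -> S y ->
  seminorm b (x + y) <= seminorm b x + seminorm b y.
Proof.
move=> Sx Sy.
exact: ler_seminormD restrict_form_semi_inner (to_elements Sx) (to_elements Sy).
Qed.

Lemma seminormBC_in x y : S x -> S y -> seminorm b (x - y) = seminorm b (y - x).
Proof.
move=> Sx Sy.
exact: seminormBC restrict_form_semi_inner (to_elements Sx) (to_elements Sy).
Qed.

Lemma seminormZ_in k x : S x -> seminorm b (k *: x) = `|k| * seminorm b x.
Proof.
by move=> Sx; exact: seminormZ restrict_form_semi_inner k (to_elements Sx).
Qed.

Lemma ler_seminorm_dist_in x y z : S x -> S y -> S z ->
  seminorm b (x - z) <= seminorm b (x - y) + seminorm b (y - z).
Proof.
move=> Sx Sy Sz; exact: ler_seminorm_dist restrict_form_semi_inner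
  (to_elements Sx) (to_elements Sy) (to_elements Sz).
Qed.

End inner.
End elements.

Section square_integrable.
Context d (T : measurableType d) (R : realType) (mu : {measure set T -> \bar R}).
Implicit Types f g : T -> R.

Definition sqint f := measurable_fun setT f /\
  mu.-integrable setT (EFin \o (fun x => f x ^+ 2)).

Lemma sqintE f : f \in Lfun mu 2%:E <-> sqint f.
Proof.
split=> [f2|[mf fi]].
  split; last exact: Lfun2_integrable_sqr.
  by move: f2; rewrite inE => /andP[+ _]; rewrite inE.
rewrite inE; apply/andP; split; rewrite inE//=.
rewrite /finite_norm unlock; apply: poweR_lty.
case/integrableP: fi => _; apply: le_lt_trans.
apply: ge0_le_integral => //.
- by move=> x _; exact: poweR_ge0.
- apply: (@measurableT_comp _ _ _ _ _ _ (fun x : \bar R => (x `^ 2)%E)) => //.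
    exact: measurable_poweR.
  by apply: measurableT_comp => //; exact/measurable_EFinP.
- by apply: measurableT_comp => //; apply/measurable_EFinP; exact: measurable_funX.
- by move=> x _ /=; rewrite lee_fin normrX powR_mulrn.
Qed.

Lemma sqint_mul_integrable f g : sqint f -> sqint g ->
  mu.-integrable setT (EFin \o (fun x => f x * g x)).
Proof.
move=> /sqintE f2 /sqintE g2; apply/Lfun1_integrable.
exact: Lfun2_mul_Lfun1.
Qed.

Lemma sqintP (k : R) f g : sqint f -> sqint g -> sqint (fun x => k * f x + g x).
Proof.
move=> sf sg; have [mf fi] := sf; have [mg gi] := sg; split.
  by apply: measurable_funD => //; exact: measurable_funM.
have -> : (EFin \o (fun x => (k * f x + g x) ^+ 2)) =
    (fun x => (k ^+ 2)%:E * (f x ^+ 2)%:E + ((2 * k)%:E * (f x * g x)%:E + (g x ^+ 2)%:E))%E.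
  by apply/funext => x /=; rewrite -!EFinM -!EFinD; congr EFin; ring.
apply: integrableD => //; first exact: integrableZl.
by apply: integrableD => //; apply: integrableZl => //; exact: sqint_mul_integrable.
Qed.

Lemma sqint0 : sqint (fun=> 0).
Proof.
split=> //; rewrite (_ : _ \o _ = cst 0%E); first exact: integrable0.
by apply/funext => x /=; rewrite expr0n.
Qed.

Lemma sqint_closed : submod_closed (mem (sqint : set (T -> R)) : {pred (T -> R)}).
Proof.
split=> [|k f g]; rewrite !inE; first exact: sqint0.
by move=> sf sg; exact: sqintP.
Qed.

Definition sqint_submodule := Submodule sqint_closed.

Definition integral_mul f g : R := \int[mu]_x (f x * g x).

Lemma integral_mulC f g : integral_mul f g = integral_mul g f.
Proof. by apply: eq_Rintegral => x _; rewrite mulrC. Qed.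

Lemma integral_mul_lin (k : R) f g h : sqint f -> sqint g -> sqint h ->
  integral_mul (fun x => k * f x + g x) h = k * integral_mul f h + integral_mul g h.
Proof.
move=> sf sg sh; have fh := sqint_mul_integrable sf sh.
have gh := sqint_mul_integrable sg sh.
rewrite /integral_mul -RintegralZl// -RintegralD//; last exact: (integrableZl _ k fh).
by apply: eq_Rintegral => x _; ring.
Qed.

Lemma integral_mul_ge0 f : 0 <= integral_mul f f.
Proof. by apply: Rintegral_ge0 => x _; rewrite -expr2 sqr_ge0. Qed.

Lemma integral_mul_semi_inner : semi_inner_in sqint_submodule integral_mul.
Proof.
split=> [f g _ _|k f g h|f _]; first exact: integral_mulC.
- exact: integral_mul_lin.
- exact: integral_mul_ge0.
Qed.

Lemma ae_eq_integral_mul f f' g g' : sqint f -> sqint g -> sqint f' -> sqint g' ->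
  f = f' %[ae mu] -> g = g' %[ae mu] -> integral_mul f g = integral_mul f' g'.
Proof.
move=> [mf _] [mg _] [mf' _] [mg' _] ff' gg'; congr fine.
apply: ae_eq_integral => //.
- by apply/measurable_EFinP; exact: measurable_funM.
- by apply/measurable_EFinP; exact: measurable_funM.
- by apply: filterS2 ff' gg' => x fx gx _; rewrite fx// gx.
Qed.

Lemma integral_sqr_eq0 f : sqint f -> integral_mul f f = 0 -> f = (fun=> 0) %[ae mu].
Proof.
move=> [mf fi] f0.
have fi' : mu.-integrable setT (fun x => (f x ^+ 2)%:E) by [].
have : (\int[mu]_x `|(f x ^+ 2)%:E| = 0)%E.
  have <- : (\int[mu]_x (f x ^+ 2)%:E = 0)%E.
    rewrite -[LHS]fineK ?integrable_fin_num//; congr EFin.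
    by rewrite -[RHS]f0; apply: eq_Rintegral.
  by apply: eq_integral => x _; rewrite gee0_abs// lee_fin sqr_ge0.
move/(ae_eq_integral_abs mu measurableT (measurable_int _ fi')).
apply: filterS => x /(_ I) [/eqP]; rewrite sqrf_eq0 => /eqP -> //.
Qed.

(** The difference is spelled as a combination [-1 * g x + f x] to match [sqintP] and
    [integral_mul_lin]. *)
Lemma ae_eq_subr f g : (fun x => -1 * g x + f x) = (fun=> 0) %[ae mu] -> f = g %[ae mu].
Proof.
move=> fg; apply: filterS fg => x h Dx.
by have := h Dx; rewrite mulN1r addrC => /eqP; rewrite subr_eq0 => /eqP.
Qed.

Lemma ae_eq_subl (h f g : T -> R) : f = g %[ae mu] -> h - f = h - g %[ae mu].
Proof. by move=> fg; apply: filterS fg => x E Dx; rewrite /= /GRing.add /= /GRing.opp /= E. Qed.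

End square_integrable.

(** Naming the limit as a limsup makes it an explicit function of the sequence, so that pointwise
    limits are measurable. Convergence comes from [geometric_limit] for R as a one-dimensional
    Hilbert space. *)
Lemma real_geometric_limit (R : realType) (x : nat -> R) (K : R) :
  (forall n, `|x n.+1 - x n| <= K / 2 ^+ n) ->
  let l := fine (limn_esup (fun n => (x n)%:E)) in
  x @ \oo --> l /\ forall n, `|x n - l| <= 2 * K / 2 ^+ n.
Proof.
move=> xK; pose a (y z : R^o) : R := y * z.
have aP : semi_inner a.
  split=> [y z|k y z w|y]; rewrite /a ?(mulrC y z)//.
    by rewrite mulrDl -mulrA.
  by rewrite -expr2 sqr_ge0.
have nE (y : R^o) : seminorm a y = `|y| by rewrite /seminorm /a -expr2 sqrtr_sqr.
have aC : seq_complete a.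
  move=> s sC; have cs : cvgn (s : nat -> R).
    apply/cauchy_cvgP/cauchy_exP => e e0.
    have [N NP] := sC (e / 2) ltac:(by rewrite divr_gt0).
    exists (s N); exists N => // n /= Nn; rewrite /ball/= (le_lt_trans (y := e / 2))//.
      by have := NP _ _ (leqnn N) Nn; rewrite nE.
    by rewrite ltr_pdivrMr// ltr_pMr// ltr1n.
  exists (limn (s : nat -> R)) => e e0.
  have /cvgrPdist_le/(_ e e0) [N _ NP] := cs.
  by exists N => n Nn; rewrite nE distrC; exact: NP.
have [|l lP] := geometric_limit aP aC (s := x) (K := K).
  by move=> n; rewrite nE.
have xl : x @ \oo --> (l : R).
  apply/cvgrPdist_le => e e0.
  pose N := Num.truncn (2 * K / e); exists N => // n /= Nn.
  have := lP n; rewrite nE distrC => /le_trans; apply.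
  rewrite ler_pdivrMr ?exprn_gt0// [leRHS]mulrC -ler_pdivrMr//.
  rewrite (le_trans (ltW (truncnS_gt _)))// -natrX ler_nat.
  exact: leq_trans (ltn_expl N (ltnSn 1)) (leq_pexp2l _ Nn).
have lE : fine (limn_esup (fun n => (x n)%:E)) = l.
  have : (fun n => (x n)%:E) @ \oo --> (l : R)%:E by apply: cvg_EFin => //; exact: nearW.
  by move=> /cvg_limn_einf_sup[_ ->].
by rewrite lE; split=> // n; rewrite -nE.
Qed.

(** * Completeness of L2 (Riesz-Fischer) *)

Section riesz_fischer.
Context d (T : measurableType d) (R : realType) (mu : {measure set T -> \bar R}).

Local Notation nrm := (seminorm (@integral_mul _ T R mu)).

(* The limit is a limsup of values so that it inherits the periodicity of the sequence. *)
Lemma sqint_complete (s : nat -> T -> R) : (forall n, sqint mu (s n)) ->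
  (forall e : R, 0 < e -> exists N, forall m n, (N <= m)%N -> (N <= n)%N ->
     nrm (s m - s n) <= e) ->
  exists k : nat -> nat,
    let g := fun x => fine (limn_esup (fun n => (s (k n) x)%:E)) in
    [/\ sqint mu g,
        forall e : R, 0 < e -> exists N, forall n, (N <= n)%N -> nrm (s n - g) <= e &
        {ae mu, forall x, s (k n) x @[n --> \oo] --> g x}].
Proof.
move=> s2 sC.
have pos n : 0 < 2 ^+ n :> R by rewrite exprn_gt0.
(* A bound for the square of the norm of the [n]-th increment. The numbers [4 ^+ n * e n] sum to 2,
   so the sum [H] of the weighted squares [h n] is integrable, and wherever [H] is finite the
   increments decay like [2 ^- n]. *)
pose e n : R := (2 / (2 ^ (n + 1))%:R) / 4 ^+ n.
have e0 n : 0 < e n by rewrite !divr_gt0 ?exprn_gt0// ltr0n expn_gt0.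
have /choice[N NP] : forall n, exists N, forall m m', (N <= m)%N -> (N <= m')%N ->
    nrm (s m - s m') <= Num.sqrt (e n).
  by move=> n; apply: sC; rewrite sqrtr_gt0.
(* A sum rather than a maximum: [k m] dominates every [N n] with [n] at most [m]. *)
pose k n := (\sum_(i < n.+1) N i)%N.
have kN n m : (n <= m)%N -> (N n <= k m)%N.
  move=> nm; rewrite /k; have nm' : (n < m.+1)%N by [].
  by rewrite (bigD1 (Ordinal nm'))//= leq_addr.
pose D n x := s (k n.+1) x - s (k n) x.
have sD m n : sqint mu (s m - s n) := submoduleB (s2 m) (s2 n) (S := sqint_submodule mu).
have D2 n : sqint mu (D n) by exact: sD.
have DI n : \int[mu]_x (D n x ^+ 2) <= e n.
  have := NP n _ _ (kN n n.+1 (leqnSn _)) (kN n n (leqnn _)).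
  rewrite /seminorm ler_sqrt ?(ltW (e0 n))// => De; exact: le_trans De.
pose h n x := ((4 ^+ n * D n x ^+ 2)%:E : \bar R).
have h0 n x : (0 <= h n x)%E by rewrite lee_fin mulr_ge0 ?sqr_ge0 ?exprn_ge0.
have mD n : measurable_fun setT (D n) by case: (D2 n).
have mh n : measurable_fun setT (h n).
  by apply/measurable_EFinP; apply: measurable_funM => //; exact: measurable_funX.
pose H x := (\sum_(0 <= n <oo) h n x)%E.
have HI : (\int[mu]_x H x <= 2%:E)%E.
  rewrite integral_nneseries//.
  have := @cvg_geometric_eseries_half R 2 0; rewrite expr0 divr1 => /cvg_lim <-//.
  apply: lee_nneseries => [n _ _|n _].
    by apply: integral_ge0.
  have [_ D2i] := D2 n.
  under eq_integral do rewrite /h EFinM.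
  rewrite integralZl//= -[X in (_ * X)%E]fineK ?integrable_fin_num//.
  rewrite -EFinM lee_fin -ler_pdivlMl ?exprn_gt0// mulrC.
  exact: DI.
have mH : measurable_fun setT H.
  by apply: ge0_emeasurable_sum.
have H0 x : (0 <= H x)%E by apply: nneseries_ge0.
have iH : mu.-integrable setT H.
  apply/integrableP; split=> //; under eq_integral do rewrite gee0_abs//.
  by rewrite (le_lt_trans HI)// ltry.
exists k; set g := fun x => _.
have gP x : H x \is a fin_num -> s (k n) x @[n --> \oo] --> g x /\
    forall n, (s (k n) x - g x) ^+ 2 <= 4 * fine (H x) / 4 ^+ n.
  move=> Hx; have DH n : `|D n x| <= Num.sqrt (fine (H x)) / 2 ^+ n.
    rewrite ler_pdivlMr// -[X in _ * X](gtr0_norm (pos n)) -normrM -sqrtr_sqr.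
    rewrite ler_wsqrtr// exprMn exprAC (_ : 2 ^+ 2 = 4); last by rewrite -natrX.
    rewrite mulrC -lee_fin fineK//.
    by rewrite /H (@nneseriesD1 _ (h ^~ x) n)//= leeDl//; apply: nneseries_ge0.
  have [cv bd] := real_geometric_limit DH; split=> // n.
  rewrite -real_normK ?num_real// (_ : 4 * _ / _ = (2 * Num.sqrt (fine (H x)) / 2 ^+ n) ^+ 2).
    by rewrite ler_pXn2r ?nnegrE// divr_ge0 ?mulr_ge0 ?sqrtr_ge0// ltW.
  rewrite !exprMn sqr_sqrtr ?fine_ge0// exprVn exprAC.
  by rewrite (_ : 2 ^+ 2 = 4)// -natrX.
have Hfin := integrable_ae measurableT iH.
have mg : measurable_fun setT g.
  apply: (measurableT_comp (fine_measurable measurableT)).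
  by apply: measurable_fun_limn_esup => n; apply/measurable_EFinP; case: (s2 (k n)).
have Dg n : sqint mu (s (k n) - g) /\ nrm (s (k n) - g) <= Num.sqrt (8 / 4 ^+ n).
  have ms : measurable_fun setT (fun x => s (k n) x - g x).
    by apply: measurable_funB => //; case: (s2 (k n)).
  have bnd : (\int[mu]_x (`|((s (k n) x - g x) ^+ 2)%:E|) <= \int[mu]_x ((4 / 4 ^+ n)%:E * H x))%E.
    apply: ae_ge0_le_integral => //.
    - by apply: measurableT_comp => //; apply/measurable_EFinP; exact: measurable_funX.
    - by move=> x _; apply: mule_ge0 => //; rewrite lee_fin divr_ge0// exprn_ge0.
    - exact: measurable_funeM.
    apply: filterS Hfin => x /(_ I) Hx _; have [_ /(_ n)] := gP x Hx.
    rewrite gee0_abs ?lee_fin ?sqr_ge0// => /le_trans le4.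
    rewrite -[H x]fineK// -EFinM lee_fin; apply: le4.
    by rewrite mulrAC.
  have bnd2 : (\int[mu]_x (`|((s (k n) x - g x) ^+ 2)%:E|) <= (8 / 4 ^+ n)%:E)%E.
    apply: le_trans bnd _; rewrite ge0_integralZl//.
    have c0 : (0 <= (4 / 4 ^+ n)%:E :> \bar R)%E by rewrite lee_fin divr_ge0// exprn_ge0.
    apply: le_trans (lee_wpmul2l c0 HI) _.
    by rewrite -EFinM lee_fin mulrAC -natrM.
  have si : sqint mu (s (k n) - g).
    split=> //; apply/integrableP; split; last by rewrite (le_lt_trans bnd2)// ltry.
    by apply/measurable_EFinP; exact: measurable_funX.
  split=> //; rewrite /seminorm ler_wsqrtr// -lee_fin.
  rewrite fineK; last by apply: integrable_fin_num => //; exact: sqint_mul_integrable.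
  apply: le_trans bnd2; apply: ge0_le_integral => //.
  - by move=> x _; rewrite lee_fin -expr2 sqr_ge0.
  - by apply/measurable_EFinP; apply: measurable_funM.
  - by apply: measurableT_comp => //; apply/measurable_EFinP; exact: measurable_funX.
  - by move=> x _; rewrite -expr2; exact: lee_abs.
split.
- have [si _] := Dg 0%N.
  have -> : g = s (k 0%N) - (s (k 0%N) - g) by rewrite subKr.
  exact: (submoduleB (S := sqint_submodule mu) (s2 _) si).
(* Both [e m] and [8 / 4 ^+ m] lie below [9 / 4 ^+ m], whose root is [3 / 2 ^+ m]; this [m] makes
   that root at most [r / 2]. *)
- move=> r r0; pose m := Num.truncn (6 / r).
  have m2 : 3 / 2 ^+ m <= r / 2.
    have : 6 / r <= 2 ^+ m.
      rewrite (le_trans (ltW (truncnS_gt _)))// -natrX ler_nat.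
      exact: ltn_expl.
    by rewrite ler_pdivrMr// ler_pdivrMr//; lra.
  have sq (y : R) : y <= 9 / 4 ^+ m -> Num.sqrt y <= r / 2.
    move=> ym; rewrite (le_trans _ m2)// (le_trans (ler_wsqrtr ym))//.
    rewrite (_ : 9 / 4 ^+ m = (3 / 2 ^+ m) ^+ 2); last first.
      rewrite exprMn exprVn exprAC; congr (_ / _ ^+ _); ring.
    by rewrite sqrtr_sqr ger0_norm// divr_ge0// ltW.
  have p4 : 0 < (4 ^+ m : R)^-1 by rewrite invr_gt0 exprn_gt0.
  exists (N m) => n Nn.
  have := ler_seminormD_in (integral_mul_semi_inner mu) (sD n (k m)) (Dg m).1.
  rewrite addrA subrK => /le_trans; apply.
  have em : e m <= 9 / 4 ^+ m.
    rewrite /e ler_pM2r// ler_pdivrMr ?ltr0n ?expn_gt0//.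
    rewrite -natrM ler_nat (leq_trans (_ : 2 <= 9)%N)// leq_pmulr// expn_gt0.
    by [].
  have := le_trans (NP m _ _ Nn (kN _ _ (leqnn m))) (sq _ em).
  have := le_trans (Dg m).2 (sq _ _).
  by rewrite ler_pM2r// ler_nat => /(_ isT); lra.
- by apply: filterS Hfin => x /(_ I) /gP[].
Qed.
End riesz_fischer.

(** * Fourth powers of L2 limits *)

Section fourth_power.
Context d (T : measurableType d) (R : realType) (mu : {measure set T -> \bar R}).
Local Notation nrm := (seminorm (integral_mul mu)).
Implicit Types (f g u : T -> R) (s : nat -> T -> R).

Lemma limn_einf_le (x : nat -> \bar R) (C : \bar R) :
  (forall n, (x n <= C)%E) -> (limn_einf x <= C)%E.
Proof.
move=> xC; rewrite limn_einf_lim; apply: lime_le; first exact: is_cvg_einfs.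
apply: nearW => n; apply: le_trans (xC n); apply: ereal_inf_lbound.
by exists n => /=.
Qed.

(** Lower semicontinuity of the L4 norm under L2 convergence: a subsequence converges almost
    everywhere, and Fatou's lemma applies to the fourth powers. *)
Lemma sqint_sqr_limit s u (C : R) : sqint mu u -> (forall n, sqint mu (s n)) ->
  (forall e : R, 0 < e -> exists N, forall n, (N <= n)%N -> nrm (s n - u) <= e) ->
  (forall n, mu.-integrable setT (EFin \o (fun x => s n x ^+ 4))) ->
  (forall n, \int[mu]_x (s n x ^+ 4) <= C) ->
  sqint mu (fun x => u x ^+ 2) /\ \int[mu]_x ((u x ^+ 2) ^+ 2) <= C.
Proof.
move=> su ss sU s4 sC; have tri f g h (sf : sqint mu f) (sg : sqint mu g) (sh : sqint mu h) :=
  ler_seminorm_dist_in (integral_mul_semi_inner mu) sf sg sh.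
have nBC f g (sf : sqint mu f) (sg : sqint mu g) :=
  seminormBC_in (integral_mul_semi_inner mu) sf sg.
have half (e : R) : 0 < e -> 0 < e / 2 by move=> e0; rewrite divr_gt0.
have [|k [sg sG cg]] := sqint_complete ss.
  move=> e e0; have [N NP] := sU _ (half _ e0); exists N => m n Nm Nn.
  apply: le_trans (tri _ _ _ (ss m) su (ss n)) _; rewrite (nBC _ _ su (ss n)) [leRHS]splitr.
  by apply: lerD; exact: NP.
set g := (fun x => _) in sg sG cg.
(* Riesz-Fischer produces its own limit [g]; uniqueness of L2 limits identifies it with [u]. *)
have ug : u = g %[ae mu].
  apply: ae_eq_subr; apply: integral_sqr_eq0; first exact: sqintP.
  rewrite (_ : (fun x => _) = u - g); last by apply/funext => x; rewrite mulN1r addrC.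
  have n0 : nrm (u - g) <= 0.
    apply/ler_addgt0Pl => e e0; rewrite addr0.
    have [N1 P1] := sU _ (half _ e0); have [N2 P2] := sG _ (half _ e0).
    pose n := maxn N1 N2.
    apply: le_trans (tri _ _ _ su (ss n) sg) _; rewrite (nBC _ _ su (ss n)) [leRHS]splitr.
    by apply: lerD; [apply: P1; exact: leq_maxl|apply: P2; exact: leq_maxr].
  by apply/eqP; rewrite eq_le integral_mul_ge0 andbT -sqrtr_eq0 eq_le n0 sqrtr_ge0.
have [mu_ _] := su.
have mF n : measurable_fun setT (fun x => (s (k n) x ^+ 4)%:E).
  by apply/measurable_EFinP/measurable_funX; case: (ss (k n)).
have m4 : measurable_fun setT (fun x => ((u x ^+ 2) ^+ 2)%:E).
  by apply/measurable_EFinP; apply: measurable_funX; exact: measurable_funX.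
have u4 : (\int[mu]_x ((u x ^+ 2) ^+ 2)%:E <= C%:E)%E.
  have -> : (\int[mu]_x ((u x ^+ 2) ^+ 2)%:E =
             \int[mu]_x limn_einf (fun n => (s (k n) x ^+ 4)%:E))%E.
    apply: ae_eq_integral => //.
      apply: measurableT_comp => //; apply: measurable_fun_limn_esup => n.
      exact: measurableT_comp.
    apply: filterS2 ug cg => x ux cx _; rewrite (ux I).
    have c4 : (s (k n) x ^+ 4)%:E @[n --> \oo] --> ((g x ^+ 2) ^+ 2)%:E.
      rewrite -exprM; apply/fine_cvgP; split; first exact: nearW.
      have cx2 : s (k n) x ^+ 2 @[n --> \oo] --> g x ^+ 2.
        by rewrite expr2; under eq_fun do rewrite expr2; exact: cvgM.
      have -> : fine \o (fun n => (s (k n) x ^+ 4)%:E) =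
          (fun n => s (k n) x ^+ 2 * s (k n) x ^+ 2).
        by apply/funext => n /=; rewrite -exprD.
      by rewrite (exprD _ 2 2); exact: cvgM.
    by rewrite is_cvg_limn_einfE; [exact/esym/cvg_lim|apply/cvg_ex; eexists; exact: c4].
  apply: le_trans (fatou mu measurableT mF _) _.
    by move=> n x _; rewrite lee_fin (exprM _ 2 2) sqr_ge0.
  apply: limn_einf_le => n; have := sC (k n); rewrite -lee_fin /Rintegral fineK//.
  exact: integrable_fin_num (s4 _).
have i4 : mu.-integrable setT (EFin \o (fun x => (u x ^+ 2) ^+ 2)).
  apply/integrableP; split=> //; apply: le_lt_trans (ltry C).
  apply: le_trans u4; rewrite le_eqVlt; apply/orP; left; apply/eqP.
  by apply: eq_integral => x _; rewrite gee0_abs// lee_fin sqr_ge0.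
split; first by split=> //; exact: measurable_funX.
by rewrite -lee_fin /Rintegral fineK//; exact: integrable_fin_num i4.
Qed.

Lemma sqint_mul f g : sqint mu (fun x => f x ^+ 2) -> sqint mu (fun x => g x ^+ 2) ->
  measurable_fun setT f -> measurable_fun setT g -> sqint mu (fun x => f x * g x).
Proof.
move=> sf sg mf mg; split; first exact: measurable_funM.
rewrite (_ : (fun x => _) = (fun x => f x ^+ 2 * g x ^+ 2)); last first.
  by apply/funext => x; rewrite exprMn.
exact: sqint_mul_integrable.
Qed.

Lemma seminorm_mul_le f g : sqint mu (fun x => f x ^+ 2) -> sqint mu (fun x => g x ^+ 2) ->
  nrm (fun x => f x * g x) ^+ 2 <= nrm (fun x => f x ^+ 2) * nrm (fun x => g x ^+ 2).
Proof.
move=> sf sg; rewrite sqr_sqrtr ?integral_mul_ge0//.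
rewrite (_ : integral_mul mu _ _ = integral_mul mu (fun x => f x ^+ 2) (fun x => g x ^+ 2)).
  apply: le_trans (ler_norm _) _.
  exact: (cauchy_schwarz_in (integral_mul_semi_inner mu) sf sg).
by apply: eq_Rintegral => x _; ring.
Qed.

End fourth_power.

(** * The torus *)

Notation mplane R := (measurableTypeR R * measurableTypeR R)%type.

Section torus_integral.
Variable R : realType.
Local Notation mu := (@torus_measure R).
Local Notation leb := (@lebesgue_measure R).
Local Notation I := (`[0%R, 1%R[%classic : set R).

(** Measurability on the plane is relative to the product sigma-algebra, so an open set has to be
    written as a countable union of rectangles; those with rational corners suffice. *)
Lemma continuous_measurable_plane (f : plane R -> R) :
  continuous f -> measurable_fun [set: mplane R] (f : mplane R -> R).
Proof.
move=> cf _; apply: (measurability _ (RGenOInfty.measurableE R)) => //.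
move=> /= _ [_ [a ->] <-]; rewrite setTI preimage_itvoy.
pose rect (q : rat * rat * (rat * rat)) : set (mplane R) :=
  `]ratr q.1.1, ratr q.1.2[ `*` `]ratr q.2.1, ratr q.2.2[.
rewrite [X in measurable X](_ : _ = \bigcup_q
    (if `[< rect q `<=` [set z | a < f z] >] then rect q else set0)).
  apply: countable_bigcupT_measurable => // q; case: ifP => _ //.
  by apply: measurableX; exact: measurable_itv.
apply/seteqP; split=> [[x y] /= afz|z [q _]]; last first.
  by case: ifP => // /asboolP; apply.
have [[/= U V] [xU yV] UV] : nbhs (x, y) [set z | a < f z].
  exact: cvgr_gt (cf (x, y)) _ afz.
have [e /= e0 xe] := xU; have [e' /= e'0 ye] := yV.
have rat_btw (s t : R) : s < t -> exists q : rat, s < ratr q < t.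
  by move=> /rat_in_itvoo[q]; rewrite in_itv; exists q.
have [q1 /andP[q11 q12]] := rat_btw (x - e) x ltac:(by rewrite ltrBlDr ltrDl).
have [q2 /andP[q21 q22]] := rat_btw x (x + e) ltac:(by rewrite ltrDl).
have [q3 /andP[q31 q32]] := rat_btw (y - e') y ltac:(by rewrite ltrBlDr ltrDl).
have [q4 /andP[q41 q42]] := rat_btw y (y + e') ltac:(by rewrite ltrDl).
exists ((q1, q2), (q3, q4)) => //; rewrite asboolT.
  by split; rewrite /= in_itv /= ?q12 ?q32.
move=> [s t] [] /=; rewrite !in_itv /= => /andP[s1 s2] /andP[t1 t2].
apply: (UV (s, t)); split => /=.
  by apply: xe; rewrite /= ltr_distlC; apply/andP; split; lra.
by apply: ye; rewrite /= ltr_distlC; apply/andP; split; lra.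
Qed.

Lemma torus_integral (f : mplane R -> \bar R) : measurable_fun setT f ->
  (\int[mu]_z f z = \int[leb \x leb]_(z in @fundamental_domain R) f z)%E.
Proof.
have mD := @measurable_fundamental_domain R.
have ge0 (g : mplane R -> \bar R) : measurable_fun setT g -> (forall z, 0 <= g z)%E ->
    (\int[mu]_z g z = \int[leb \x leb]_(z in @fundamental_domain R) g z)%E.
  move=> mg g0.
  have mC : measurable (~` @fundamental_domain R) by exact: measurableC.
  have muC : mu (~` @fundamental_domain R) = 0%E by rewrite /= /mrestr setICl measure0.
  have mg' : measurable_fun [set: mplane R] g by [].
  rewrite (ge0_negligible_integral mC (measurableT : measurable [set: mplane R]) mg' (fun z _ => g0 z) muC).
  rewrite setTD setCK; apply: eq_measure_integral => A mA AD.
  by rewrite /= /mrestr setIidl.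
move=> mf; rewrite integralE [RHS]integralE.
rewrite (ge0 _ (measurable_funepos mf) (funepos_ge0 f)).
by rewrite (ge0 _ (measurable_funeneg mf) (funeneg_ge0 f)).
Qed.

Lemma torus_fubini (f : mplane R -> \bar R) : measurable_fun setT f ->
  (forall z, 0 <= f z)%E ->
  (\int[mu]_z f z = \int[leb]_(x in I) \int[leb]_(y in I) f (x, y))%E /\
  (\int[mu]_z f z = \int[leb]_(y in I) \int[leb]_(x in I) f (x, y))%E.
Proof.
move=> mf f0; have mD := @measurable_fundamental_domain R.
rewrite torus_integral// integral_mkcond.
have mfD : measurable_fun setT (f \_ (@fundamental_domain R)).
  by apply/(measurable_restrictT _ mD) => //; exact: measurable_funTS.
have fD0 z : (0 <= (f \_ (@fundamental_domain R)) z)%E.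
  by rewrite patchE; case: ifP.
split.
  rewrite (fubini_tonelli1 _ mfD fD0) [RHS]integral_mkcond.
  apply: eq_integral => x _; rewrite /fubini_F patchE.
  case: ifPn => [xI|xI].
    rewrite [RHS]integral_mkcond; apply: eq_integral => y _.
    by rewrite !patchE; rewrite in_setX xI.
  apply: integral0_eq => y _; rewrite patchE in_setX.
  by rewrite (negbTE xI).
rewrite (fubini_tonelli2 _ mfD fD0) [RHS]integral_mkcond.
apply: eq_integral => y _; rewrite /fubini_G patchE.
case: ifPn => [yI|yI].
  rewrite [RHS]integral_mkcond; apply: eq_integral => x _.
  by rewrite !patchE; rewrite in_setX yI andbT.
apply: integral0_eq => x _; rewrite patchE in_setX.
by rewrite (negbTE yI) andbF.
Qed.

Lemma torus_measureT : mu setT = 1%E.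
Proof.
rewrite /= /mrestr setTI product_measure1E//=.
rewrite lebesgue_measure_itv/= lte_fin ltr01 -EFinB subr0 mule1//.
Qed.

End torus_integral.

(** * Averages along coordinate lines *)

Section torus_average.
Variable R : realType.
Local Notation mu := (@torus_measure R).
Local Notation leb := (@lebesgue_measure R).
Local Notation I := (`[0%R, 1%R[%classic : set R).
Implicit Types (f g : plane R -> R) (j : 'I_2) (z : plane R) (t : R).

Lemma periodic_shift f (e : plane R) : periodic f e ->
  forall (n : int) z, f (z + e *~ n) = f z.
Proof.
move=> fe [n|n] z; first by rewrite -pmulrn periodicn.
by rewrite NegzE mulrNz -pmulrn -[in RHS](subrK (e *+ n.+1) z) periodicn.
Qed.

Definition wrap z : plane R := (z.1 - (Num.floor z.1)%:~R, z.2 - (Num.floor z.2)%:~R).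

Lemma wrapE f z : torus_fun f -> f (wrap z) = f z.
Proof.
move=> [f1 f2]; rewrite -(periodic_shift f1 (Num.floor z.1)).
rewrite -(periodic_shift f2 (Num.floor z.2)); congr f.
case: z => x y; rewrite /wrap/=.
have fstE (e : plane R) n : (e *~ n).1 = e.1 *~ n by exact: (raddfMz fst).
have sndE (e : plane R) n : (e *~ n).2 = e.2 *~ n by exact: (raddfMz snd).
congr (_, _) => /=.
  by rewrite !fstE/= mul0rz addr0 subrK.
by rewrite !sndE/= mul0rz addr0 subrK.
Qed.

Lemma wrap_unit z : 0 <= (wrap z).1 < 1 /\ 0 <= (wrap z).2 < 1.
Proof.
by split; rewrite /wrap/= subr_ge0 ge_floor/= ltrBlDl -intrD1 lt_succ_floor.
Qed.

Lemma torus_continuous_bounded f : torus_fun f -> continuous f ->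
  exists C : R, forall z, `|f z| <= C.
Proof.
move=> fper cf.
have cK : compact (`[0%R, 1%R] `*` `[0%R, 1%R] : set (plane R)).
  by apply: compact_setX; exact: segment_compact.
have : compact (f @` (`[0%R, 1%R] `*` `[0%R, 1%R])).
  by apply: continuous_compact => //; exact: continuous_subspaceT.
move=> /compact_bounded[M [_ MP]]; exists (M + 1) => z.
apply: (MP (M + 1)); first by rewrite ltrDl.
exists (wrap z); last exact: wrapE.
have [/andP[a b] /andP[c d]] := wrap_unit z.
by split; rewrite /= in_itv /= ?a ?c /= ltW.
Qed.

Lemma torus_bounded_integrable f C : measurable_fun [set: mplane R] (f : mplane R -> R) ->
  (forall z, `|f z| <= C) -> mu.-integrable setT (EFin \o (f : mplane R -> R)).
Proof.
move=> mf fC; apply: measurable_bounded_integrable => //.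
  by rewrite torus_measureT ltry.
by exists C; split; [exact: num_real|move=> M CM x _; exact: le_trans (fC x) (ltW CM)].
Qed.

Lemma torus_continuous_integrable f : torus_fun f -> continuous f ->
  mu.-integrable setT (EFin \o (f : mplane R -> R)).
Proof.
move=> fper cf; have [C fC] := torus_continuous_bounded fper cf.
by apply: torus_bounded_integrable fC; exact: continuous_measurable_plane.
Qed.

Definition set_coord j t z : plane R := if j == 0 then (t, z.2) else (z.1, t).

Lemma continuous_set_coord j z : continuous (fun t => set_coord j t z).
Proof.
move=> t; rewrite /set_coord /continuous_at; case: (j == 0).
  by apply: (@cvg_pair _ _ _ (nbhs t) (nbhs t) (nbhs z.2)); [exact: cvg_id|exact: cvg_cst].
by apply: (@cvg_pair _ _ _ (nbhs t) (nbhs z.1) (nbhs t)); [exact: cvg_cst|exact: cvg_id].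
Qed.

Lemma continuous_line f j z : continuous f -> continuous (fun t => f (set_coord j t z)).
Proof.
by move=> cf t; apply: continuous_comp; [exact: continuous_set_coord|exact: cf].
Qed.

(** A function of the other coordinate only; the inequalities below bound a function pointwise by
    such averages. The closed interval gives compactness, and [avgE] returns to the half-open one of
    the fundamental domain. *)
Definition avg j f z : R := \int[leb]_(t in `[0, 1]) f (set_coord j t z).

Section avg_theory.
Variables (f : plane R -> R) (C : R).
Hypotheses (cf : continuous f) (f0 : forall z, 0 <= f z) (fC : forall z, f z <= C).

Lemma line_integrable j z : leb.-integrable `[0, 1] (EFin \o (fun t => f (set_coord j t z))).
Proof.
apply: continuous_compact_integrable; first exact: segment_compact.
exact/continuous_subspaceT/continuous_line.
Qed.

Lemma avgE j z : (avg j f z)%:E = (\int[leb]_(t in I) (f (set_coord j t z))%:E)%E.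
Proof.
rewrite /avg fineK; last by apply: integrable_fin_num => //; exact: line_integrable.
rewrite integral_itv_bndo_bndc//.
apply/measurable_EFinP; apply: measurable_funTS.
by apply: continuous_measurable_fun; exact: continuous_line.
Qed.

Lemma avg_ge0 j z : 0 <= avg j f z.
Proof. exact: Rintegral_ge0. Qed.

Lemma avg_le j z : avg j f z <= C.
Proof.
have -> : C = \int[leb]_(t in `[0, 1]) C.
  by rewrite Rintegral_cst//= lebesgue_measure_itv/= lte_fin ltr01/= subr0 mulr1.
apply: le_Rintegral => //; first exact: line_integrable.
apply: continuous_compact_integrable; first exact: segment_compact.
by apply: continuous_subspaceT => ?; exact: cvg_cst.
Qed.

Lemma measurable_avg j : measurable_fun [set: mplane R] (avg j f : mplane R -> R).
Proof.
have mf : measurable_fun [set: mplane R] (EFin \o f : mplane R -> \bar R).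
  by apply/measurable_EFinP; exact: continuous_measurable_plane.
apply/measurable_EFinP; rewrite (_ : _ \o _ = fun z : mplane R =>
  (\int[leb]_(t in I) (f (set_coord j t z))%:E)%E); last by apply/funext => z; exact: avgE.
have [->|->] : j = 0 \/ j = 1 by case: j => -[|[|//]] i; [left|right]; exact: val_inj.
- pose D : set (mplane R) := I `*` setT.
  have mD : measurable D by apply: measurableX; [exact: measurable_itv|exact: measurableT].
  have mfD : measurable_fun setT ((EFin \o f : mplane R -> \bar R) \_ D).
    by apply/(measurable_restrictT _ mD) => //; exact: measurable_funTS.
  have fD0 z : (0 <= ((EFin \o f : mplane R -> \bar R) \_ D) z)%E.
    by rewrite patchE; case: ifP => // _; rewrite lee_fin.
  have mG := measurable_fun_fubini_tonelli_G (m1 := leb) _ mfD fD0.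
  apply: eq_measurable_fun (measurableT_comp mG measurable_snd) => z _ /=; rewrite /fubini_G [RHS]integral_mkcond.
  by apply: eq_integral => t _; rewrite !patchE in_setX in_setT andbT.
- pose D : set (mplane R) := setT `*` I.
  have mD : measurable D by apply: measurableX; [exact: measurableT|exact: measurable_itv].
  have mfD : measurable_fun setT ((EFin \o f : mplane R -> \bar R) \_ D).
    by apply/(measurable_restrictT _ mD) => //; exact: measurable_funTS.
  have fD0 z : (0 <= ((EFin \o f : mplane R -> \bar R) \_ D) z)%E.
    by rewrite patchE; case: ifP => // _; rewrite lee_fin.
  have mG := measurable_fun_fubini_tonelli_F (m2 := leb) _ mfD fD0.
  apply: eq_measurable_fun (measurableT_comp mG measurable_fst) => z _ /=; rewrite /fubini_F [RHS]integral_mkcond.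
  by apply: eq_integral => t _; rewrite !patchE in_setX in_setT.
Qed.

Lemma integral_avgE j : (\int[mu]_z (avg j f z)%:E = \int[mu]_z (f z)%:E)%E.
Proof.
have mf : measurable_fun [set: mplane R] (EFin \o f : mplane R -> \bar R).
  by apply/measurable_EFinP; exact: continuous_measurable_plane.
have mA : measurable_fun [set: mplane R] (EFin \o avg j f : mplane R -> \bar R).
  by apply/measurable_EFinP; exact: measurable_avg.
have [fxy fyx] := torus_fubini mf (fun z => f0 z).
have [Axy Ayx] := torus_fubini mA (fun z => avg_ge0 j z).
have muI : (leb I = 1)%E.
  by rewrite lebesgue_measure_itv/= lte_fin ltr01 -EFinB subr0.
have [j0|j1] : j = 0 \/ j = 1 by case: (j) => -[|[|//]] i; [left|right]; exact: val_inj.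
- rewrite [LHS]Ayx [RHS]fyx; apply: eq_integral => y _.
  rewrite (eq_integral (fun=> (avg j f (0, y))%:E)) => [|x _]; last first.
    by rewrite /= !avgE j0.
  by rewrite integral_cst//= muI mule1 avgE j0.
- rewrite [LHS]Axy [RHS]fxy; apply: eq_integral => x _.
  rewrite (eq_integral (fun=> (avg j f (x, 0))%:E)) => [|y _]; last first.
    by rewrite /= !avgE j1.
  by rewrite integral_cst//= muI mule1 avgE j1.
Qed.

Lemma integral_avg j : \int[mu]_z avg j f z = \int[mu]_z f z.
Proof. by congr fine; exact: integral_avgE. Qed.

End avg_theory.
End torus_average.

(** * Smooth periodic functions *)

Section line.
Variable R : realType.
Local Notation leb := (@lebesgue_measure R).
Implicit Types (F G h : R -> R) (s t : R).

Lemma unit_integrable h : continuous h -> leb.-integrable `[0, 1] (EFin \o h).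
Proof.
move=> ch; apply: continuous_compact_integrable; first exact: segment_compact.
exact: continuous_subspaceT.
Qed.

Lemma unit_Rintegral_cst (c : R) : \int[leb]_(t in `[0, 1]) c = c.
Proof.
by rewrite Rintegral_cst//= lebesgue_measure_itv/= lte_fin ltr01/= subr0 mulr1.
Qed.

Lemma continuous_cst (c : R) : continuous (fun _ : R => c).
Proof. by move=> ?; exact: cvg_cst. Qed.

Lemma continuous_norm h : continuous h -> continuous (fun t => `|h t|).
Proof. by move=> ch t; apply: cvg_norm; exact: ch. Qed.

Lemma line_increment F G s t : continuous G -> (forall t : R, is_derive t 1 F (G t)) ->
  0 <= s <= 1 -> 0 <= t <= 1 ->
  `|F t - F s| <= \int[leb]_(x in `[0, 1]) `|G x|.
Proof.
move=> cG dF; wlog st : s t / s <= t.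
  move=> W s1 t1; have [st|/ltW ts] := leP s t; first exact: W.
  by rewrite distrC; exact: W.
move=> /andP[s0 s1] /andP[t0 t1].
have iG : leb.-integrable `[s, t] (EFin \o G).
  apply: continuous_compact_integrable; first exact: segment_compact.
  exact: continuous_subspaceT.
rewrite -(Rintegral_FTC st cG dF); apply: le_trans (le_normr_Rintegral _ iG) _ => //.
have iN := unit_integrable (continuous_norm cG).
rewrite -lee_fin !fineK; last 2 first.
- exact: integrable_fin_num.
- apply: integrable_fin_num => //.
  apply: (integrableS _ _ _ iN) => // x; rewrite /= !in_itv /= => /andP[a b].
  by rewrite (le_trans s0 a) (le_trans b t1).
apply: ge0_subset_integral => //.
- by case/integrableP: iN.
- by move=> x; rewrite /= !in_itv /= => /andP[a b]; rewrite (le_trans s0 a) (le_trans b t1).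
Qed.

Lemma line_osc F G s t : continuous G -> (forall t : R, is_derive t 1 F (G t)) ->
  0 <= s <= 1 -> 0 <= t <= 1 ->
  (F t - F s) ^+ 2 <= \int[leb]_(x in `[0, 1]) (G x ^+ 2).
Proof.
move=> cG dF s1 t1; rewrite -real_normK ?num_real//; set d := `|_|.
have dG : d <= _ := line_increment cG dF s1 t1.
have d0 : 0 <= d by rewrite normr_ge0.
have cG2 : continuous (fun x => G x ^+ 2).
  by move=> x; apply: continuousM; exact: cG.
(* Integrating [2 d |G| <= d ^+ 2 + G ^+ 2], with [d] at most the integral of [|G|], replaces
   Cauchy-Schwarz. *)
have : \int[leb]_(x in `[0, 1]) (2 * d * `|G x|) <= \int[leb]_(x in `[0, 1]) (d ^+ 2 + G x ^+ 2).
  apply: le_Rintegral => //.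
  - apply: unit_integrable => x; apply: cvgM; first exact: cvg_cst.
    exact: continuous_norm.
  - by apply: unit_integrable => x; apply: cvgD; [exact: cvg_cst|exact: cG2].
  - move=> x _; rewrite -(real_normK (num_real (G x))).
    by have := sqr_ge0 (d - `|G x|); lra.
rewrite RintegralZl//; last exact/unit_integrable/continuous_norm.
rewrite RintegralD//; [|exact/unit_integrable/continuous_cst|exact: unit_integrable].
rewrite unit_Rintegral_cst; nra.
Qed.

(** The derivative [2 F G] of [F ^+ 2] is at most [F ^+ 2 + G ^+ 2] in absolute value; integrate
    from [s] to [t], then average over [s]. *)
Lemma line_sup F G t : continuous F -> continuous G ->
  (forall t : R, is_derive t 1 F (G t)) -> 0 <= t <= 1 ->
  F t ^+ 2 <= \int[leb]_(x in `[0, 1]) (2 * F x ^+ 2 + G x ^+ 2).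
Proof.
move=> cF cG dF t1.
have cF2 : continuous (fun x => F x ^+ 2).
  by move=> x; apply: continuousM; exact: cF.
have cG2 : continuous (fun x => G x ^+ 2).
  by move=> x; apply: continuousM; exact: cG.
have cFG : continuous (fun x => 2 * (F x * G x)).
  move=> x; apply: cvgM; first exact: cvg_cst.
  by apply: cvgM; [exact: cF|exact: cG].
have dF2 (x : R) : is_derive x 1 (fun x => F x ^+ 2) (2 * (F x * G x)).
  have dFx := dF x; apply: is_derive_eq.
  by rewrite ?expr1 /GRing.scale/= ?mulr_natl; ring.
pose c := \int[leb]_(x in `[0, 1]) (F x ^+ 2 + G x ^+ 2).
have c2 : continuous (fun x => F x ^+ 2 + G x ^+ 2).
  by move=> x; apply: cvgD; [exact: cF2|exact: cG2].
have Fs s : 0 <= s <= 1 -> F t ^+ 2 <= F s ^+ 2 + c.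
  move=> s1; have := line_increment cFG dF2 s1 t1.
  have := ler_norm (F t ^+ 2 - F s ^+ 2).
  suff : \int[leb]_(x in `[0, 1]) `|2 * (F x * G x)| <= c by lra.
  apply: le_Rintegral => //; [exact/unit_integrable/continuous_norm|exact: unit_integrable|].
  move=> x _; rewrite ler_norml.
  by have := sqr_ge0 (F x - G x); have := sqr_ge0 (F x + G x); lra.
have : \int[leb]_(s in `[0, 1]) (F t ^+ 2) <= \int[leb]_(s in `[0, 1]) (F s ^+ 2 + c).
  apply: le_Rintegral.
  - exact: measurable_itv.
  - exact/unit_integrable/continuous_cst.
  - by apply: unit_integrable => x; apply: cvgD; [exact: cF2|exact: cvg_cst].
  - by move=> s s1; apply: Fs; move: s1; rewrite /= in_itv.
rewrite unit_Rintegral_cst RintegralD//; [|exact: unit_integrable|exact/unit_integrable/continuous_cst].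
rewrite unit_Rintegral_cst => /le_trans; apply.
rewrite /c -RintegralD//; [|exact: unit_integrable|exact: unit_integrable].
by rewrite le_eqVlt; apply/orP; left; apply/eqP; apply: eq_Rintegral => x _; ring.
Qed.

End line.

Section smooth_functions.
Variable R : realType.
Local Notation mu := (@torus_measure R).
Local Notation leb := (@lebesgue_measure R).
Implicit Types (f g : plane R -> R) (j : 'I_2) (z : plane R) (t : R).

Local Notation dir f := (f : (R^o * R^o)%type -> R^o).

Lemma smooth_continuous f : smooth f -> continuous f.
Proof. by case=> _ /(_ [::])[]. Qed.

Lemma smooth_derivable f : smooth f -> forall j z, derivable (dir f) z (basis_vector R j).
Proof. by case=> _ /(_ [::])[]. Qed.

Lemma torus_fun_partial j f : torus_fun f -> torus_fun (partial j f).
Proof.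
have sh e : periodic f e -> periodic (partial j f) e.
  move=> fe z.
  have E : (fun h => h^-1 *: ((dir f \o shift (z + e)) (h *: basis_vector R j) - dir f (z + e))) =
      (fun h => h^-1 *: ((dir f \o shift z) (h *: basis_vector R j) - dir f z)).
    by apply/funext => h; rewrite /= fe addrA fe.
  by rewrite /partial /derive E.
by move=> [f1 f2]; split; exact: sh.
Qed.

Lemma smooth_partial j f : smooth f -> smooth (partial j f).
Proof.
move=> [fper fs]; split; first exact: torus_fun_partial.
by move=> s; have := fs (rcons s j); rewrite foldr_rcons.
Qed.

Lemma set_coordD j t h z :
  h *: basis_vector R j + set_coord j t z = set_coord j (h + t) z.
Proof.
rewrite /basis_vector /set_coord; case: (j == 0); congr (_, _) => /=.
- by rewrite /GRing.scale/= mulr1.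
- by rewrite /GRing.scale/= mulr0 add0r.
- by rewrite /GRing.scale/= mulr0 add0r.
- by rewrite /GRing.scale/= mulr1.
Qed.

Lemma is_derive_line f j z t : derivable (dir f) (set_coord j t z) (basis_vector R j) ->
  is_derive t 1 (fun t => f (set_coord j t z)) (partial j f (set_coord j t z)).
Proof.
move=> df; have E : (fun h => h^-1 *: (((fun t => f (set_coord j t z)) \o shift t) (h *: (1 : R))
     - f (set_coord j t z))) =
   (fun h => h^-1 *: ((dir f \o shift (set_coord j t z)) (h *: basis_vector R j)
     - dir f (set_coord j t z))).
  apply/funext => h; rewrite /= set_coordD; congr (_ *: (f (set_coord j _ z) - _)).
  by rewrite /GRing.scale/= mulr1.
split; first by rewrite /derivable E.
by rewrite /partial /derive E.
Qed.

Lemma smooth_line f j z t : smooth f ->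
  is_derive t 1 (fun t => f (set_coord j t z)) (partial j f (set_coord j t z)).
Proof. by move=> fs; apply: is_derive_line; exact: smooth_derivable. Qed.

Lemma periodic_set_coord f j z : torus_fun f -> f (set_coord j 1 z) = f (set_coord j 0 z).
Proof.
move=> [f1 f2]; rewrite /set_coord; case: (j == 0).
  by rewrite -[RHS]f1; congr (f (_, _)); rewrite /= ?add0r ?addr0.
by rewrite -[RHS]f2; congr (f (_, _)); rewrite /= ?add0r ?addr0.
Qed.

Lemma torus_integral_cst (c : R) : \int[mu]_z c = c.
Proof. by rewrite Rintegral_cst// [X in fine X]torus_measureT mulr1. Qed.

Lemma torus_integral_derivative f g j : torus_fun f -> torus_fun g ->
  continuous f -> continuous g ->
  (forall z t, is_derive t 1 (fun t => f (set_coord j t z)) (g (set_coord j t z))) ->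
  \int[mu]_z g z = 0.
Proof.
move=> fper gper cf cg dfg; have [C gC] := torus_continuous_bounded gper cg.
(* [integral_avg] rests on Tonelli and asks for a nonnegative integrand, hence the shift. *)
pose g' z := g z + C.
have cg' : continuous g' by move=> z; apply: cvgD; [exact: cg|exact: cvg_cst].
have g'0 z : 0 <= g' z by have := gC z; rewrite ler_norml /g'; lra.
have gi := torus_continuous_integrable gper cg.
have : \int[mu]_z g' z = C.
  rewrite -(integral_avg cg' g'0 j) -[RHS]torus_integral_cst.
  apply: eq_Rintegral => z _; rewrite /avg /g' RintegralD//.
  - rewrite unit_Rintegral_cst (Rintegral_FTC _ (@continuous_line _ g j z cg) (dfg z))//.
    by rewrite periodic_set_coord// subrr add0r.
  - exact/unit_integrable/continuous_line.
  - exact/unit_integrable/continuous_cst.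
rewrite RintegralD//; last by apply: (@torus_bounded_integrable _ _ `|C|).
by rewrite torus_integral_cst; lra.
Qed.

Lemma smooth_by_parts f g j : smooth f -> smooth g ->
  \int[mu]_z (f z * partial j g z) = - \int[mu]_z (partial j f z * g z).
Proof.
move=> fs gs.
have [cf cg] := (smooth_continuous fs, smooth_continuous gs).
have [cdf cdg] := (smooth_continuous (smooth_partial j fs), smooth_continuous (smooth_partial j gs)).
have perM h k : torus_fun h -> torus_fun k -> torus_fun (fun z => h z * k z).
  by move=> [h1 h2] [k1 k2]; split=> z; rewrite ?h1 ?k1 ?h2 ?k2.
have cM (h k : plane R -> R) : continuous h -> continuous k -> continuous (fun z : plane R => h z * k z : R).
  by move=> ch ck z; apply: cvgM; [exact: ch|exact: ck].
have [fper gper] := (fs.1, gs.1).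
have dfper := torus_fun_partial j fper; have dgper := torus_fun_partial j gper.
have i1 := torus_continuous_integrable (perM _ _ fper dgper) (cM _ _ cf cdg).
have i2 := torus_continuous_integrable (perM _ _ dfper gper) (cM _ _ cdf cg).
apply/eqP; rewrite -subr_eq0 opprK -RintegralD//; apply/eqP.
apply: (@torus_integral_derivative (fun z => f z * g z) _ j).
- exact: perM.
- have [a1 a2] := perM _ _ fper dgper; have [b1 b2] := perM _ _ dfper gper.
  by split=> z; [rewrite a1 b1|rewrite a2 b2].
- exact: cM.
- by move=> z; apply: cvgD; [exact: cM|exact: cM].
- move=> z t; have df := smooth_line j z t fs; have dg := smooth_line j z t gs.
  apply: is_derive_eq; rewrite /GRing.scale/=; ring.
Qed.

End smooth_functions.

(** * The Ladyzhenskaya and Poincare inequalities *)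

Lemma sqrD_le (R : realDomainType) (x y : R) : (x + y) ^+ 2 <= 2 * x ^+ 2 + 2 * y ^+ 2.
Proof. by have := sqr_ge0 (x - y); lra. Qed.

Lemma double_le (R : realDomainType) (x y z : R) : x + x <= 2 * y + 2 * z -> x <= y + z.
Proof. lra. Qed.

Lemma sum_ord2 (V : nmodType) (F : 'I_2 -> V) : \sum_(i < 2) F i = F 0 + F 1.
Proof. by rewrite big_ord_recl big_ord1; congr (F _ + F _); exact: val_inj. Qed.

Section torus_Rintegral.
Variable R : realType.
Local Notation mu := (@torus_measure R).
Implicit Types (h k : mplane R -> R) (c : R).

Lemma torus_integrableD h k : mu.-integrable setT (EFin \o h) ->
  mu.-integrable setT (EFin \o k) -> mu.-integrable setT (EFin \o (fun z => h z + k z)).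
Proof. by move=> ih ik; exact: (integrableD measurableT ih ik). Qed.

Lemma torus_integrableZ c h : mu.-integrable setT (EFin \o h) ->
  mu.-integrable setT (EFin \o (fun z => c * h z)).
Proof. by move=> ih; exact: (integrableZl measurableT c ih). Qed.

Lemma torus_integrable_cst c : mu.-integrable setT (EFin \o (fun _ : mplane R => c)).
Proof. by apply: (@torus_bounded_integrable _ _ `|c|) => //; exact: measurable_cst. Qed.

Lemma torus_RintegralD h k : mu.-integrable setT (EFin \o h) ->
  mu.-integrable setT (EFin \o k) ->
  \int[mu]_z (h z + k z) = \int[mu]_z h z + \int[mu]_z k z.
Proof. by move=> ih ik; exact: (RintegralD measurableT ih ik). Qed.

Lemma torus_RintegralZ c h : mu.-integrable setT (EFin \o h) ->
  \int[mu]_z (c * h z) = c * \int[mu]_z h z.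
Proof. by move=> ih; exact: (RintegralZl _ measurableT ih). Qed.

Lemma torus_RintegralZD c h k : mu.-integrable setT (EFin \o h) ->
  mu.-integrable setT (EFin \o k) ->
  \int[mu]_z (c * h z + k z) = c * \int[mu]_z h z + \int[mu]_z k z.
Proof.
by move=> ih ik; rewrite (torus_RintegralD (torus_integrableZ c ih) ik) torus_RintegralZ.
Qed.

End torus_Rintegral.

Section smooth_inequalities.
Variable R : realType.
Local Notation mu := (@torus_measure R).
Local Notation leb := (@lebesgue_measure R).
Local Notation I := (`[0%R, 1%R[%classic : set R).
Implicit Types (f g : plane R -> R) (j : 'I_2) (z w : plane R) (t : R).

Lemma torus_shift f (m n : int) (x y : R) : torus_fun f ->
  f (x - m%:~R, y - n%:~R) = f (x, y).
Proof.
move=> [f1 f2]; rewrite -(periodic_shift f1 m) -(periodic_shift f2 n); congr f.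
have fstE (e : plane R) k : (e *~ k).1 = e.1 *~ k by exact: (raddfMz fst).
have sndE (e : plane R) k : (e *~ k).2 = e.2 *~ k by exact: (raddfMz snd).
congr (_, _) => /=.
  by rewrite !fstE/= mul0rz addr0 subrK.
by rewrite !sndE/= mul0rz addr0 subrK.
Qed.

Lemma torus_funM f g : torus_fun f -> torus_fun g -> torus_fun (fun z => f z * g z).
Proof. by move=> [f1 f2] [g1 g2]; split=> z; rewrite ?f1 ?g1 ?f2 ?g2. Qed.

Lemma continuous_planeM f g : continuous f -> continuous g ->
  continuous (fun z : plane R => f z * g z : R).
Proof. by move=> cf cg z; apply: cvgM; [exact: cf|exact: cg]. Qed.

Lemma continuous_plane_sqr f : continuous f -> continuous (fun z : plane R => f z ^+ 2 : R).
Proof. by move=> cf; exact: continuous_planeM. Qed.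

Lemma torus_fun_sqr f : torus_fun f -> torus_fun (fun z => f z ^+ 2).
Proof. by move=> [f1 f2]; split=> z; rewrite ?f1 ?f2. Qed.

Lemma torus_continuous_sqint f : torus_fun f -> continuous f -> sqint mu (f : mplane R -> R).
Proof.
move=> fper cf; split; first exact: continuous_measurable_plane.
apply: (@torus_continuous_integrable _ (fun z => f z ^+ 2)).
  exact: torus_fun_sqr.
exact: continuous_plane_sqr.
Qed.

Lemma smooth_sqint f : smooth f -> sqint mu (f : mplane R -> R).
Proof. by move=> fs; apply: torus_continuous_sqint fs.1 (smooth_continuous fs). Qed.

Lemma ord2P j : j = 0 \/ j = 1.
Proof. by case: j => -[|[|//]] i; [left|right]; exact: val_inj. Qed.

Lemma unit_coordinate f j z : torus_fun f ->
  exists2 t, 0 <= t <= 1 & f (set_coord j t z) = f z.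
Proof.
move=> fper; have [w1 w2] := wrap_unit z.
case: z w1 w2 => x y; rewrite /wrap /= => /andP[x0 x1] /andP[y0 y1].
have [->|->] := ord2P j.
  exists (x - (Num.floor x)%:~R); first by rewrite x0 ltW.
  by rewrite /set_coord/= -[in LHS](subr0 y) (torus_shift _ 0).
exists (y - (Num.floor y)%:~R); first by rewrite y0 ltW.
by rewrite /set_coord/= -[in LHS](subr0 x) (torus_shift 0).
Qed.

Lemma avg_wrap f j z : torus_fun f -> avg j f (wrap z) = avg j f z.
Proof.
move=> fper; apply: eq_Rintegral => t _; have [->|->] := ord2P j.
  by rewrite /set_coord/= -[in LHS](subr0 t) (torus_shift 0).
by rewrite /set_coord/= -[in LHS](subr0 t) (torus_shift _ 0).
Qed.

Lemma avg_set_coord f j t z : avg j f (set_coord j t z) = avg j f z.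
Proof. by apply: eq_Rintegral => s _; rewrite /set_coord; case: (j == 0). Qed.

(** [avg 0 f] depends on the second coordinate alone and [avg 1 g] on the first alone, so the double
    integral factors. This is the two-dimensional heart of Ladyzhenskaya's inequality. *)
Lemma integral_avg_mul f g C : continuous f -> continuous g ->
  (forall z, 0 <= f z) -> (forall z, 0 <= g z) ->
  (forall z, f z <= C) -> (forall z, g z <= C) ->
  \int[mu]_z (avg 0 f z * avg 1 g z) = \int[mu]_z f z * \int[mu]_z g z.
Proof.
move=> cf cg f0 g0 fC gC.
have mf := measurable_avg cf f0 0; have mg := measurable_avg cg g0 1.
have mA : measurable_fun [set: mplane R] (EFin \o avg 0 f : mplane R -> \bar R).
  exact/measurable_EFinP.
have mB : measurable_fun [set: mplane R] (EFin \o avg 1 g : mplane R -> \bar R).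
  exact/measurable_EFinP.
have mAB : measurable_fun [set: mplane R]
    (EFin \o (fun z => avg 0 f z * avg 1 g z) : mplane R -> \bar R).
  by apply/measurable_EFinP; exact: measurable_funM.
have fA0 := avg_ge0 f0; have gB0 := avg_ge0 g0.
have [EA _] := torus_fubini mA (fun z => fA0 0 z).
have [EB _] := torus_fubini mB (fun z => gB0 1 z).
have [EAB _] := torus_fubini mAB (fun z => mulr_ge0 (fA0 0 z) (gB0 1 z)).
have muI : (leb I = 1)%E by rewrite lebesgue_measure_itv/= lte_fin ltr01/= sube0.
have cst1 (c : \bar R) : (\int[leb]_(x in I) c = c)%E by rewrite integral_cst//= muI mule1.
have AE x y : avg 0 f (x, y) = avg 0 f (0, y) by exact: (avg_set_coord f 0 x (0, y)).
have BE x y : avg 1 g (x, y) = avg 1 g (x, 0) by exact: (avg_set_coord g 1 y (x, 0)).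
set c := (\int[leb]_(y in I) (avg 0 f (0, y))%:E)%E.
have m2 : measurable_fun I (fun y : R => (avg 0 f (0, y))%:E).
  apply: measurable_funTS; apply: (measurableT_comp mA).
  exact: measurable_pair1.
have m1 : measurable_fun I (fun x : R => (avg 1 g (x, 0))%:E).
  apply: measurable_funTS; apply: (measurableT_comp mB).
  exact: measurable_pair2.
have Ec : (\int[mu]_z (avg 0 f z)%:E = c)%E.
  by rewrite [LHS]EA (eq_integral (fun=> c)) ?cst1//.
have Ed : (\int[mu]_z (avg 1 g z)%:E = \int[leb]_(x in I) (avg 1 g (x, 0))%:E)%E.
  rewrite [LHS]EB; apply: eq_integral => x _.
  rewrite -[RHS]cst1; apply: eq_integral => y _; by rewrite /= BE.
have mI : measurable I by exact: measurable_itv.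
have g0' x : I x -> (0 <= (avg 1 g (x, 0))%:E)%E by move=> _; rewrite lee_fin.
have f0' y : I y -> (0 <= (avg 0 f (0, y))%:E)%E by move=> _; rewrite lee_fin.
have c0 : (0 <= c)%E by exact: integral_ge0.
have H : (\int[mu]_z (avg 0 f z * avg 1 g z)%:E =
    (\int[mu]_z (avg 0 f z)%:E) * \int[mu]_z (avg 1 g z)%:E)%E.
  rewrite [LHS]EAB Ec Ed -(ge0_integralZl leb mI m1 g0' c0).
  apply: eq_integral => x _; rewrite muleC.
  have b0 : (0 <= (avg 1 g (x, 0))%:E)%E by rewrite lee_fin.
  rewrite -(ge0_integralZl leb mI m2 f0' b0).
  by apply: eq_integral => y _; rewrite -EFinM /= AE BE mulrC.
have iA : mu.-integrable setT (EFin \o (avg 0 f : mplane R -> R)).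
  apply: (torus_bounded_integrable (C := C) mf) => z.
  by rewrite ger0_norm//; exact: avg_le.
have iB : mu.-integrable setT (EFin \o (avg 1 g : mplane R -> R)).
  apply: (torus_bounded_integrable (C := C) mg) => z.
  by rewrite ger0_norm//; exact: avg_le.
transitivity (fine ((\int[mu]_z (avg 0 f z)%:E) * \int[mu]_z (avg 1 g z)%:E)%E).
  by congr fine; exact: H.
rewrite fineM; [|exact: (integrable_fin_num measurableT iA)|exact: (integrable_fin_num measurableT iB)].
congr (_ * _); first exact: (integral_avg cf f0).
exact: (integral_avg cg g0).
Qed.

Definition energy f := \int[mu]_z (f z ^+ 2) + \sum_(j < 2) \int[mu]_z (partial j f z ^+ 2).

(** By [line_sup], [f ^+ 2] is at most the average of [p j] in either direction; the product of the
    two bounds dominates [f ^+ 4] and its integral factors. Each factor is at most [2 * energy f],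
    whence the 4. *)
Theorem ladyzhenskaya f : smooth f -> \int[mu]_z (f z ^+ 4) <= 4 * energy f ^+ 2.
Proof.
move=> fs; pose p j z := 2 * f z ^+ 2 + partial j f z ^+ 2.
have cf := smooth_continuous fs.
have cdf j := smooth_continuous (smooth_partial j fs).
have f2 := continuous_plane_sqr cf; have df2 j := continuous_plane_sqr (cdf j).
have fper := fs.1; have dfper j := torus_fun_partial j fper.
have cp j : continuous (p j).
  by move=> z; apply: cvgD; [apply: cvgM; [exact: cvg_cst|exact: f2]|exact: df2].
have p0 j z : 0 <= p j z by rewrite addr_ge0 ?sqr_ge0// mulr_ge0 ?sqr_ge0.
have pper j : torus_fun (p j).
  have [a1 a2] := fper; have [b1 b2] := dfper j.
  by split=> z; rewrite /p ?a1 ?b1 ?a2 ?b2.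
have [C0 pC0] := torus_continuous_bounded (pper 0) (cp 0).
have [C1 pC1] := torus_continuous_bounded (pper 1) (cp 1).
pose C := Num.max C0 C1.
have pC j z : p j z <= C.
  have [->|->] := ord2P j; rewrite le_max.
    by rewrite (le_trans (ler_norm _) (pC0 z)).
  by rewrite (le_trans (ler_norm _) (pC1 z)) orbT.
have fp j z : f z ^+ 2 <= avg j (p j) z.
  have [t t1 <-] := unit_coordinate j z fper.
  apply: (line_sup (F := fun t => f (set_coord j t z))
    (G := fun t => partial j f (set_coord j t z))) => //.
  - exact: continuous_line.
  - exact: continuous_line.
  - by move=> s; exact: smooth_line.
have int2 j : \int[mu]_z p j z <= 2 * energy f.
  have i1 := torus_continuous_integrable (torus_fun_sqr fper) f2.
  have i2 k := torus_continuous_integrable (torus_fun_sqr (dfper k)) (df2 k).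
  rewrite RintegralD//; last exact: (integrableZl _ 2 i1).
  rewrite RintegralZl// /energy mulrDr lerD2l.
  have d0 k : 0 <= \int[mu]_z (partial k f z ^+ 2) by apply: Rintegral_ge0 => z _; rewrite sqr_ge0.
  rewrite (le_trans (y := \sum_(k < 2) \int[mu]_z (partial k f z ^+ 2)))//.
    by rewrite (bigD1 j)//= lerDl sumr_ge0.
  by rewrite ler_peMl ?ler1n// sumr_ge0.
have q0 j : 0 <= \int[mu]_z p j z by apply: Rintegral_ge0.
apply: (@le_trans _ _ (\int[mu]_z (avg 0 (p 0) z * avg 1 (p 1) z))).
  apply: le_Rintegral => //.
  - have c4 : continuous (fun z => f z ^+ 4 : R).
      by rewrite (_ : (fun _ => _) = (fun z => (f z ^+ 2) ^+ 2)); [exact: continuous_plane_sqr|apply/funext => z; rewrite -exprM].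
    apply: torus_continuous_integrable c4.
    by have [a1 a2] := fper; split=> z; rewrite ?a1 ?a2.
  - apply: (@torus_bounded_integrable _ _ (C * C)).
      by apply: measurable_funM; exact: measurable_avg.
    move=> z; have a0 j := avg_ge0 (p0 j) j z.
    rewrite ger0_norm ?mulr_ge0// ler_pM//.
      exact: avg_le (cp 0) (pC 0) 0 z.
    exact: avg_le (cp 1) (pC 1) 1 z.
  - move=> z _; rewrite (_ : f z ^+ 4 = f z ^+ 2 * f z ^+ 2); last by rewrite -exprD.
    by rewrite ler_pM ?sqr_ge0.
rewrite (integral_avg_mul (cp 0) (cp 1) (p0 0) (p0 1) (pC 0) (pC 1)).
rewrite (_ : 4 * _ = (2 * energy f) * (2 * energy f)); last by ring.
by rewrite ler_pM.
Qed.

(** Two points are joined by an L-shaped path whose legs are bounded by averages attached to one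
    endpoint each. Averaging the squared difference over both points gives twice the integral of
    [f ^+ 2], the cross term vanishing with the mean; the 2 from splitting the path is cancelled, so
    the constant is 1. *)
Theorem poincare f : smooth f -> \int[mu]_z f z = 0 ->
  \int[mu]_z (f z ^+ 2) <= \sum_(j < 2) \int[mu]_z (partial j f z ^+ 2).
Proof.
move=> fs fI; pose q j z := partial j f z ^+ 2.
have cf := smooth_continuous fs.
have cdf j := smooth_continuous (smooth_partial j fs).
have f2 := continuous_plane_sqr cf; have cq j : continuous (q j) := continuous_plane_sqr (cdf j).
have fper := fs.1; have dfper j := torus_fun_partial j fper.
have qper j : torus_fun (q j) := torus_fun_sqr (dfper j).
have q0 j z : 0 <= q j z by exact: sqr_ge0.
have osc z w : (f z - f w) ^+ 2 <= 2 * avg 0 (q 0) z + 2 * avg 1 (q 1) w.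
  rewrite -(avg_wrap 0 z (qper 0)) -(avg_wrap 1 w (qper 1)).
  rewrite -(wrapE z fper) -(wrapE w fper).
  have [zx zy] := wrap_unit z; have [wx wy] := wrap_unit w.
  have le1 (x : R) : 0 <= x < 1 -> 0 <= x <= 1 by move=> /andP[-> /ltW ->].
  move: (wrap z) (wrap w) zx zy wx wy => [x y] [s t] /= /le1 x1 /le1 y1 /le1 s1 /le1 t1.
  (* The corner is [(s, y)]: the horizontal leg lies on the line of the first point, the vertical
     leg on that of the second. *)
  have h0 : (f (x, y) - f (s, y)) ^+ 2 <= avg 0 (q 0) (x, y).
    apply: (line_osc (F := fun r => f (set_coord 0 r (x, y)))
      (G := fun r => partial 0 f (set_coord 0 r (x, y))) _ _ s1 x1).
    - exact: continuous_line.
    - by move=> r; exact: smooth_line.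
  have h1 : (f (s, y) - f (s, t)) ^+ 2 <= avg 1 (q 1) (s, t).
    apply: (line_osc (F := fun r => f (set_coord 1 r (s, t)))
      (G := fun r => partial 1 f (set_coord 1 r (s, t))) _ _ t1 y1).
    - exact: continuous_line.
    - by move=> r; exact: smooth_line.
  rewrite -(subrK (f (s, y)) (f (x, y))) -addrA (le_trans (sqrD_le _ _))//.
  by apply: lerD; (apply: ler_wpM2l; first exact: ler0n); [exact: h0|exact: h1].
have [C0 qC0] := torus_continuous_bounded (qper 0) (cq 0).
have [C1 qC1] := torus_continuous_bounded (qper 1) (cq 1).
have iA0 : mu.-integrable setT (EFin \o (avg 0 (q 0) : mplane R -> R)).
  apply: (@torus_bounded_integrable _ _ C0); first exact: measurable_avg.
  move=> z; rewrite ger0_norm ?avg_ge0//.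
  by apply: avg_le => // w; exact: le_trans (ler_norm _) (qC0 w).
have iA1 : mu.-integrable setT (EFin \o (avg 1 (q 1) : mplane R -> R)).
  apply: (@torus_bounded_integrable _ _ C1); first exact: measurable_avg.
  move=> z; rewrite ger0_norm ?avg_ge0//.
  by apply: avg_le => // w; exact: le_trans (ler_norm _) (qC1 w).
have if1 := torus_continuous_integrable fper cf.
have if2 := torus_continuous_integrable (torus_fun_sqr fper) f2.
have i2A0 := torus_integrableZ 2 iA0; have i2A1 := torus_integrableZ 2 iA1.
have step w : \int[mu]_z (f z ^+ 2) + f w ^+ 2 <= 2 * \int[mu]_z q 0 z + 2 * avg 1 (q 1) w.
  have ifw := torus_integrableD (torus_integrableZ (- 2 * f w) if1) (torus_integrable_cst (f w ^+ 2)).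
  have E1 : \int[mu]_z (f z ^+ 2 + ((- 2 * f w) * f z + f w ^+ 2)) =
      \int[mu]_z (f z ^+ 2) + f w ^+ 2.
    rewrite (torus_RintegralD if2 ifw) (torus_RintegralZD _ if1 (torus_integrable_cst _)).
    by rewrite fI torus_integral_cst mulr0 add0r.
  have E2 : \int[mu]_z (2 * avg 0 (q 0) z + 2 * avg 1 (q 1) w) =
      2 * \int[mu]_z q 0 z + 2 * avg 1 (q 1) w.
    rewrite (torus_RintegralZD _ iA0 (torus_integrable_cst _)) torus_integral_cst.
    by rewrite (integral_avg (cq 0) (q0 0)).
  rewrite -E1 -E2; apply: le_Rintegral.
  - exact: measurableT.
  - exact: torus_integrableD.
  - exact: (torus_integrableD i2A0 (torus_integrable_cst _)).
  - move=> z _; rewrite [leLHS](_ : _ = (f z - f w) ^+ 2); [exact: osc|ring].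
have E3 : \int[mu]_w (\int[mu]_z (f z ^+ 2) + f w ^+ 2) =
    \int[mu]_z (f z ^+ 2) + \int[mu]_z (f z ^+ 2).
  by rewrite (torus_RintegralD (torus_integrable_cst _) if2) torus_integral_cst.
have E4 : \int[mu]_w (2 * \int[mu]_z q 0 z + 2 * avg 1 (q 1) w) =
    2 * \int[mu]_z q 0 z + 2 * \int[mu]_z q 1 z.
  rewrite (torus_RintegralD (torus_integrable_cst _) i2A1) torus_integral_cst.
  congr (_ + _); rewrite -(integral_avg (cq 1) (q0 1) 1); exact: torus_RintegralZ.
rewrite sum_ord2; apply: double_le; rewrite -E3 -E4; apply: le_Rintegral.
- exact: measurableT.
- exact: (torus_integrableD (torus_integrable_cst _) if2).
- exact: (torus_integrableD (torus_integrable_cst _) i2A1).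
- by move=> w _; exact: step.
Qed.

End smooth_inequalities.

(** * The fundamental lemma of the calculus of variations *)

Section smooth_expressions.
Variable R : realType.
Implicit Types (f g : plane R -> R) (j : 'I_2) (z : plane R) (t : R).

Local Notation dir f := (f : (R^o * R^o)%type -> R^o).

Lemma set_coord_self j z : set_coord j (if j == 0 then z.1 else z.2) z = z.
Proof. by rewrite /set_coord; case: (j == 0); case: z. Qed.

Lemma line_partial f g j :
  (forall z t, is_derive t 1 (fun t => f (set_coord j t z)) (g (set_coord j t z))) ->
  forall z, derivable (dir f) z (basis_vector R j) /\ partial j f z = g z.
Proof.
move=> dfg z; pose t := if j == 0 then z.1 else z.2.
have zE : set_coord j t z = z := set_coord_self j z.
have [] := dfg z t.
have E : (fun h => h^-1 *: (((fun t => f (set_coord j t z)) \o shift t) (h *: (1 : R))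
     - f (set_coord j t z))) =
   (fun h => h^-1 *: ((dir f \o shift z) (h *: basis_vector R j) - dir f z)).
  apply/funext => h; rewrite /= -{3}zE set_coordD zE; congr (_ *: (f (set_coord j _ z) - _)).
  by rewrite /GRing.scale/= mulr1.
rewrite /derivable /derive E => d1 d2; split=> //.
by rewrite /partial /derive d2 zE.
Qed.

(** Smoothness asks for all iterated partial derivatives. A syntax closed under symbolic
    differentiation provides them by one induction, and it is rich enough for the periodic cut-offs
    below. *)
Inductive sexp :=
  | Cst of R | Sin of R & R & R | Cos of R & R & R
  | Add of sexp & sexp | Mul of sexp & sexp | Exp of sexp.

Fixpoint seval e z : R := match e with
  | Cst c => c
  | Sin a b c => sin (a * z.1 + b * z.2 + c)
  | Cos a b c => cos (a * z.1 + b * z.2 + c)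
  | Add e1 e2 => seval e1 z + seval e2 z
  | Mul e1 e2 => seval e1 z * seval e2 z
  | Exp e1 => expR (seval e1 z)
  end.

Fixpoint sdiff j e : sexp := match e with
  | Cst c => Cst 0
  | Sin a b c => Mul (Cst (if j == 0 then a else b)) (Cos a b c)
  | Cos a b c => Mul (Cst (- (if j == 0 then a else b))) (Sin a b c)
  | Add e1 e2 => Add (sdiff j e1) (sdiff j e2)
  | Mul e1 e2 => Add (Mul (sdiff j e1) e2) (Mul e1 (sdiff j e2))
  | Exp e1 => Mul (sdiff j e1) (Exp e1)
  end.

Lemma continuous_seval e : continuous (seval e).
Proof.
have lin a b c : continuous (fun z : plane R => a * z.1 + b * z.2 + c : R).
  move=> z; apply: cvgD; last exact: cvg_cst.
  by apply: cvgD; apply: cvgM; [exact: cvg_cst|exact: cvg_fst|exact: cvg_cst|exact: cvg_snd].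
elim: e => [c|a b c|a b c|e1 IH1 e2 IH2|e1 IH1 e2 IH2|e1 IH1] z /=.
- exact: cvg_cst.
- by apply: (continuous_comp (lin a b c z)); exact: continuous_sin.
- by apply: (continuous_comp (lin a b c z)); exact: continuous_cos.
- by apply: cvgD; [exact: IH1|exact: IH2].
- by apply: cvgM; [exact: IH1|exact: IH2].
- by apply: (continuous_comp (IH1 z)); exact: continuous_expR.
Qed.

Lemma line_seval e j z t :
  is_derive t 1 (fun t => seval e (set_coord j t z)) (seval (sdiff j e) (set_coord j t z)).
Proof.
have lin a b c : is_derive t 1
    (fun t => a * (set_coord j t z).1 + b * (set_coord j t z).2 + c)
    (if j == 0 then a else b).
  rewrite /set_coord; case: (j == 0) => /=.
    by apply: is_derive_eq; rewrite /GRing.scale/= mulr1; ring.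
  by apply: is_derive_eq; rewrite /GRing.scale/= mulr1; ring.
elim: e => [c|a b c|a b c|e1 IH1 e2 IH2|e1 IH1 e2 IH2|e1 IH1] /=.
- exact: is_derive_cst.
- have L := lin a b c.
  rewrite mulrC; exact: (is_derive1_comp (is_derive_sin _) L).
- have L := lin a b c.
  rewrite mulNr mulrC -mulNr; exact: (is_derive1_comp (is_derive_cos _) L).
- by apply: is_derive_eq.
- by apply: is_derive_eq; rewrite /GRing.scale/= addrC; congr (_ + _); rewrite mulrC.
- rewrite mulrC; exact: (is_derive1_comp (is_derive_expR _) IH1).
Qed.

Lemma partial_seval j e : partial j (seval e) = seval (sdiff j e).
Proof.
by apply/funext => z; have [_] := line_partial (line_seval e j) z.
Qed.

Lemma smooth_seval e : torus_fun (seval e) -> smooth (seval e).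
Proof.
move=> eper; split=> // s.
have -> : foldr (@partial R) (seval e) s = seval (foldr sdiff e s).
  by elim: s => //= j s ->; rewrite partial_seval.
split; first exact: continuous_seval.
by move=> j z; have [] := line_partial (line_seval (foldr sdiff e s) j) z.
Qed.

Lemma smooth_cst (c : R) : smooth (fun=> c : R).
Proof. exact: (@smooth_seval (Cst c)). Qed.

(* [exp (- exp (- n p))] tends to 1 where [p > 0] and to 0 where [p < 0]. *)
Definition soft_step (n : nat) (p : R) : R := expR (- expR (- n%:R * p)).

Lemma soft_step_unit n p : 0 <= soft_step n p <= 1.
Proof.
by rewrite expR_ge0/= -expR0 ler_expR oppr_le0 expR_ge0.
Qed.

Lemma cvg_soft_step_pos p : 0 < p -> soft_step n p @[n --> \oo] --> (1 : R).
Proof.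
move=> p0; apply/cvgrPdist_le => e e0; near=> n.
have [/andP[s0 s1] n0] := (soft_step_unit n p, @ler0n R n).
rewrite ger0_norm ?subr_ge0// lerBlDr -lerBlDl.
apply: le_trans (expR_ge1Dx _); rewrite lerD2l lerN2 mulNr expRN.
have np : e^-1 <= expR (n%:R * p).
  apply: le_trans (expR_ge1Dx _); rewrite ler_wpDl// -ler_pdivrMr//.
  by near: n; exact: nbhs_infty_ger.
by rewrite invf_ple ?posrE ?expR_gt0.
Unshelve. all: by end_near. Qed.

Lemma cvg_soft_step_neg p : p < 0 -> soft_step n p @[n --> \oo] --> (0 : R).
Proof.
move=> p0; apply/cvgrPdist_le => e e0; near=> n.
have [/andP[s0 s1] n0] := (soft_step_unit n p, @ler0n R n).
rewrite sub0r normrN ger0_norm// /soft_step expRN invf_ple ?posrE ?expR_gt0//.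
apply: le_trans (expR_ge1Dx _); rewrite ler_wpDl//.
apply: le_trans (expR_ge1Dx _); rewrite ler_wpDl// mulNr -mulrN.
rewrite -ler_pdivrMr ?oppr_gt0//.
by near: n; exact: nbhs_infty_ger.
Unshelve. all: by end_near. Qed.

(** A smooth approximation, on the unit square, of the indicator of the box below [(b, c)]. The
    phase [sin (pi x) sin (pi (b - x))] has the sign of [b - x] for [0 < x < 1], and has period 1
    because both sines change sign under [x + 1]. *)
Definition box_exp (n : nat) (b c : R) : sexp :=
  let step p := Exp (Mul (Cst (-1)) (Exp (Mul (Cst (- n%:R)) p))) in
  Mul (step (Mul (Sin pi 0 0) (Sin (- pi) 0 (pi * b))))
      (step (Mul (Sin 0 pi 0) (Sin 0 (- pi) (pi * c)))).

Lemma box_expE n b c z : seval (box_exp n b c) z =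
  soft_step n (sin (pi * z.1) * sin (pi * (b - z.1))) *
  soft_step n (sin (pi * z.2) * sin (pi * (c - z.2))).
Proof.
rewrite /= /soft_step !mul0r !addr0 !add0r !mulN1r.
by rewrite (_ : - pi * z.1 + pi * b = pi * (b - z.1)) 1?(_ : - pi * z.2 + pi * c = pi * (c - z.2))//; ring.
Qed.

Lemma smooth_box n b c : smooth (seval (box_exp n b c)).
Proof.
apply: smooth_seval.
have per (b' x : R) : sin (pi * (x + 1)) * sin (pi * (b' - (x + 1))) =
    sin (pi * x) * sin (pi * (b' - x)).
  rewrite mulrDr mulr1 sinDpi (_ : pi * (b' - (x + 1)) = pi * (b' - x) - pi); last by ring.
  by rewrite -[X in _ = _ * sin X](subrK pi) sinDpi mulNr mulrN.
split=> z; rewrite !box_expE /= addr0 per//.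
Qed.

Lemma box_sign (b x : R) : 0 < b <= 1 -> 0 < x < 1 -> x != b ->
  if x < b then 0 < sin (pi * x) * sin (pi * (b - x))
  else sin (pi * x) * sin (pi * (b - x)) < 0.
Proof.
move=> /andP[b0 b1] /andP[x0 x1] xb; have p0 := pi_gt0 R.
have sp (y : R) : 0 < y < 1 -> 0 < sin (pi * y).
  by move=> /andP[y0 y1]; apply: sin_gt0_pi; rewrite mulr_gt0//= gtr_pMr.
case: ltP => h; first by rewrite mulr_gt0 ?sp ?x0//; apply/andP; split; lra.
rewrite pmulr_rlt0 ?sp ?x0// -opprB mulrN sinN oppr_lt0 sp//.
have {}xb : b < x by rewrite lt_neqAle eq_sym xb.
by apply/andP; split; lra.
Qed.

End smooth_expressions.

(** * Functions orthogonal to all smooth periodic functions *)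

Section fundamental_lemma.
Variable R : realType.
Local Notation mu := (@torus_measure R).
Local Notation leb := (@lebesgue_measure R).
Local Notation I := (`[0%R, 1%R[%classic : set R).
Local Notation D := (@fundamental_domain R).
Implicit Types (f g : mplane R -> R).

Lemma ae_domain : {ae mu, forall z : mplane R, D z}.
Proof.
exists (~` D); split.
- exact: measurableC (@measurable_fundamental_domain R).
- by rewrite /= /mrestr setICl measure0.
- by move=> z.
Qed.

Lemma ae_fst_neq (x : R) : {ae mu, forall z : mplane R, z.1 != x}.
Proof.
have mA : measurable ([set x] `*` setT : set (mplane R)).
  by apply: measurableX => //; exact: measurable_set1.
exists ([set x] `*` setT); split => //.
- rewrite /= /mrestr -setXI product_measure1E; last 2 first.
    by apply: measurableI; [exact: measurable_set1|exact: measurable_itv].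
    by apply: measurableI => //; exact: measurable_itv.
  apply/eqP; rewrite mule_eq0; apply/orP; left; apply/eqP.
  apply: (@subset_measure0 _ _ _ leb _ [set x]).
  - by apply: measurableI; [exact: measurable_set1|exact: measurable_itv].
  - exact: measurable_set1.
  - by move=> y [].
  - exact: lebesgue_measure_set1.
- by move=> [y1 y2] /= /negP/negPn/eqP ->.
Qed.

Lemma ae_snd_neq (x : R) : {ae mu, forall z : mplane R, z.2 != x}.
Proof.
have mA : measurable (setT `*` [set x] : set (mplane R)).
  by apply: measurableX => //; exact: measurable_set1.
exists (setT `*` [set x]); split => //.
- rewrite /= /mrestr -setXI product_measure1E; last 2 first.
    by apply: measurableI => //; exact: measurable_itv.
    by apply: measurableI; [exact: measurable_set1|exact: measurable_itv].
  apply/eqP; rewrite mule_eq0; apply/orP; right; apply/eqP.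
  apply: (@subset_measure0 _ _ _ leb _ [set x]).
  - by apply: measurableI; [exact: measurable_set1|exact: measurable_itv].
  - exact: measurable_set1.
  - by move=> y [].
  - exact: lebesgue_measure_set1.
- by move=> [y1 y2] /= /negP/negPn/eqP ->.
Qed.

Lemma sqint_integrable f : sqint mu f -> mu.-integrable setT (EFin \o f).
Proof.
move=> sf; have s1 : sqint mu (fun _ : mplane R => 1) := smooth_sqint (smooth_cst 1).
have := sqint_mul_integrable sf s1.
by rewrite (_ : (fun x => f x * 1) = f)//; apply/funext => x; rewrite mulr1.
Qed.

Lemma dominated_zero (F_ : nat -> mplane R -> R) (F g : mplane R -> R) :
  (forall n, measurable_fun setT (F_ n)) -> measurable_fun setT F ->
  {ae mu, forall z, F_ n z @[n --> \oo] --> F z} ->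
  mu.-integrable setT (EFin \o g) -> (forall n z, `|F_ n z| <= g z) ->
  (forall n, \int[mu]_z F_ n z = 0) -> \int[mu]_z F z = 0.
Proof.
move=> mF_ mF cF ig Fg F0.
have [||||_ _ H] := @dominated_convergence _ _ _ mu setT measurableT
  (fun n => EFin \o F_ n) (EFin \o F) (EFin \o g) _ _ _ ig.
- by move=> n; apply/measurable_EFinP; exact: mF_.
- by apply/measurable_EFinP.
- apply: filterS cF => z Fz _; apply: cvg_EFin => //; exact: nearW.
- by apply: aeW => z n _; rewrite lee_fin; exact: Fg.
have iF n : mu.-integrable setT (EFin \o F_ n).
  apply: (le_integrable _ _ _ ig) => //; first by apply/measurable_EFinP; exact: mF_.
  by move=> z _; rewrite lee_fin (le_trans (Fg n z))// ler_norm.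
have E : [sequence (\int[mu]_z (EFin \o F_ n) z)%E]_n = (fun=> 0%E).
  apply/funext => n; rewrite -[LHS]fineK; last exact: (integrable_fin_num measurableT (iF n)).
  by congr EFin; exact: F0.
rewrite E in H.
by rewrite /Rintegral (_ : (\int[mu]_z (F z)%:E)%E = 0%E)//; apply: cvg_unique H _ => //; exact: cvg_cst.
Qed.

Definition quadrant (b c : R) : set (mplane R) := `]-oo, b[ `*` `]-oo, c[.

Lemma measurable_quadrant b c : measurable (quadrant b c).
Proof. by apply: measurableX; exact: measurable_itv. Qed.

Section orthogonal.
Variable d : mplane R -> R.
Hypotheses (sd : sqint mu d)
  (d0 : forall phi, smooth phi -> \int[mu]_z (d z * phi z) = 0).

Let md : measurable_fun setT d := sd.1.

Let id : mu.-integrable setT (EFin \o d) := sqint_integrable sd.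

Let inorm : mu.-integrable setT (EFin \o (fun z => `|d z|)).
Proof. exact: (integrable_abse id). Qed.

Let measurable_dM (A : set (mplane R)) : measurable A ->
  measurable_fun setT (fun z => d z * \1_A z).
Proof. by move=> mA; apply: measurable_funM => //; exact: measurable_indic. Qed.

Let dM_norm (A : set (mplane R)) z : `|d z * \1_A z| <= `|d z|.
Proof.
by rewrite normrM ler_piMr// indicE; case: (z \in A); rewrite ?normr1 ?normr0.
Qed.

Let iM (A : set (mplane R)) : measurable A ->
  mu.-integrable setT (EFin \o (fun z => d z * \1_A z)).
Proof.
move=> mA; apply: (le_integrable _ _ _ id) => //.
  by apply/measurable_EFinP; exact: measurable_dM.
by move=> z _; rewrite lee_fin.
Qed.

(** Dominated convergence along the soft boxes, which are admissible test functions. *)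
Let box_zero b c : 0 < b <= 1 -> 0 < c <= 1 -> \int[mu]_z (d z * \1_(quadrant b c) z) = 0.
Proof.
move=> b1 c1.
apply: (@dominated_zero (fun n z => d z * seval (box_exp n b c) z) _ (fun z => `|d z|)).
- move=> n; apply: measurable_funM => //; apply: continuous_measurable_plane.
  exact: continuous_seval.
- exact: measurable_dM (measurable_quadrant b c).
(* On the excluded lines the phase vanishes and [soft_step] stays at [exp (-1)]. *)
- have ae_good : {ae mu, forall z : mplane R,
      D z /\ ((z.1 != 0 /\ z.1 != b) /\ (z.2 != 0 /\ z.2 != c))}.
    apply: filterS2 ae_domain _ => [z Dz|]; first by move=> h; split; [exact: Dz|exact: h].
    apply: filterS2 _ _ => [z h1 h2||]; first by split; [exact: h1|exact: h2].
    - by apply: filterS2 (ae_fst_neq 0) (ae_fst_neq b) => z ? ?; split.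
    - by apply: filterS2 (ae_snd_neq 0) (ae_snd_neq c) => z ? ?; split.
  apply: filterS ae_good => -[x y] [[/= Dx Dy] [[x0 xb] [y0 yc]]].
  have unit (t : R) : I t -> t != 0 -> 0 < t < 1.
    by rewrite /= in_itv /= => /andP[t0 ->] tn0; rewrite lt_neqAle eq_sym tn0 t0.
  have step (b' t : R) : 0 < b' <= 1 -> I t -> t != 0 -> t != b' ->
      soft_step n (sin (pi * t) * sin (pi * (b' - t))) @[n --> \oo] --> ((t < b')%R%:R : R).
    move=> b'1 It t0 tb; have := box_sign b'1 (unit t It t0) tb.
    by case: (t < b') => h; [exact: cvg_soft_step_pos|exact: cvg_soft_step_neg].
  have -> : (fun n => d (x, y) * seval (box_exp n b c) (x, y)) = (fun n => d (x, y) *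
      (soft_step n (sin (pi * x) * sin (pi * (b - x))) *
       soft_step n (sin (pi * y) * sin (pi * (c - y))))).
    by apply/funext => n; rewrite box_expE.
  apply: cvgM; first exact: cvg_cst.
  have -> : \1_(quadrant b c) (x, y) = ((x : R) < b)%R%:R * ((y : R) < c)%R%:R :> R.
    rewrite indicE in_setX -natrM mulnb; congr ((_ && _)%:R).
      by apply/idP/idP; rewrite inE /= in_itv.
    by apply/idP/idP; rewrite inE /= in_itv.
  by apply: cvgM; exact: step.
- exact: inorm.
- move=> n z; rewrite normrM ler_piMr// box_expE normrM.
  have u (p : R) : `|soft_step n p| <= 1.
    by have /andP[p0 p1] := soft_step_unit n p; rewrite ger0_norm.
  by rewrite -[leRHS]mulr1 ler_pM.
- by move=> n; apply: d0; exact: smooth_box.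
Qed.

Let ae_zero (F : mplane R -> R) : measurable_fun setT F ->
  {ae mu, forall z, F z = 0} -> \int[mu]_z F z = 0.
Proof.
move=> mF F0; transitivity (fine (\int[mu]_z cst 0%E z)); last by rewrite integral0.
congr fine; apply: ae_eq_integral.
- exact: measurableT.
- exact/measurable_EFinP.
- exact: measurable_cst.
- by apply: filterS F0 => z /= Fz _; rewrite /= Fz.
Qed.

(** Only the trace on the fundamental domain counts: it is empty if [b] or [c] is nonpositive, and
    otherwise unchanged when both are capped at 1. *)
Let quadrant_zero b c : \int[mu]_z (d z * \1_(quadrant b c) z) = 0.
Proof.
have [b0|b0] := leP b 0.
  apply: ae_zero; first exact: measurable_dM (measurable_quadrant b c).
  apply: filterS ae_domain => -[x y] [/= + _]; rewrite in_itv /= => /andP[x0 _].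
  rewrite indicE memNset ?mulr0// => -[/= + _]; rewrite in_itv /= => xb.
  by have := lt_le_trans xb b0; rewrite ltNge x0.
have [c0|c0] := leP c 0.
  apply: ae_zero; first exact: measurable_dM (measurable_quadrant b c).
  apply: filterS ae_domain => -[x y] [/= _ +]; rewrite in_itv /= => /andP[x0 _].
  rewrite indicE memNset ?mulr0// => -[/= _ +]; rewrite in_itv /= => xb.
  by have := lt_le_trans xb c0; rewrite ltNge x0.
have m1 (t : R) : 0 < t -> 0 < Num.min t 1 <= 1.
  by move=> t0; rewrite lt_min t0 ltr01 ge_min lexx orbT.
rewrite -[RHS](box_zero (m1 b b0) (m1 c c0)); congr fine; apply: ae_eq_integral.
- exact: measurableT.
- by apply/measurable_EFinP; exact: measurable_dM (measurable_quadrant _ _).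
- by apply/measurable_EFinP; exact: measurable_dM (measurable_quadrant _ _).
apply: filterS ae_domain => -[x y] [/= + +] _; rewrite !in_itv /= => /andP[_ x1] /andP[_ y1].
congr (_ * _)%:E; rewrite !indicE !in_setX; congr ((_ && _)%:R);
  by apply/idP/idP; rewrite !inE /= !in_itv /= lt_min ?x1 ?y1 ?andbT.
Qed.

Let H : set (set (mplane R)) :=
  [set A | measurable A /\ \int[mu]_z (d z * \1_A z) = 0].

Let H_lambda : lambda_system setT H.
Proof.
split.
- by move=> A _.
- split; first exact: measurableT.
  rewrite -(d0 (smooth_cst 1)); apply: eq_Rintegral => z _.
  by rewrite indicE in_setT.
- move=> A B BA [mA A0] [mB B0]; split; first exact: measurableD.
  have -> : \int[mu]_z (d z * \1_(A `\` B) z) =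
      \int[mu]_z (-1 * (d z * \1_B z) + d z * \1_A z).
    apply: eq_Rintegral => z _; rewrite !indicE in_setD.
    have : z \in B -> z \in A by rewrite !inE; exact: BA.
    case: (z \in A); case: (z \in B) => /=; rewrite ?mulr0 ?mulr1 ?addr0 ?mulN1r ?addNr ?oppr0 ?add0r//.
    by move=> /(_ isT).
  by rewrite (torus_RintegralZD _ (iM mB) (iM mA)) A0 B0 mulr0 addr0.
- move=> F ndF HF; have mF n : measurable (F n) by case: (HF n).
  have mU : measurable (\bigcup_n F n) by exact: bigcup_measurable.
  split=> //; apply: (@dominated_zero (fun n z => d z * \1_(F n) z) _ (fun z => `|d z|)).
  + by move=> n; exact: measurable_dM.
  + exact: measurable_dM.
  + apply: aeW => z; apply: cvgM; first exact: cvg_cst.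
    have [[N _ FN]|nF] := pselect ((\bigcup_n F n) z).
      apply: cvg_near_cst; exists N => // n /= Nn; rewrite !indicE !mem_set//.
        by exists N.
      by move: z FN; apply/subsetPset; exact: ndF.
    apply: cvg_near_cst; exists 0%N => // n _; rewrite !indicE !memNset// => Fn.
    by apply: nF; exists n.
  + exact: inorm.
  + by move=> n z; exact: dM_norm.
  + by move=> n; case: (HF n).
Qed.

(** A pi-lambda argument: quadrants are stable under intersection and generate the product
    sigma-algebra, while the sets over which [d] integrates to 0 form a lambda-system. *)
Theorem torus_fundamental : d = (fun=> 0) %[ae mu].
Proof.
pose G : set (set (mplane R)) := [set A | exists b c, A = quadrant b c].
have GI : setI_closed G.
  move=> _ _ [b [c ->]] [b' [c' ->]]; exists (Num.min b b'), (Num.min c c').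
  rewrite -setXI; congr (_ `*` _); apply/seteqP; split=> x /=;
    rewrite !in_itv /= lt_min; by [move=> [-> ->]|move=> /andP[]].
have mE : @measurable _ (mplane R) `<=` <<s G >>.
  rewrite measurable_prod_measurableType.
  apply: smallest_sub; first exact: smallest_sigma_algebra.
  pose T := g_sigma_algebraType G.
  have mT (b c : R) : measurable (quadrant b c : set T) by apply: sub_sigma_algebra; exists b, c.
  have m1 : measurable_fun setT (fst : T -> R).
    apply: (measurability _ (RGenInftyO.measurableE R)) => _ [_ [b ->] <-].
    rewrite setTI (_ : _ @^-1` _ = \bigcup_n (quadrant b n%:R : set T)).
      exact: bigcup_measurable.
    apply/seteqP; split=> [[x y] /= xb|[x y] [n _ []]//].
    by exists (Num.truncn y).+1 => //; split=> //=; rewrite in_itv /= truncnS_gt.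
  have m2 : measurable_fun setT (snd : T -> R).
    apply: (measurability _ (RGenInftyO.measurableE R)) => _ [_ [b ->] <-].
    rewrite setTI (_ : _ @^-1` _ = \bigcup_n (quadrant n%:R b : set T)).
      exact: bigcup_measurable.
    apply/seteqP; split=> [[x y] /= xb|[x y] [n _ []]//].
    by exists (Num.truncn x).+1 => //; split=> //=; rewrite in_itv /= truncnS_gt.
  move=> _ [A mA [B mB <-]].
  have := measurableI _ _ (m1 measurableT A mA) (m2 measurableT B mB).
  by rewrite !setTI.
have all0 A : measurable A -> \int[mu]_z (d z * \1_A z) = 0.
  move=> /mE GA; have [] // := lambda_system_subset GI H_lambda _ _ GA.
  by move=> _ [b [c ->]]; split; [exact: measurable_quadrant|exact: quadrant_zero].
have : ae_eq mu setT (EFin \o d) (cst 0%E).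
  apply: (integral_ae_eq measurableT id); first exact: measurable_cst.
  move=> A _ mA; rewrite integral0 integral_mkcond.
  rewrite -[LHS]fineK; last first.
    apply: (integrable_fin_num measurableT).
    by apply/(integrable_mkcond _ mA); exact: (integrableS measurableT).
  congr EFin; rewrite -[RHS](all0 A mA); congr fine; apply: eq_integral => z _.
  rewrite patchE /= indicE; case: (z \in A); by rewrite ?mulr1 ?mulr0.
by apply: filterS => z /(_ Logic.I) [].
Qed.
End orthogonal.
End fundamental_lemma.

(** * Weak derivatives and H1 *)

Lemma lin_form_arith (R : comRingType) (A B P Q c k : R) :
  k * A + B + c * (k * P + Q) = k * (A + c * P) + (B + c * Q).
Proof. ring. Qed.

Section weak_derivatives.
Variable R : realType.
Local Notation mu := (@torus_measure R).
Local Notation ip := (@integral_mul _ (mplane R) R mu).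
Local Notation n2 := (seminorm ip).
Local Notation sq := (@sqint _ (mplane R) R mu).
Implicit Types (f g : plane R -> R) (u v w : field R) (i j : 'I_2) (z : plane R).

Lemma L2E f : L2 f <-> torus_fun f /\ sq f.
Proof. by split=> -[fper f2]; split=> //; apply/sqintE. Qed.

Lemma L2_sqint f : L2 f -> sq f. Proof. by move=> /L2E[]. Qed.

Lemma L2P (k : R) f g : L2 f -> L2 g -> L2 (fun z => k * f z + g z).
Proof.
move=> /L2E[[f1 f2] sf] /L2E[[g1 g2] sg]; apply/L2E; split; last exact: sqintP.
by split=> z; rewrite ?f1 ?f2 ?g1 ?g2.
Qed.

Lemma smooth_L2 f : smooth f -> L2 f.
Proof. by move=> fs; apply/L2E; split; [exact: fs.1|exact: smooth_sqint]. Qed.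

Lemma is_weak_partial_lin j (k : R) f g f' g' :
  sq f -> sq g -> sq f' -> sq g' ->
  is_weak_partial j f f' -> is_weak_partial j g g' ->
  is_weak_partial j (fun z => k * f z + g z) (fun z => k * f' z + g' z).
Proof.
move=> sf sg sf' sg' wf wg phi sphi.
have s1 := smooth_sqint sphi; have s2 := smooth_sqint (smooth_partial j sphi).
have := integral_mul_lin k sf sg s2; rewrite /integral_mul => ->.
have := integral_mul_lin k sf' sg' s1; rewrite /integral_mul => ->.
by rewrite (wf _ sphi) (wg _ sphi) opprD mulrN.
Qed.

Lemma weak_partial_unique j f g g' : L2 g -> L2 g' ->
  is_weak_partial j f g -> is_weak_partial j f g' -> g = g' %[ae mu].
Proof.
move=> /L2_sqint sg /L2_sqint sg' wg wg'.
have sd : sq (fun z => -1 * g' z + g z) by exact: sqintP.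
have gg' : (fun z => -1 * g' z + g z) = (fun=> 0) %[ae mu].
  apply: (torus_fundamental sd) => phi sphi.
  have := integral_mul_lin (-1) sg' sg (smooth_sqint sphi); rewrite /integral_mul => ->.
  apply: oppr_inj; rewrite opprD mulN1r opprK oppr0.
  by rewrite -(wg _ sphi) -[X in X + _]opprK -(wg' _ sphi) addNr.
exact: ae_eq_subr gg'.
Qed.

Lemma weak_partialP j f : H1 f ->
  L2 (weak_partial j f) /\ is_weak_partial j f (weak_partial j f).
Proof.
move=> [_ /(_ j)[g gP]]; rewrite /weak_partial.
by have := @xgetPex _ (fun=> 0) [set g | L2 g /\ is_weak_partial j f g] (ex_intro _ g gP).
Qed.

Lemma weak_partial_L2 j f : H1 f -> L2 (weak_partial j f).
Proof. by move=> /(weak_partialP j)[]. Qed.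

Lemma weak_partial_sqint j f : H1 f -> sq (weak_partial j f).
Proof. by move=> /(weak_partial_L2 j)/L2_sqint. Qed.

Lemma weak_partial_ae j f g : H1 f -> L2 g -> is_weak_partial j f g ->
  weak_partial j f = g %[ae mu].
Proof.
by move=> /(weak_partialP j)[w1 w2] g1 g2; exact: weak_partial_unique w2 g2.
Qed.

Lemma H1P (k : R) f g : H1 f -> H1 g -> H1 (fun z => k * f z + g z).
Proof.
move=> hf hg; split; first exact: L2P hf.1 hg.1.
move=> j; have [a1 a2] := weak_partialP j hf; have [b1 b2] := weak_partialP j hg.
exists (fun z => k * weak_partial j f z + weak_partial j g z).
split; first exact: L2P.
by apply: is_weak_partial_lin => //; apply: L2_sqint => //; [exact: hf.1|exact: hg.1].
Qed.

(** Only almost everywhere, since [weak_partial] picks a representative for each function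
    separately; uniqueness of weak derivatives relates the choices. *)
Lemma weak_partial_lin j (k : R) f g : H1 f -> H1 g ->
  weak_partial j (fun z => k * f z + g z) =
  (fun z => k * weak_partial j f z + weak_partial j g z) %[ae mu].
Proof.
move=> hf hg; have [a1 a2] := weak_partialP j hf; have [b1 b2] := weak_partialP j hg.
apply: weak_partial_ae; [exact: H1P|exact: L2P|].
by apply: is_weak_partial_lin => //; apply: L2_sqint => //; [exact: hf.1|exact: hg.1].
Qed.

Lemma smooth_is_weak_partial j f : smooth f -> is_weak_partial j f (partial j f).
Proof. by move=> fs phi sphi; exact: smooth_by_parts. Qed.

Lemma smooth_H1 f : smooth f -> H1 f.
Proof.
move=> fs; split; first exact: smooth_L2.
move=> j; exists (partial j f).
by split; [exact/smooth_L2/smooth_partial|exact: smooth_is_weak_partial].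
Qed.

Lemma smooth_weak_partial j f : smooth f -> weak_partial j f = partial j f %[ae mu].
Proof.
move=> fs; apply: weak_partial_ae; first exact: smooth_H1.
  exact/smooth_L2/smooth_partial.
exact: smooth_is_weak_partial.
Qed.

Lemma integral_mul_eq f f' g g' : sq f -> sq f' -> sq g -> sq g' ->
  f = f' %[ae mu] -> g = g' %[ae mu] -> ip f g = ip f' g'.
Proof. by move=> sf sf' sg sg'; exact: ae_eq_integral_mul. Qed.

Lemma L2_field_closed : submod_closed (mem (@L2_field R : set (field R)) : {pred field R}).
Proof.
split=> [|k u v]; rewrite !inE.
  by move=> i; apply: smooth_L2; exact: smooth_cst.
by move=> hu hv i; exact: (L2P k (hu i) (hv i)).
Qed.

Lemma H1_field_closed : submod_closed (mem (@H1_field R : set (field R)) : {pred field R}).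
Proof.
split=> [|k u v]; rewrite !inE.
  by move=> i; apply: smooth_H1; exact: smooth_cst.
by move=> hu hv i; exact: (H1P k (hu i) (hv i)).
Qed.

Definition L2_submodule := Submodule L2_field_closed.
Definition H1_submodule := Submodule H1_field_closed.

Lemma dotL2_semi_inner : semi_inner_in L2_submodule (@dotL2 R).
Proof.
split.
- by move=> u v _ _; apply: eq_bigr => i _; exact: integral_mulC.
- move=> k u v w hu hv hw; rewrite /dotL2 mulr_sumr -big_split /=.
  apply: eq_bigr => i _.
  have E := integral_mul_lin k (L2_sqint (hu i)) (L2_sqint (hv i)) (L2_sqint (hw i)).
  by rewrite /integral_mul in E; exact: E.
- by move=> u _; apply: sumr_ge0 => i _; exact: integral_mul_ge0.
Qed.

Lemma dot_grad_semi_inner : semi_inner_in H1_submodule (@dot_grad R).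
Proof.
split.
- by move=> u v _ _; apply: eq_bigr => i _; apply: eq_bigr => j _; exact: integral_mulC.
- move=> k u v w hu hv hw; rewrite /dot_grad mulr_sumr -big_split /=.
  apply: eq_bigr => i _; rewrite mulr_sumr -big_split /=; apply: eq_bigr => j _.
  have su := weak_partial_sqint j (hu i); have sv := weak_partial_sqint j (hv i).
  have sw := weak_partial_sqint j (hw i).
  have E1 := integral_mul_lin k su sv sw.
  have E2 := integral_mul_eq (weak_partial_sqint j (H1P k (hu i) (hv i))) (sqintP k su sv) sw sw
    (weak_partial_lin j k (hu i) (hv i)) (ae_eq_refl mu setT (weak_partial j (w i))).
  by rewrite /integral_mul in E1 E2; exact: etrans E2 E1.
- by move=> u _; apply: sumr_ge0 => i _; apply: sumr_ge0 => j _; exact: integral_mul_ge0.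
Qed.

(** The inner product of the regularised equation for [c = alpha ^+ 2], and that of H1 for
    [c = 1]. *)
Definition form (c : R) u v := dotL2 u v + c * dot_grad u v.

Lemma H1_L2_field u : H1_field u -> L2_field u.
Proof. by move=> hu i; exact: (hu i).1. Qed.

Lemma form_semi_inner (c : R) : 0 <= c -> semi_inner_in H1_submodule (form c).
Proof.
move=> c0; have [a1 a2 a3] := dotL2_semi_inner; have [b1 b2 b3] := dot_grad_semi_inner.
split.
- move=> u v hu hv; rewrite /form (b1 u v hu hv).
  by rewrite (a1 u v (H1_L2_field hu) (H1_L2_field hv)).
- move=> k u v w hu hv hw; rewrite /form (b2 k u v w hu hv hw).
  rewrite (a2 k u v w (H1_L2_field hu) (H1_L2_field hv) (H1_L2_field hw)).
  exact: lin_form_arith.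
- move=> u hu; apply: addr_ge0; first exact: (a3 u (H1_L2_field hu)).
  by apply: mulr_ge0 => //; exact: b3.
Qed.

Lemma normH1E u : normH1 u = seminorm (form 1) u.
Proof. by rewrite /normH1 /seminorm /form mul1r. Qed.

End weak_derivatives.

Lemma sum_sqr_le2 (R : realDomainType) (x y : R) : 0 <= x -> 0 <= y ->
  x ^+ 2 + y ^+ 2 <= (x + y) ^+ 2.
Proof. by move=> x0 y0; have := mulr_ge0 x0 y0; lra. Qed.

Lemma sum_sqr_le (R : realDomainType) (F : 'I_2 -> R) : (forall i, 0 <= F i) ->
  \sum_(i < 2) F i ^+ 2 <= (\sum_(i < 2) F i) ^+ 2.
Proof. by move=> F0; rewrite !sum_ord2 sum_sqr_le2. Qed.

Lemma sum2_sqr_le (R : realDomainType) (F : 'I_2 -> 'I_2 -> R) :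
  (forall i j, 0 <= F i j) ->
  \sum_(i < 2) \sum_(j < 2) F i j ^+ 2 <= (\sum_(i < 2) \sum_(j < 2) F i j) ^+ 2.
Proof.
move=> F0; apply: le_trans (sum_sqr_le _); last by move=> i; rewrite sumr_ge0.
by apply: ler_sum => i _; exact: sum_sqr_le.
Qed.

Lemma sqr_le_sum (R : realDomainType) (F : 'I_2 -> R) i :
  F i ^+ 2 <= \sum_(k < 2) F k ^+ 2.
Proof. by rewrite (bigD1 i)//= lerDl sumr_ge0// => k _; rewrite sqr_ge0. Qed.

Lemma sqr_le_sum2 (R : realDomainType) (F : 'I_2 -> 'I_2 -> R) i j :
  F i j ^+ 2 <= \sum_(k < 2) \sum_(l < 2) F k l ^+ 2.
Proof.
apply: le_trans (sqr_le_sum (F i) j) _; rewrite [leRHS](bigD1 i)//= lerDl.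
by rewrite sumr_ge0// => k _; rewrite sumr_ge0// => l _; rewrite sqr_ge0.
Qed.

Lemma le_sqrt (R : rcfType) (x y : R) : 0 <= x -> x ^+ 2 <= y -> x <= Num.sqrt y.
Proof. by move=> x0 xy; rewrite -[x]ger0_norm// -sqrtr_sqr ler_wsqrtr. Qed.

Lemma sqrt_le (R : rcfType) (x y : R) : 0 <= y -> x <= y ^+ 2 -> Num.sqrt x <= y.
Proof. by move=> y0 xy; rewrite -[y]ger0_norm// -sqrtr_sqr ler_wsqrtr. Qed.

(** * Completeness of H1 *)

Section completeness.
Variable R : realType.
Local Notation mu := (@torus_measure R).
Local Notation ip := (@integral_mul _ (mplane R) R mu).
Local Notation n2 := (seminorm ip).
Local Notation sq := (@sqint _ (mplane R) R mu).
Local Notation sqS := (@sqint_submodule _ (mplane R) R mu).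
Implicit Types (f g : plane R -> R) (u v w : field R) (i j : 'I_2) (z : plane R).

Definition vanishing (x : nat -> R) :=
  forall e : R, 0 < e -> exists N, forall n, (N <= n)%N -> x n <= e.

Definition cauchy_in {X : zmodType} (nrm : X -> R) (s : nat -> X) :=
  forall e : R, 0 < e -> exists N, forall m n, (N <= m)%N -> (N <= n)%N ->
    nrm (s m - s n) <= e.

Lemma vanishing_le (x y : nat -> R) (K : R) : (forall n, y n <= K * x n) ->
  (forall n, 0 <= x n) -> vanishing x -> vanishing y.
Proof.
move=> xy x0 vx e e0; have K0 : 0 < `|K| + 1 by rewrite ltr_wpDl.
have [N NP] := vx (e / (`|K| + 1)) ltac:(by rewrite divr_gt0).
exists N => n /NP; rewrite ler_pdivlMr// => h.
apply: le_trans (xy n) _; apply: le_trans h; rewrite mulrC ler_wpM2l//.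
by rewrite (le_trans (ler_norm K))// lerDl.
Qed.

Lemma vanishingD (x y : nat -> R) : vanishing x -> vanishing y ->
  vanishing (fun n => x n + y n).
Proof.
move=> vx vy e e0; have e2 : 0 < e / 2 by rewrite divr_gt0.
have [[N NP] [M MP]] := (vx _ e2, vy _ e2).
exists (maxn N M) => n; rewrite geq_max => /andP[/NP h1 /MP h2].
by rewrite [e]splitr lerD.
Qed.

Lemma vanishing_sum (F : 'I_2 -> nat -> R) : (forall i, vanishing (F i)) ->
  vanishing (fun n => \sum_(i < 2) F i n).
Proof.
move=> vF; have := vanishingD (vF 0) (vF 1); congr vanishing.
by apply/funext => n; rewrite sum_ord2.
Qed.

Lemma cauchy_in_le {X Y : zmodType} (p : X -> R) (q : Y -> R) (F : nat -> X) (G : nat -> Y) (K : R) :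
  (forall m n, q (G m - G n) <= K * p (F m - F n)) -> (forall x, 0 <= p x) ->
  cauchy_in p F -> cauchy_in q G.
Proof.
move=> pq p0 cF e e0; have K0 : 0 < `|K| + 1 by rewrite ltr_wpDl.
have [N NP] := cF (e / (`|K| + 1)) ltac:(by rewrite divr_gt0).
exists N => m n Nm Nn; have := NP _ _ Nm Nn; rewrite ler_pdivlMr// => h.
apply: le_trans (pq m n) _; apply: le_trans h; rewrite mulrC ler_wpM2l//.
by rewrite (le_trans (ler_norm K))// lerDl.
Qed.

Lemma n2_ge0 f : 0 <= n2 f. Proof. exact: seminorm_ge0. Qed.

Lemma n2_cauchy_schwarz f g : sq f -> sq g -> `|ip f g| <= n2 f * n2 g.
Proof. by move=> sf sg; exact: (cauchy_schwarz_in (integral_mul_semi_inner mu) sf sg). Qed.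

Lemma n2BC f g : sq f -> sq g -> n2 (f - g) = n2 (g - f).
Proof. by move=> sf sg; exact: (seminormBC_in (integral_mul_semi_inner mu) sf sg). Qed.

Lemma n2_ae f g : sq f -> sq g -> f = g %[ae mu] -> n2 f = n2 g.
Proof. by move=> sf sg fg; rewrite /seminorm (integral_mul_eq sf sg sf sg fg fg). Qed.

Lemma sqintB f g : sq f -> sq g -> sq (f - g).
Proof. by move=> sf sg; exact: (submoduleB (S := sqS) sf sg). Qed.

Lemma subfE f g : f - g = (fun z => -1 * g z + f z).
Proof. by apply/funext => z; rewrite mulN1r addrC. Qed.

Lemma H1B f g : H1 f -> H1 g -> H1 (f - g).
Proof. by move=> hf hg; rewrite subfE; exact: H1P. Qed.

Lemma n2_weak_partialB j f g : H1 f -> H1 g ->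
  n2 (weak_partial j (f - g)) = n2 (weak_partial j f - weak_partial j g).
Proof.
move=> hf hg; apply: n2_ae.
- exact/weak_partial_sqint/H1B.
- by apply: sqintB; exact: weak_partial_sqint.
- by rewrite !subfE; exact: weak_partial_lin.
Qed.

(** For a fixed test function both sides of the defining identity are continuous for L2
    convergence. *)
Lemma is_weak_partial_limit j (s : nat -> plane R -> R) g (G : plane R -> R) :
  (forall n, H1 (s n)) -> sq g -> sq G ->
  vanishing (fun n => n2 (s n - g)) ->
  vanishing (fun n => n2 (weak_partial j (s n) - G)) ->
  is_weak_partial j g G.
Proof.
move=> hs sg sG vs vp phi sphi.
have s1 := smooth_sqint sphi; have s2 := smooth_sqint (smooth_partial j sphi).
have ss n : sq (s n) := L2_sqint (hs n).1.
have sp n : sq (weak_partial j (s n)) := weak_partial_sqint j (hs n).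
suff : ip g (partial j phi) = - ip G phi by [].
apply/eqP; rewrite -addr_eq0 -normr_eq0 eq_le normr_ge0 andbT.
have E n : ip g (partial j phi) + ip G phi =
    - (ip (s n - g) (partial j phi) + ip (weak_partial j (s n) - G) phi).
  have [_ /(_ _ sphi) w] := weak_partialP j (hs n).
  have w' : ip (s n) (partial j phi) = - ip (weak_partial j (s n)) phi by exact: w.
  rewrite !subfE (integral_mul_lin (-1) sg (ss n) s2) (integral_mul_lin (-1) sG (sp n) s1) w'.
  by move: (ip _ _) (ip _ _) (ip _ _) => a b c; ring.
have : vanishing (fun n => n2 (partial j phi) * n2 (s n - g) + n2 phi * n2 (weak_partial j (s n) - G)).
  by apply: vanishingD; [apply: vanishing_le vs|apply: vanishing_le vp] => n; rewrite ?lexx ?n2_ge0.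
move=> van; apply/ler_addgt0Pl => e e0; rewrite addr0.
have [N /(_ N (leqnn N)) NP] := van e e0.
apply: le_trans NP; rewrite (E N) normrN; apply: le_trans (ler_normD _ _) _.
apply: lerD; rewrite [leRHS]mulrC.
  exact: n2_cauchy_schwarz (sqintB (ss N) sg) s2.
exact: n2_cauchy_schwarz (sqintB (sp N) sG) s1.
Qed.

Lemma H1_limit (s : nat -> plane R -> R) : (forall n, H1 (s n)) ->
  cauchy_in n2 s -> (forall j, cauchy_in n2 (fun n => weak_partial j (s n))) ->
  exists g, [/\ H1 g, vanishing (fun n => n2 (s n - g)) &
    forall j, vanishing (fun n => n2 (weak_partial j (s n) - weak_partial j g))].
Proof.
move=> hs cs cp.
have limit (t : nat -> plane R -> R) : (forall n, L2 (t n)) -> cauchy_in n2 t ->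
    exists g, L2 g /\ vanishing (fun n => n2 (t n - g)).
  move=> t2 ct; have [k [sg vg _]] := sqint_complete (fun n => L2_sqint (t2 n)) ct.
  eexists; split; last exact: vg.
  apply/L2E; split; last exact: sg.
  (* The Riesz-Fischer limit is an explicit limsup of values, hence periodic at every point and not
     merely almost everywhere. *)
  by split=> z; congr (fine (limn_esup _)); apply/funext => n;
    have /L2E[[t1 t1'] _] := t2 (k n); rewrite ?t1 ?t1'.
have [g [g2 gv]] := limit s (fun n => (hs n).1) cs.
have /choice[G GP] : forall j, exists G, L2 G /\ vanishing (fun n => n2 (weak_partial j (s n) - G)).
  by move=> j; apply: limit (cp j) => n; exact: weak_partial_L2.
have wG j : is_weak_partial j g (G j).
  by apply: is_weak_partial_limit hs _ _ gv (GP j).2; apply: L2_sqint => //; exact: (GP j).1.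
have hg : H1 g by split=> // j; exists (G j); split; [exact: (GP j).1|exact: wG].
exists g; split=> // j.
have E n : n2 (weak_partial j (s n) - weak_partial j g) = n2 (weak_partial j (s n) - G j).
  apply: n2_ae.
  - by apply: sqintB; exact: weak_partial_sqint.
  - by apply: sqintB; [exact: weak_partial_sqint|exact: L2_sqint (GP j).1].
  - have := weak_partial_ae hg (GP j).1 (wG j).
    exact: ae_eq_subl.
rewrite (_ : (fun n => _) = (fun n => n2 (weak_partial j (s n) - G j))); first exact: (GP j).2.
by apply/funext => n; exact: E.
Qed.

Lemma sqr_n2 f : n2 f ^+ 2 = ip f f.
Proof. exact: sqr_sqrtr (integral_mul_ge0 _ _). Qed.

Lemma dotL2E u : dotL2 u u = \sum_(i < 2) n2 (u i) ^+ 2.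
Proof. by apply: eq_bigr => i _; exact: esym (sqr_n2 (u i)). Qed.

Lemma dot_gradE u : dot_grad u u = \sum_(i < 2) \sum_(j < 2) n2 (weak_partial j (u i)) ^+ 2.
Proof.
by apply: eq_bigr => i _; apply: eq_bigr => j _; exact: esym (sqr_n2 (weak_partial j (u i))).
Qed.

Lemma dotL2_ge0 u : 0 <= dotL2 u u.
Proof. by rewrite dotL2E; apply: sumr_ge0 => i _; exact: sqr_ge0. Qed.

Lemma dot_grad_ge0 u : 0 <= dot_grad u u.
Proof.
by rewrite dot_gradE; apply: sumr_ge0 => i _; apply: sumr_ge0 => j _; exact: sqr_ge0.
Qed.

Lemma n2_le_normL2 u i : n2 (u i) <= normL2 u.
Proof.
apply: le_sqrt; first exact: n2_ge0.
by rewrite dotL2E; exact: (sqr_le_sum (fun i => n2 (u i))).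
Qed.

Lemma n2_le_norm_grad u i j : n2 (weak_partial j (u i)) <= norm_grad u.
Proof.
apply: le_sqrt; first exact: n2_ge0.
by rewrite dot_gradE; exact: (sqr_le_sum2 (fun i j => n2 (weak_partial j (u i)))).
Qed.

Lemma normL2_le u : normL2 u <= \sum_(i < 2) n2 (u i).
Proof.
apply: sqrt_le; first by apply: sumr_ge0 => i _; exact: n2_ge0.
by rewrite dotL2E; apply: sum_sqr_le => i; exact: n2_ge0.
Qed.

Lemma norm_grad_le u : norm_grad u <= \sum_(i < 2) \sum_(j < 2) n2 (weak_partial j (u i)).
Proof.
apply: sqrt_le; first by apply: sumr_ge0 => i _; apply: sumr_ge0 => j _; exact: n2_ge0.
by rewrite dot_gradE; apply: sum2_sqr_le => i j; exact: n2_ge0.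
Qed.

Lemma normL2_le_form c u : 0 <= c -> normL2 u <= seminorm (form c) u.
Proof.
by move=> c0; apply: ler_wsqrtr; rewrite lerDl; apply: mulr_ge0 c0 (dot_grad_ge0 u).
Qed.

Lemma norm_grad_le_form c u : 0 <= c -> Num.sqrt c * norm_grad u <= seminorm (form c) u.
Proof.
move=> c0; rewrite -(sqrtrM _ c0); apply: ler_wsqrtr; rewrite lerDr; exact: dotL2_ge0.
Qed.

Lemma form_le c u : 0 <= c -> seminorm (form c) u <= normL2 u + Num.sqrt c * norm_grad u.
Proof.
move=> c0; have l0 : 0 <= normL2 u by exact: sqrtr_ge0.
have g0 : 0 <= Num.sqrt c * norm_grad u by rewrite mulr_ge0 ?sqrtr_ge0.
apply: sqrt_le; first exact: addr_ge0.
apply: le_trans (sum_sqr_le2 l0 g0); rewrite exprMn (sqr_sqrtr c0).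
by rewrite (sqr_sqrtr (dotL2_ge0 u)) (sqr_sqrtr (dot_grad_ge0 u)).
Qed.

Lemma vanishing_form c (s : nat -> field R) v : 0 <= c ->
  (forall n, H1_field (s n)) -> H1_field v ->
  (forall i, vanishing (fun n => n2 (s n i - v i))) ->
  (forall i j, vanishing (fun n => n2 (weak_partial j (s n i) - weak_partial j (v i)))) ->
  vanishing (fun n => seminorm (form c) (s n - v)).
Proof.
move=> c0 hs hv v1 v2.
have V1 : vanishing (fun n => \sum_(i < 2) n2 (s n i - v i) +
    Num.sqrt c * \sum_(i < 2) \sum_(j < 2) n2 (weak_partial j (s n i) - weak_partial j (v i))).
  apply: vanishingD; first exact: vanishing_sum.
  apply: vanishing_le (fun n => lexx _) _ _ => [n|].
    by apply: sumr_ge0 => i _; apply: sumr_ge0 => j _; exact: n2_ge0.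
  by apply: vanishing_sum => i; exact: vanishing_sum.
move=> e e0; have [N NP] := V1 e e0; exists N => n Nn; apply: le_trans (NP n Nn).
apply: le_trans (form_le _ c0) _; apply: lerD; first exact: normL2_le.
rewrite ler_wpM2l ?sqrtr_ge0//; apply: le_trans (norm_grad_le _) _.
rewrite le_eqVlt; apply/orP; left; apply/eqP.
by apply: eq_bigr => i _; apply: eq_bigr => j _; exact: (n2_weak_partialB j (hs n i) (hv i)).
Qed.

(** Convergence is given for every [c'] because completeness is wanted for [c = alpha ^+ 2], whereas
    membership of the limit in [V] is tested with [c' = 1]. *)
Lemma H1_field_limit c (s : nat -> field R) : 0 < c -> (forall n, H1_field (s n)) ->
  cauchy_in (seminorm (form c)) s ->
  exists2 v, H1_field v & forall c', 0 <= c' -> vanishing (fun n => seminorm (form c') (s n - v)).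
Proof.
move=> c0 hs cs; have sc0 : 0 < Num.sqrt c by rewrite sqrtr_gt0.
have pf x : 0 <= seminorm (form c) x by exact: seminorm_ge0.
have cL i : cauchy_in n2 (fun n => s n i).
  apply: (@cauchy_in_le _ _ _ _ s _ 1) cs => // m n; rewrite mul1r.
  exact: le_trans (n2_le_normL2 (s m - s n) i) (normL2_le_form _ (ltW c0)).
have cG i j : cauchy_in n2 (fun n => weak_partial j (s n i)).
  apply: (@cauchy_in_le _ _ _ _ s _ (Num.sqrt c)^-1) cs => // m n.
  rewrite -(n2_weak_partialB j (hs m i) (hs n i)) (ler_pdivlMl _ _ sc0).
  apply: le_trans (norm_grad_le_form _ (ltW c0)); rewrite (ler_pM2l sc0).
  exact: (n2_le_norm_grad (s m - s n) i j).
have /choice[v vP] : forall i, exists g, [/\ H1 g, vanishing (fun n => n2 (s n i - g)) &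
    forall j, vanishing (fun n => n2 (weak_partial j (s n i) - weak_partial j g))].
  by move=> i; apply: H1_limit (cL i) (cG i) => n; exact: (hs n).
have hv : H1_field v by move=> i; have [] := vP i.
exists v => // c' c'0; apply: vanishing_form => // [i|i j].
  by have [] := vP i.
by have [_ _] := vP i.
Qed.

End completeness.

(** * The space V *)

Lemma ler_addeps2 (R : realFieldType) (x y : R) :
  (forall e, 0 < e -> x <= y + 2 * e) -> x <= y.
Proof.
move=> h; apply/ler_addgt0Pl => e e0.
by have := h (e / 2) ltac:(by rewrite divr_gt0); lra.
Qed.

Lemma ler_sqr_eps (R : rcfType) (x y : R) : 0 <= y ->
  (forall e, 0 < e -> x <= 2 * (y + e) ^+ 2) -> x <= 2 * y ^+ 2.
Proof.
move=> y0 h; have [x0|x0] := leP x 0; first by rewrite (le_trans x0)// mulr_ge0 ?sqr_ge0.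
rewrite -ler_pdivrMl//; set r := 2^-1 * x.
have r0 : 0 <= r by rewrite mulr_ge0 ?invr_ge0 ?ler0n ?(ltW x0).
rewrite -(sqr_sqrtr r0) ler_pXn2r ?nnegrE ?sqrtr_ge0//.
apply/ler_addgt0Pl => e e0; apply: sqrt_le; first by rewrite addr_ge0// ltW.
by rewrite /r ler_pdivrMl// addrC h.
Qed.

Section space_V.
Variable R : realType.
Local Notation mu := (@torus_measure R).
Local Notation ip := (@integral_mul _ (mplane R) R mu).
Local Notation n2 := (seminorm ip).
Local Notation sq := (@sqint _ (mplane R) R mu).
Implicit Types (f g : plane R -> R) (u v w phi psi : field R) (i j : 'I_2) (z : plane R).

Lemma derivable_lin j (k : R) (F G : plane R -> R) :
  (forall z, derivable (F : (R^o * R^o)%type -> R^o) z (basis_vector R j)) ->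
  (forall z, derivable (G : (R^o * R^o)%type -> R^o) z (basis_vector R j)) ->
  forall z, derivable ((fun z => k * F z + G z) : (R^o * R^o)%type -> R^o) z (basis_vector R j) /\
    partial j (fun z => k * F z + G z) z = k * partial j F z + partial j G z.
Proof.
move=> dF dG; apply: (@line_partial R (fun z => k * F z + G z)
  (fun z => k * partial j F z + partial j G z) j) => z t.
have d1 := is_derive_line (dF (set_coord j t z)).
have d2 := is_derive_line (dG (set_coord j t z)).
by apply: is_derive_eq; rewrite /GRing.scale/=.
Qed.

Lemma smooth_lin (k : R) f g : smooth f -> smooth g -> smooth (fun z => k * f z + g z).
Proof.
move=> fs gs; have [[f1 f2] fd] := fs; have [[g1 g2] gd] := gs.
split; first by split=> z; rewrite ?f1 ?f2 ?g1 ?g2.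
have E s : foldr (@partial R) (fun z => k * f z + g z) s =
    (fun z => k * foldr (@partial R) f s z + foldr (@partial R) g s z).
  elim: s => //= j s ->; apply/funext => z.
  by have [_ ->] := derivable_lin k ((fd s).2 j) ((gd s).2 j) z.
move=> s; rewrite E; split.
  by move=> z; apply: cvgD; [apply: cvgM; [exact: cvg_cst|exact: (fd s).1]|exact: (gd s).1].
by move=> j z; have [] := derivable_lin k ((fd s).2 j) ((gd s).2 j) z.
Qed.

Lemma partial_lin j (k : R) f g z : smooth f -> smooth g ->
  partial j (fun z => k * f z + g z) z = k * partial j f z + partial j g z.
Proof.
move=> fs gs.
by have [] := derivable_lin k (@smooth_derivable _ f fs j) (@smooth_derivable _ g gs j) z.
Qed.

Lemma smooth_integrable f : smooth f -> mu.-integrable setT (EFin \o (f : mplane R -> R)).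
Proof. by move=> fs; exact: torus_continuous_integrable fs.1 (smooth_continuous fs). Qed.

Lemma smooth_solenoidal_lin (k : R) phi psi : smooth_solenoidal phi -> smooth_solenoidal psi ->
  smooth_solenoidal (k *: phi + psi).
Proof.
move=> [s1 d1 m1] [s2 d2 m2]; split=> [i|z|i].
- exact: (smooth_lin k (s1 i) (s2 i)).
- rewrite (eq_bigr (fun i => k * partial i (phi i) z + partial i (psi i) z)).
    by rewrite big_split/= -mulr_sumr d1 d2 mulr0 addr0.
  by move=> i _; exact: (partial_lin i k z (s1 i) (s2 i)).
- have E := torus_RintegralZD k (smooth_integrable (s1 i)) (smooth_integrable (s2 i)).
  by rewrite m1 m2 mulr0 addr0 in E; exact: E.
Qed.

Lemma smooth_solenoidal0 : smooth_solenoidal (0 : field R).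
Proof.
split=> [i|z|i]; first exact: smooth_cst.
- rewrite big1// => i _.
  have line (z' : plane R) (t : R) : is_derive t 1 (fun t => (0 : field R) i (set_coord i t z')) 0.
    exact: is_derive_cst.
  by have [_ ->] := @line_partial R ((0 : field R) i) (fun=> 0) i line z.
- exact: torus_integral_cst.
Qed.

Lemma smooth_solenoidal_H1 phi : smooth_solenoidal phi -> H1_field phi.
Proof. by move=> [s _ _] i; exact: smooth_H1. Qed.

Local Notation N := (seminorm (@form R 1)).

Lemma N_semi_inner : semi_inner_in (H1_submodule R) (@form R 1).
Proof. exact: form_semi_inner ler01. Qed.

Lemma V_approx u (e : R) : V u -> 0 < e ->
  exists2 phi, smooth_solenoidal phi & N (u - phi) < e.
Proof. by move=> [_ h] /h[phi sphi]; rewrite normH1E; exists phi. Qed.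

Lemma H1_fieldB u v : H1_field u -> H1_field v -> H1_field (u - v).
Proof. by move=> hu hv i; exact: (H1B (hu i) (hv i)). Qed.

Lemma V0 : V (0 : field R).
Proof.
have H0 : H1_field (0 : field R) := submodule0 (H1_submodule R).
split=> // e e0; exists 0; first exact: smooth_solenoidal0.
rewrite normH1E subrr.
by have := seminormZ_in N_semi_inner 0 H0; rewrite scale0r normr0 mul0r => ->.
Qed.

Lemma VP (k : R) u v : V u -> V v -> V (k *: u + v).
Proof.
move=> hu hv; split; first by move=> i; exact: (H1P k (hu.1 i) (hv.1 i)).
move=> e e0; have k0 : 0 < `|k| + 1 by rewrite ltr_wpDl.
have e2 : 0 < e / 2 by rewrite divr_gt0.
have [phi sphi Nphi] := V_approx hu (divr_gt0 e2 k0).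
have [psi spsi Npsi] := V_approx hv e2.
exists (k *: phi + psi); first exact: smooth_solenoidal_lin.
have h1 := H1_fieldB hu.1 (smooth_solenoidal_H1 sphi).
have h2 := H1_fieldB hv.1 (smooth_solenoidal_H1 spsi).
have h3 : H1_field (k *: (u - phi)) := submoduleZ (S := H1_submodule R) k h1.
rewrite normH1E opprD addrACA -scalerBr.
have E1 := ler_seminormD_in N_semi_inner h3 h2.
apply: le_lt_trans E1 _; rewrite (seminormZ_in N_semi_inner k h1).
have : `|k| * N (u - phi) <= e / 2.
  rewrite ltr_pdivlMr// in Nphi; apply: le_trans (ltW Nphi).
  by rewrite mulrC ler_wpM2l ?seminorm_ge0// lerDl.
by move: (N _) (N _) Npsi => p q; move: e2; lra.
Qed.

Lemma V_closed : submod_closed (mem (@V R : set (field R)) : {pred field R}).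
Proof.
split=> [|k u v]; first exact/mem_set/V0.
by move=> /set_mem hu /set_mem hv; apply/mem_set; exact: VP.
Qed.

Definition V_submodule := Submodule V_closed.

Lemma V_limit u : H1_field u ->
  (forall e, 0 < e -> exists2 v, V v & N (v - u) <= e) -> V u.
Proof.
move=> hu uv; split=> // e e0.
have e2 : 0 < e / 2 by rewrite divr_gt0.
have [v hv Nv] := uv (e / 2) e2; have [phi sphi Np] := V_approx hv e2.
exists phi => //; rewrite normH1E.
have hphi := smooth_solenoidal_H1 sphi.
apply: le_lt_trans (ler_seminorm_dist_in N_semi_inner hu hv.1 hphi) _.
rewrite (seminormBC_in N_semi_inner hu hv.1).
have E := ler_ltD Nv Np; rewrite -splitr in E; exact: E.
Qed.

Lemma seminorm_elementsB (c : R) (x y : elements V_submodule) :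
  seminorm (restrict_form (S := V_submodule) (form c)) (x - y) =
  seminorm (form c) (val x - val y).
Proof. by rewrite /seminorm /restrict_form raddfB. Qed.

Lemma V_complete (c : R) : 0 < c ->
  seq_complete (restrict_form (S := V_submodule) (form c)).
Proof.
move=> c0 s cs; have hs n : V (val (s n)) := elementsP (s n).
have [|v hv vP] := @H1_field_limit _ c (fun n => val (s n)) c0 (fun n => (hs n).1).
  move=> e e0; have [M MP] := cs e e0; exists M => m n Mm Mn.
  by rewrite -seminorm_elementsB; exact: (MP m n Mm Mn).
have Vv : V v.
  apply: V_limit hv _ => e e0; have [M MP] := vP 1 ler01 e e0.
  by exists (val (s M)) => //; exact: MP.
exists (to_elements (S := V_submodule) Vv) => e e0.
have [M MP] := vP c (ltW c0) e e0.
by exists M => n Mn; rewrite seminorm_elementsB; exact: (MP n Mn).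
Qed.

Lemma n2_smooth_partial j f : smooth f ->
  n2 (weak_partial j f) ^+ 2 = \int[mu]_z (partial j f z ^+ 2).
Proof.
move=> fs; have sd := smooth_sqint (smooth_partial j fs).
rewrite (n2_ae (weak_partial_sqint j (smooth_H1 fs)) sd (smooth_weak_partial j fs)).
by rewrite sqr_n2.
Qed.

Lemma normL2_le_norm_grad_smooth phi : smooth_solenoidal phi -> normL2 phi <= norm_grad phi.
Proof.
move=> [s d m]; apply: ler_wsqrtr; rewrite dotL2E dot_gradE; apply: ler_sum => i _.
have E : \sum_(j < 2) n2 (weak_partial j (phi i)) ^+ 2 =
    \sum_(j < 2) \int[mu]_z (partial j (phi i) z ^+ 2).
  by apply: eq_bigr => j _; exact: n2_smooth_partial.
have P := poincare (s i) (m i); rewrite -E in P.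
by rewrite sqr_n2; exact: P.
Qed.

Lemma normL2_le_N u : normL2 u <= N u.
Proof. exact: normL2_le_form ler01. Qed.

Lemma norm_grad_le_N u : norm_grad u <= N u.
Proof. by have := norm_grad_le_form u ler01; rewrite sqrtr1 mul1r. Qed.

Lemma normL2D u v : H1_field u -> H1_field v -> normL2 (u + v) <= normL2 u + normL2 v.
Proof.
by move=> hu hv; exact: (ler_seminormD_in (dotL2_semi_inner R) (H1_L2_field hu) (H1_L2_field hv)).
Qed.

Lemma norm_gradD u v : H1_field u -> H1_field v ->
  norm_grad (u + v) <= norm_grad u + norm_grad v.
Proof. by move=> hu hv; exact: (ler_seminormD_in (dot_grad_semi_inner R) hu hv). Qed.

Lemma norm_gradBC u v : H1_field u -> H1_field v -> norm_grad (u - v) = norm_grad (v - u).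
Proof. by move=> hu hv; exact: (seminormBC_in (dot_grad_semi_inner R) hu hv). Qed.

(** By density of the mean-free smooth fields; the approximation error enters once through the L2
    norm and once through the gradient, hence [2 * e]. *)
Theorem V_poincare u : V u -> normL2 u <= norm_grad u.
Proof.
move=> hu; apply: ler_addeps2 => e e0.
have [phi sphi /ltW Np] := V_approx hu e0.
have hphi := smooth_solenoidal_H1 sphi.
have h1 := normL2D (H1_fieldB hu.1 hphi) hphi.
have h2 := norm_gradD (H1_fieldB hphi hu.1) hu.1.
have h3 := normL2_le_norm_grad_smooth sphi.
rewrite !subrK in h1 h2; rewrite (norm_gradBC hphi hu.1) in h2.
have h4 := le_trans (normL2_le_N (u - phi)) Np.
have h5 := le_trans (norm_grad_le_N (u - phi)) Np.
move: (normL2 u) (norm_grad u) (normL2 phi) (norm_grad phi) (normL2 (u - phi)) (norm_grad (u - phi)) h1 h2 h3 h4 h5.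
by clear; move=> a1 a2 a3 a4 a5 a6; lra.
Qed.

End space_V.

(** * The convection term *)

(** Meant for the difference of a bounded cubic form at two points of norms [x] and [p] at distance
    [d], telescoped one argument at a time. *)
Lemma telescope3_le (R : realFieldType) (b1 b2 b3 K x p d : R) :
  `|b1| <= K * d * x * x -> `|b2| <= K * p * d * x -> `|b3| <= K * p * p * d ->
  0 <= K -> 0 <= x -> 0 <= p -> p <= x + 1 -> 0 <= d ->
  `|b1 + b2 + b3| <= 3 * K * (x + 1) ^+ 2 * d.
Proof.
move=> h1 h2 h3 K0 x0 p0 px d0.
have q : 0 <= K * d by rewrite mulr_ge0.
have e1 : x * x <= (x + 1) ^+ 2 by nra.
have e2 : p * x <= (x + 1) ^+ 2 by nra.
have e3 : p * p <= (x + 1) ^+ 2 by nra.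
have f1 := ler_wpM2l q e1; have f2 := ler_wpM2l q e2; have f3 := ler_wpM2l q e3.
apply: le_trans (ler_normD _ _) _; apply: le_trans (lerD (ler_normD _ _) (lexx _)) _.
by nra.
Qed.

Lemma fourth_sqr (R : comRingType) (x : R) : 4 * (x ^+ 2) ^+ 2 = (2 * x ^+ 2) ^+ 2.
Proof. ring. Qed.

Lemma fourth_le (R : realDomainType) (x y : R) : 0 <= x -> x <= y ->
  (2 * x ^+ 2) ^+ 2 <= (2 * y ^+ 2) ^+ 2.
Proof.
move=> x0 xy; have y0 := le_trans x0 xy.
by rewrite lerXn2r ?nnegrE ?mulr_ge0 ?sqr_ge0// ler_wpM2l// lerXn2r ?nnegrE.
Qed.

Lemma mulr_sqr_le (R : realDomainType) (n a b x y : R) : 0 <= n -> 0 <= a -> 0 <= b ->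
  0 <= x -> 0 <= y -> n ^+ 2 <= x * y -> x <= 2 * a ^+ 2 -> y <= 2 * b ^+ 2 ->
  n <= 2 * a * b.
Proof.
move=> n0 a0 b0 x0 y0 h hx hy; rewrite -(@ler_pXn2r _ 2) ?nnegrE ?mulr_ge0//.
apply: le_trans h (le_trans (ler_pM x0 y0 hx hy) _).
by rewrite le_eqVlt; apply/orP; left; apply/eqP; ring.
Qed.

Lemma mulr_sum2 (R : comRingType) (a b c d w : R) :
  (a * b + c * d) * w = a * w * b + c * w * d.
Proof. ring. Qed.

Lemma norm_sum2_le (R : realDomainType) (F : 'I_2 -> 'I_2 -> R) (M : R) :
  (forall i j, `|F i j| <= M) -> `|\sum_(i < 2) \sum_(j < 2) F i j| <= 4 * M.
Proof.
move=> h; rewrite !sum_ord2.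
apply: le_trans (ler_normD _ _) _; apply: le_trans (lerD (ler_normD _ _) (ler_normD _ _)) _.
by have := h 0 0; have := h 0 1; have := h 1 0; have := h 1 1; lra.
Qed.

Lemma sum2_lin (R : comRingType) (F G H : 'I_2 -> 'I_2 -> R) (k : R) :
  (forall i j, F i j = k * G i j + H i j) ->
  \sum_(i < 2) \sum_(j < 2) F i j =
  k * (\sum_(i < 2) \sum_(j < 2) G i j) + \sum_(i < 2) \sum_(j < 2) H i j.
Proof. by move=> E; rewrite !sum_ord2 !E; ring. Qed.

Lemma mulr_linl (R : comRingType) (k a b w : R) : (k * a + b) * w = k * (a * w) + b * w.
Proof. ring. Qed.

Lemma mulr_linr (R : comRingType) (k a b w : R) : w * (k * a + b) = k * (w * a) + w * b.
Proof. ring. Qed.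

Lemma cubic_derivative (R : comRingType) (f g f' g' : R) :
  f * (g * g' + g * g') + g * g * f' = 2 * (f * g * g') + f' * (g * g).
Proof. ring. Qed.

Lemma half_sum_eq0 (R : numDomainType) (a b p q : R) :
  2 * a + p = 0 -> 2 * b + q = 0 -> 1 * p + q = 0 -> a + b = 0.
Proof.
move=> h1 h2 h3; apply: (@mulfI R 2); first by rewrite pnatr_eq0.
have : (2 * a + p) + (2 * b + q) = 0 by rewrite h1 h2 addr0.
by rewrite addrACA mulrDr -(mul1r p) h3 addr0 mulr0.
Qed.

Lemma norm_le_eps_eq0 (R : realFieldType) (x K : R) : 0 <= K ->
  (forall e, 0 < e -> e <= 1 -> `|x| <= K * e) -> x = 0.
Proof.
move=> K0 h; apply/eqP; rewrite -normr_le0; apply/ler_addgt0Pl => e e0; rewrite addr0.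
have K1 : 0 < K + 1 by rewrite ltr_wpDl.
have d0 : 0 < Num.min 1 (e / (K + 1)) by rewrite lt_min ltr01 divr_gt0.
apply: le_trans (h _ d0 _) _; first by rewrite ge_min lexx.
apply: (@le_trans _ _ ((K + 1) * (e / (K + 1)))).
  by apply: ler_pM => //; [exact: ltW|rewrite lerDl|rewrite ge_min lexx orbT].
by rewrite mulrC divfK// gt_eqF.
Qed.

Lemma le24 (R : realFieldType) (a p d e : R) :
  a <= 3 * 8 * p * d -> d <= e -> 0 <= p -> a <= 24 * p * e.
Proof. by move=> h1 h2 h3; have := ler_wpM2l h3 h2; lra. Qed.

Lemma row_le_sum (R : numDomainType) (F : 'I_2 -> 'I_2 -> R) i : (forall k l, 0 <= F k l) ->
  \sum_(l < 2) F i l <= \sum_(k < 2) \sum_(l < 2) F k l.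
Proof.
move=> F0; rewrite [leRHS](bigD1 i)//= lerDl; apply: sumr_ge0 => k _.
by apply: sumr_ge0 => l _; exact: F0.
Qed.

Section convection_on_V.
Variable R : realType.
Local Notation mu := (@torus_measure R).
Local Notation ip := (@integral_mul _ (mplane R) R mu).
Local Notation n2 := (seminorm ip).
Local Notation sq := (@sqint _ (mplane R) R mu).
Local Notation N := (seminorm (@form R 1)).
Implicit Types (f g : plane R -> R) (u v w phi psi : field R) (i j : 'I_2) (z : plane R).

Lemma sqr_N u : N u ^+ 2 = dotL2 u u + dot_grad u u.
Proof.
have E : form 1 u u = dotL2 u u + dot_grad u u by rewrite /form mul1r.
by rewrite /seminorm E sqr_sqrtr//; exact: addr_ge0 (dotL2_ge0 u) (dot_grad_ge0 u).
Qed.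

Lemma smooth_energy_le phi i : smooth (phi i) -> energy (phi i) <= N phi ^+ 2.
Proof.
move=> fs; have E : energy (phi i) =
    n2 (phi i) ^+ 2 + \sum_(j < 2) n2 (weak_partial j (phi i)) ^+ 2.
  rewrite /energy sqr_n2; congr (_ + _); apply: eq_bigr => j _.
  exact/esym/n2_smooth_partial.
rewrite E sqr_N dotL2E dot_gradE; apply: lerD; first exact: (sqr_le_sum (fun i => n2 (phi i))).
exact: (row_le_sum i (fun k l => sqr_ge0 (n2 (weak_partial l (phi k))))).
Qed.

Lemma smooth_fourth_power f : smooth f ->
  mu.-integrable setT (EFin \o (fun z : mplane R => f z ^+ 4)).
Proof.
move=> fs; have c := continuous_plane_sqr (continuous_plane_sqr (smooth_continuous fs)).
have p := torus_fun_sqr (torus_fun_sqr fs.1).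
have E : (fun z : mplane R => f z ^+ 4) = (fun z => (f z ^+ 2) ^+ 2).
  by apply/funext => z; rewrite -exprM.
by rewrite E; exact: torus_continuous_integrable p c.
Qed.

Lemma ladyzhenskaya_solenoidal phi i : smooth_solenoidal phi ->
  \int[mu]_z (phi i z ^+ 4) <= (2 * N phi ^+ 2) ^+ 2.
Proof.
move=> [s _ _]; apply: le_trans (ladyzhenskaya (s i)) _; rewrite -fourth_sqr.
rewrite ler_wpM2l// lerXn2r ?nnegrE ?sqr_ge0//; last exact: smooth_energy_le.
rewrite /energy addr_ge0//; first by apply: Rintegral_ge0 => z _; exact: sqr_ge0.
by apply: sumr_ge0 => j _; apply: Rintegral_ge0 => z _; exact: sqr_ge0.
Qed.

Lemma ND u v : H1_field u -> H1_field v -> N (u + v) <= N u + N v.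
Proof. by move=> hu hv; exact: (ler_seminormD_in (N_semi_inner R) hu hv). Qed.

Lemma NBC u v : H1_field u -> H1_field v -> N (u - v) = N (v - u).
Proof. by move=> hu hv; exact: (seminormBC_in (N_semi_inner R) hu hv). Qed.

Lemma N_approx_le u phi (e : R) : H1_field u -> H1_field phi -> N (u - phi) <= e ->
  N phi <= N u + e.
Proof.
move=> hu hp; rewrite (NBC hu hp) => h.
have E := ND (H1_fieldB hp hu) hu; rewrite subrK in E; apply: le_trans E _.
rewrite [leLHS]addrC; exact: (lerD (lexx (N u)) h).
Qed.

(** Ladyzhenskaya's inequality is known for smooth fields; it passes to [V] by density and lower
    semicontinuity of the L4 norm, with a slack [e] that is removed at the end. *)
Theorem V_L4 u i : V u ->
  sq (fun z => u i z ^+ 2) /\ n2 (fun z => u i z ^+ 2) <= 2 * N u ^+ 2.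
Proof.
move=> hu; have N0 := seminorm_ge0 (@form R 1) u.
suff h e : 0 < e -> sq (fun z => u i z ^+ 2) /\ n2 (fun z => u i z ^+ 2) <= 2 * (N u + e) ^+ 2.
  split; first exact: (h 1 ltr01).1.
  by apply: ler_sqr_eps N0 _ => e e0; exact: (h e e0).2.
(* The minimum serves two ends: [e] bounds the norms of the approximations uniformly, and
   [n.+1%:R^-1] makes them converge to [u]. *)
move=> e0; pose d n := Num.min e n.+1%:R^-1.
have d0 n : 0 < d n by rewrite lt_min e0 invr_gt0 ltr0Sn.
have /choice[phi phiP] : forall n, exists phi, smooth_solenoidal phi /\ N (u - phi) <= d n.
  by move=> n; have [phi sp /ltW h] := V_approx hu (d0 n); exists phi.
have hphi n := smooth_solenoidal_H1 (phiP n).1.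
have sphi n : sq (phi n i) := smooth_sqint (let: And3 s _ _ := (phiP n).1 in s i).
have su : sq (u i) := L2_sqint (hu.1 i).1.
have Nphi n : N (phi n) <= N u + e.
  by apply: N_approx_le hu.1 (hphi n) (le_trans (phiP n).2 _); rewrite ge_min lexx.
have lim : forall r : R, 0 < r -> exists M, forall n, (M <= n)%N -> n2 (phi n i - u i) <= r.
  move=> r r0; exists (Num.bound r^-1) => n Mn.
  have E : n2 (phi n i - u i) <= N (u - phi n).
    rewrite (n2BC (sphi n) su).
    exact: le_trans (n2_le_normL2 (u - phi n) i) (normL2_le_N (u - phi n)).
  apply: le_trans E (le_trans (phiP n).2 _); rewrite ge_min; apply/orP; right.
  rewrite invf_ple ?posrE ?ltr0Sn//; apply: ltW.
  apply: lt_le_trans (archi_boundP _) _; first by rewrite invr_ge0 ltW.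
  by rewrite ler_nat ltnW.
have L n : \int[mu]_z (phi n i z ^+ 4) <= (2 * (N u + e) ^+ 2) ^+ 2.
  apply: le_trans (ladyzhenskaya_solenoidal i (phiP n).1) _.
  exact: fourth_le (seminorm_ge0 _ _) (Nphi n).
have i4 n := smooth_fourth_power (let: And3 s _ _ := (phiP n).1 in s i).
have [s4 L4] := sqint_sqr_limit su sphi lim i4 L.
by split; [exact: s4|exact: sqrt_le (mulr_ge0 (ler0n R 2) (sqr_ge0 _)) L4].
Qed.

Lemma V_sq_mul u w i j : V u -> V w -> sq (fun z => u j z * w i z).
Proof.
move=> hu hw; have [[su _] [sw _]] := (L2_sqint (hu.1 j).1, L2_sqint (hw.1 i).1).
exact: (sqint_mul (V_L4 j hu).1 (V_L4 i hw).1 su sw).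
Qed.

Lemma V_n2_mul u w i j : V u -> V w -> n2 (fun z => u j z * w i z) <= 2 * N u * N w.
Proof.
move=> hu hw; have [s1 l1] := V_L4 j hu; have [s2 l2] := V_L4 i hw.
exact: mulr_sqr_le (n2_ge0 _) (seminorm_ge0 _ u) (seminorm_ge0 _ w) (n2_ge0 _) (n2_ge0 _)
  (seminorm_mul_le s1 s2) l1 l2.
Qed.

(** Grouping [u j] with [w i], two L4 functions, puts their product in L2, so that each term is an
    L2 product with a weak derivative and the bilinear calculus applies. *)
Lemma convectionE u v w : V u -> V v -> V w -> convection u v w =
  \sum_(i < 2) \sum_(j < 2) ip (fun z => u j z * w i z) (weak_partial j (v i)).
Proof.
move=> hu hv hw; apply: eq_bigr => i _.
have I j := sqint_mul_integrable (V_sq_mul i j hu hw) (weak_partial_sqint j (hv.1 i)).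
rewrite sum_ord2.
have E := torus_RintegralD (I 0) (I 1).
have P : (fun z => (\sum_(j < 2) u j z * weak_partial j (v i) z) * w i z) =
    (fun z => u 0 z * w i z * weak_partial 0 (v i) z + u 1 z * w i z * weak_partial 1 (v i) z).
  apply/funext => z; apply: etrans (congr1 ( *%R^~ (w i z)) (sum_ord2 _)) _.
  exact: mulr_sum2.
rewrite P; exact: E.
Qed.

(** Four index pairs, each contributing at most [2 * N u * N v * N w]. *)
Lemma convection_bound u v w : V u -> V v -> V w ->
  `|convection u v w| <= 8 * N u * N v * N w.
Proof.
move=> hu hv hw; rewrite (convectionE hu hv hw).
have h i j : `|ip (fun z => u j z * w i z) (weak_partial j (v i))| <= 2 * N u * N v * N w.
  have l1 := n2_cauchy_schwarz (V_sq_mul i j hu hw) (weak_partial_sqint j (hv.1 i)).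
  have l2 := le_trans (n2_le_norm_grad v i j) (norm_grad_le_N v).
  have l3 := ler_pM (n2_ge0 _) (n2_ge0 _) (V_n2_mul i j hu hw) l2.
  apply: le_trans l1 (le_trans l3 _).
  by move: (N u) (N v) (N w); clear=> a b c; rewrite le_eqVlt; apply/orP; left; apply/eqP; ring.
apply: le_trans (norm_sum2_le h) _; move: (N u) (N v) (N w); clear=> a b c.
by rewrite le_eqVlt; apply/orP; left; apply/eqP; ring.
Qed.

Lemma convection_lin1 (k : R) u u' v w : V u -> V u' -> V v -> V w ->
  convection (k *: u + u') v w = k * convection u v w + convection u' v w.
Proof.
move=> hu hu' hv hw; rewrite (convectionE (VP k hu hu') hv hw) (convectionE hu hv hw) (convectionE hu' hv hw).
apply: sum2_lin => i j.
have E := integral_mul_lin k (V_sq_mul i j hu hw) (V_sq_mul i j hu' hw)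
  (weak_partial_sqint j (hv.1 i)).
apply: etrans E; congr (ip _ _); apply/funext => z.
exact: mulr_linl.
Qed.

Lemma convection_lin3 (k : R) u v w w' : V u -> V v -> V w -> V w' ->
  convection u v (k *: w + w') = k * convection u v w + convection u v w'.
Proof.
move=> hu hv hw hw'; rewrite (convectionE hu hv (VP k hw hw')) (convectionE hu hv hw) (convectionE hu hv hw').
apply: sum2_lin => i j.
have E := integral_mul_lin k (V_sq_mul i j hu hw) (V_sq_mul i j hu hw')
  (weak_partial_sqint j (hv.1 i)).
apply: etrans E; congr (ip _ _); apply/funext => z.
exact: mulr_linr.
Qed.

(** The middle slot carries the weak derivative, which is linear only almost everywhere; the
    equality is transported through the integral. *)
Lemma convection_lin2 (k : R) u v v' w : V u -> V v -> V v' -> V w ->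
  convection u (k *: v + v') w = k * convection u v w + convection u v' w.
Proof.
move=> hu hv hv' hw; rewrite (convectionE hu (VP k hv hv') hw) (convectionE hu hv hw) (convectionE hu hv' hw).
apply: sum2_lin => i j.
have su := V_sq_mul i j hu hw; have sv := weak_partial_sqint j (hv.1 i).
have sv' := weak_partial_sqint j (hv'.1 i); have svv := sqintP k sv sv'.
have E := integral_mul_lin k sv sv' su.
have A := weak_partial_lin j k (hv.1 i) (hv'.1 i).
have sA := weak_partial_sqint j (H1P k (hv.1 i) (hv'.1 i)).
have L := etrans (integral_mul_eq su su sA svv (ae_eq_refl mu setT _) A) (integral_mulC mu _ _).
rewrite (integral_mulC mu _ (weak_partial j (v i))) (integral_mulC mu _ (weak_partial j (v' i))).
exact: etrans L E.
Qed.

Lemma smooth_solenoidal_V phi : smooth_solenoidal phi -> V phi.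
Proof.
move=> sp; split; first exact: smooth_solenoidal_H1.
move=> e e0; exists phi => //; rewrite normH1E subrr.
by have := seminormZ_in (N_semi_inner R) 0 (V0 R).1; rewrite scale0r normr0 mul0r => ->.
Qed.

(** The left-hand side is the integral over the torus of the derivative of the periodic function
    [f * g * g]. *)
Lemma integral_partial_sqr f g j : smooth f -> smooth g ->
  2 * ip (fun z => f z * g z) (partial j g) + ip (partial j f) (fun z => g z * g z) = 0.
Proof.
move=> fs gs; have cf := smooth_continuous fs; have cg := smooth_continuous gs.
have cdf := smooth_continuous (smooth_partial j fs).
have cdg := smooth_continuous (smooth_partial j gs).
have pf := fs.1; have pg := gs.1.
have pdf := torus_fun_partial j pf; have pdg := torus_fun_partial j pg.
pose G z := 2 * (f z * g z * partial j g z) + partial j f z * (g z * g z).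
have sfg := torus_continuous_sqint (torus_funM pf pg) (continuous_planeM cf cg).
have sgg := torus_continuous_sqint (torus_funM pg pg) (continuous_planeM cg cg).
have sdf := torus_continuous_sqint pdf cdf; have sdg := torus_continuous_sqint pdg cdg.
have cA := continuous_planeM (continuous_planeM cf cg) cdg.
have cB := continuous_planeM cdf (continuous_planeM cg cg).
have pG : torus_fun G.
  by have [[f1 f2] [g1 g2]] := (pf, pg); have [[d1 d2] [e1 e2]] := (pdf, pdg);
  split=> z; rewrite /G ?f1 ?f2 ?g1 ?g2 ?d1 ?d2 ?e1 ?e2.
have cG : continuous G.
  by move=> z; apply: cvgD; [apply: cvgM; [exact: cvg_cst|exact: cA]|exact: cB].
have I := torus_RintegralZD 2 (sqint_mul_integrable sfg sdg) (sqint_mul_integrable sdf sgg).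
refine (etrans (esym I) _).
refine (@torus_integral_derivative R (fun z => f z * (g z * g z)) G j
  (torus_funM pf (torus_funM pg pg)) pG (continuous_planeM cf (continuous_planeM cg cg)) cG _).
move=> z t; have d1 := smooth_line j z t fs; have d2 := smooth_line j z t gs.
apply: is_derive_eq; rewrite /G /GRing.scale/=; exact: cubic_derivative.
Qed.

(** For each component [i], take [f] to be [phi j] and [g] to be [phi i] in [integral_partial_sqr],
    and add over [j]: the terms with a derivative of [phi j] sum to the divergence. *)
Lemma convection_skew_smooth phi : smooth_solenoidal phi -> convection phi phi phi = 0.
Proof.
move=> sp; have hp := smooth_solenoidal_V sp; have [s d _] := sp.
rewrite (convectionE hp hp hp); apply: big1 => i _.
have sP k j := smooth_sqint (smooth_partial j (s k)).
have sW j := weak_partial_sqint j (hp.1 i).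
have E j := integral_mul_eq (V_sq_mul i j hp hp) (V_sq_mul i j hp hp) (sW j) (sP i j)
  (ae_eq_refl mu setT _) (smooth_weak_partial j (s i)).
rewrite sum_ord2 (E 0) (E 1).
have D := integral_mul_lin 1 (sP 0 0) (sP 1 1) (V_sq_mul i i hp hp).
have Z : ip (fun z => 1 * partial 0 (phi 0) z + partial 1 (phi 1) z) (fun z => phi i z * phi i z) = 0.
  rewrite (_ : (fun z => 1 * _ + _) = fun=> 0).
    by apply: etrans (torus_integral_cst 0); apply: eq_Rintegral => z _; rewrite mul0r.
  by apply/funext => z; have := d z; rewrite sum_ord2 mul1r.
exact: half_sum_eq0 (integral_partial_sqr 0 (s 0) (s i)) (integral_partial_sqr 1 (s 1) (s i)) (etrans (esym D) Z).
Qed.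

(** By density and continuity of the cubic form; [24] is 3 telescoped terms times the constant 8 of
    [convection_bound], and [e <= 1] keeps the norm of the approximation below [N u + 1]. *)
Theorem convection_skew u : V u -> convection u u u = 0.
Proof.
move=> hu; apply: (@norm_le_eps_eq0 R _ (24 * (N u + 1) ^+ 2)); first by rewrite mulr_ge0 ?sqr_ge0.
move=> e e0 e1; have [phi sp /ltW Np] := V_approx hu e0.
have hp := smooth_solenoidal_V sp; have skew := convection_skew_smooth sp.
have hd : V (u - phi) := submoduleB (S := V_submodule R) hu hp.
have E1 := convection_lin1 1 hd hp hu hu; have E2 := convection_lin2 1 hp hd hp hu.
have E3 := convection_lin3 1 hp hp hd hp.
rewrite scale1r subrK mul1r in E1; rewrite scale1r subrK mul1r in E2.
rewrite scale1r subrK mul1r skew addr0 in E3.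
rewrite E1 E2 E3 addrA.
have NN := N_approx_le hu.1 hp.1 Np.
have K0 : 0 <= 8 :> R by rewrite ler0n.
have B1 := convection_bound hd hu hu; have B2 := convection_bound hp hd hu.
have B3 := convection_bound hp hp hd.
have T := telescope3_le B1 B2 B3 K0 (seminorm_ge0 _ u) (seminorm_ge0 _ phi)
  (le_trans NN (lerD (lexx _) e1)) (seminorm_ge0 _ (u - phi)).
exact: le24 T Np (sqr_ge0 _).
Qed.

End convection_on_V.

(** * Strongly measurable curves *)

Section almost_everywhere_lemmas.
Context d (T : measurableType d) (R : realType) (mu : {measure set T -> \bar R}).
Implicit Types P Q S : T -> Prop.

Lemma ae_mono P Q : {ae mu, forall t, P t} -> (forall t, P t -> Q t) -> {ae mu, forall t, Q t}.
Proof. by move=> aeP PQ; apply: filterS aeP. Qed.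

Lemma ae_mono2 P Q S : {ae mu, forall t, P t} -> {ae mu, forall t, Q t} ->
  (forall t, P t -> Q t -> S t) -> {ae mu, forall t, S t}.
Proof. by move=> aeP aeQ PQS; apply: filterS2 aeP aeQ. Qed.

End almost_everywhere_lemmas.

Section strong_measurability.
Context {R : realType} {X : lmodType R}.
Variable a : X -> X -> R.
Hypothesis aP : semi_inner a.
Local Notation nrm := (seminorm a).
Local Notation mu := (@lebesgue_measure R).

Definition simple_curve (s : R -> X) := exists n (A : 'I_n -> set R) (c : 'I_n -> X),
  (forall k, measurable (A k)) /\ forall t, s t = \sum_(k < n) \1_(A k) t *: c k.

Definition strongly_measurable (T : R) (v : R -> X) := exists s : nat -> R -> X,
  (forall n, simple_curve (s n)) /\
  {ae mu, forall t, t \in `]0, T[ -> nrm (s n t - v t) @[n --> \oo] --> 0}.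

Lemma grid_indicator (d t : R) (n : nat) (c : nat -> X) : 0 < d -> 0 <= t < n%:R * d ->
  exists2 k, (\sum_(k < n) \1_(`[k%:R * d, k.+1%:R * d[ : set R) t *: c k = c k) &
    k%:R * d <= t < k.+1%:R * d.
Proof.
move=> d0; elim: n => [|n IH] /andP[t0]; first by rewrite mul0r ltNge t0.
move=> tn; rewrite big_ord_recr/= indicE.
have [tn'|nt] := ltP t (n%:R * d).
  rewrite memNset; last by rewrite /= in_itv/= leNgt tn'.
  by rewrite scale0r addr0; apply: IH; rewrite t0.
exists n; last by rewrite nt tn.
rewrite mem_set ?scale1r; last by rewrite /= in_itv/= nt tn.
rewrite big1 ?add0r// => k _; rewrite indicE memNset ?scale0r//= in_itv/=.
apply/negP; rewrite negb_and -ltNge -leNgt; apply/orP; right.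
by apply: le_trans nt; rewrite ler_wpM2r ?(ltW d0)// ler_nat.
Qed.

(** The curve is sampled at the left endpoints of a uniform grid of []0, T[]. *)
Lemma lipschitz_strongly_measurable (C T : R) (v : R -> X) : 0 < T ->
  lipschitz_curve a C v -> strongly_measurable T v.
Proof.
move=> T0 vC; pose d n : R := T / n.+1%:R.
have d0 n : 0 < d n by rewrite divr_gt0.
exists (fun n t => \sum_(k < n.+1) \1_(`[k%:R * d n, k.+1%:R * d n[ : set R) t *: v (k%:R * d n)).
split=> [n|].
  exists n.+1, (fun k => `[k%:R * d n, k.+1%:R * d n[%classic), (fun k => v (k%:R * d n)).
  by split=> // k; exact: measurable_itv.
apply: aeW => t; rewrite in_itv /= => /andP[t0 tT].
have h n : nrm (\sum_(k < n.+1) \1_(`[k%:R * d n, k.+1%:R * d n[ : set R) t *: v (k%:R * d n) - v t)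
    <= (`|C| * T) * n.+1%:R^-1.
  have [|k -> /andP[kt tk]] := @grid_indicator (d n) t n.+1 (fun k => v (k%:R * d n)) (d0 n).
    by rewrite (ltW t0)/= mulrC divfK.
  apply: le_trans (vC _ _) _; rewrite ler0_norm ?subr_le0// opprB.
  rewrite -mulrA (le_trans (ler_wpM2r _ (ler_norm C))) ?subr_ge0// ler_wpM2l//.
  by rewrite -/(d n) lerBlDl -[X in _ + X]mul1r -mulrDl natr1 ltW.
apply: (@squeeze_cvgr _ _ _ _ (fun=> 0) (fun n => (`|C| * T) * n.+1%:R^-1)).
- by apply: nearW => n; rewrite seminorm_ge0 h.
- exact: cvg_cst.
- by rewrite -(mulr0 (`|C| * T)); apply: cvgM; [exact: cvg_cst|exact: cvg_harmonic].
Qed.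

(** In the hypothesis the exceptional null set may depend on [w]. The simple curves approaching [p]
    involve countably many vectors, so one null set serves them all, and in the limit the moving
    vector [p t] becomes an admissible test. *)
Lemma ae_orthogonal (T : R) (z p : R -> X) : strongly_measurable T p ->
  (forall w, {ae mu, forall t, t \in `]0, T[ -> a (z t) w = 0}) ->
  {ae mu, forall t, t \in `]0, T[ -> a (z t) (p t) = 0}.
Proof.
move=> [s [ss sp]] zw.
have zs : {ae mu, forall t, forall n, t \in `]0, T[ -> a (z t) (s n t) = 0}.
  apply: ae_foralln => n; have [N [A [c [_ sE]]]] := ss n.
  (* The coefficients are indexed by naturals, with default vector 0, so that countably many null
     sets can be joined by [ae_foralln]. *)
  have zc : {ae mu, forall t, forall k, t \in `]0, T[ -> a (z t) (nth 0 [seq c i | i <- enum 'I_N] k) = 0}.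
    by apply: ae_foralln => k; exact: zw.
  apply: (ae_mono zc) => t zct tT; rewrite sE.
  have a0 : a (z t) 0 = 0 by rewrite (ipC aP) (ip0l aP).
  elim/big_rec: _ => // k x _ IH; rewrite (ipDr aP) (ipZr aP) IH addr0.
  have := zct k tT; rewrite (nth_map k) ?size_enum_ord// nth_ord_enum => ->.
  by rewrite mulr0.
apply: (ae_mono2 zs sp) => t zst spt tT.
apply/eqP; rewrite -normr_eq0; apply/eqP.
have h n : `|a (z t) (p t)| <= nrm (z t) * nrm (s n t - p t).
  rewrite -normrN -(ipNr aP) -[X in `|X|]add0r -(zst n tT) -(ipDr aP).
  exact: (cauchy_schwarz aP).
apply/eqP; rewrite eq_le normr_ge0 andbT.
have lim : nrm (z t) * nrm (s n t - p t) @[n --> \oo] --> 0.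
  by rewrite -(mulr0 (nrm (z t))); apply: cvgM; [exact: cvg_cst|exact: spt].
rewrite -(cvg_lim _ lim)//; apply: limr_ge; first by apply/cvg_ex; exists 0.
exact: nearW.
Qed.

(** The difference is tested against [p] and [q] themselves. *)
Lemma ae_seminorm_eq0 (T : R) (p q : R -> X) :
  strongly_measurable T p -> strongly_measurable T q ->
  (forall w, {ae mu, forall t, t \in `]0, T[ -> a (p t - q t) w = 0}) ->
  {ae mu, forall t, t \in `]0, T[ -> nrm (p t - q t) = 0}.
Proof.
move=> sp sq pq.
apply: (ae_mono2 (ae_orthogonal sp pq) (ae_orthogonal sq pq)) => t hp hq tT.
by rewrite /nrm (ipBr aP) (hp tT) (hq tT) subrr sqrtr0.
Qed.

Lemma simple_curve_measurable (Phi : X -> R) (s : R -> X) :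
  (forall k x y, Phi (k *: x + y) = k * Phi x + Phi y) -> simple_curve s ->
  measurable_fun setT (Phi \o s).
Proof.
move=> PhiL [n [A [c [mA sE]]]].
have Phi0 : Phi 0 = 0.
  by have /eqP := PhiL 1 0 0; rewrite scale1r mul1r addr0 -subr_eq0 opprD addNKr oppr_eq0 => /eqP.
have -> : Phi \o s = (fun t => \sum_(k < n) \1_(A k) t * Phi (c k)).
  apply/funext => t /=; rewrite sE.
  clear mA sE; elim: n A c => [|n IH] A c; first by rewrite !big_ord0.
  by rewrite !big_ord_recl PhiL IH.
by apply: measurable_sum => k; apply: measurable_funM => //; exact: measurable_indic.
Qed.

(* [D] is a set of times at which the curve converges, so that no value of [Phi \o v]
   on an uncontrolled null set is involved *)
Lemma restricted_measurable (Phi : X -> R) (M : R) (s : nat -> R -> X) (v : R -> X) (D : set R) :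
  (forall k x y, Phi (k *: x + y) = k * Phi x + Phi y) -> (forall x, `|Phi x| <= M * nrm x) ->
  measurable D -> (forall n, simple_curve (s n)) ->
  (forall t, D t -> nrm (s n t - v t) @[n --> \oo] --> 0) ->
  measurable_fun setT (fun t => \1_D t * Phi (v t)).
Proof.
move=> PhiL PhiM mD ss sv.
apply: (@measurable_fun_cvg _ _ _ setT (fun n t => \1_D t * Phi (s n t))) => [n|t _].
  by apply: measurable_funM; [exact: measurable_indic|exact: simple_curve_measurable].
have [Dt|nDt] := pselect (D t); last first.
  rewrite indicE memNset// mul0r; under eq_fun do rewrite mul0r; exact: cvg_cst.
rewrite indicE mem_set// mul1r; under eq_fun do rewrite mul1r.
apply/cvgrPdist_le => e e0; have M0 : 0 < `|M| + 1 by rewrite ltr_wpDl.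
have /cvgrPdist_le /(_ (e / (`|M| + 1))) := sv t Dt.
rewrite divr_gt0// => /(_ isT); apply: filterS => n.
rewrite sub0r normrN ger0_norm ?seminorm_ge0// ler_pdivlMr// => h.
have -> : Phi (v t) - Phi (s n t) = - Phi (s n t - v t).
  by rewrite -[s n t - v t]addrC -scaleN1r PhiL; ring.
rewrite normrN; apply: le_trans (PhiM _) _; apply: le_trans h.
by rewrite mulrC ler_wpM2l ?seminorm_ge0// (le_trans (ler_norm M))// lerDl.
Qed.

End strong_measurability.

(** * Measurable forcing and uniqueness of weak solutions *)

Lemma indic_mul_le {R : realDomainType} {T : Type} (D : set T) (t : T) (x M : R) :
  0 <= M -> (D t -> `|x| <= M) -> `|\1_D t * x| <= M.
Proof.
move=> M0 xM; rewrite indicE; have [Dt|nDt] := pselect (D t).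
  by rewrite mem_set// mul1r xM.
by rewrite memNset// mul0r normr0.
Qed.

Section essential_forcing.
Context {R : realType} {X : lmodType R}.
Variable a : X -> X -> R.
Hypothesis aP : semi_inner a.
Local Notation nrm := (seminorm a).
Local Notation mu := (@lebesgue_measure R).
Variables (ell : X -> R) (J : X -> X -> R) (M0 MJ : R) (p : R -> X).
Hypotheses (ell_lin : forall k x y, ell (k *: x + y) = k * ell x + ell y)
  (ell_bnd : forall x, `|ell x| <= M0 * nrm x)
  (J_lin1 : forall k x y w, J (k *: x + y) w = k * J x w + J y w)
  (J_lin2 : forall k x y w, J w (k *: x + y) = k * J w x + J w y)
  (J_bnd : forall x w, `|J x w| <= MJ * nrm x * nrm w)
  (M00 : 0 <= M0) (MJ0 : 0 <= MJ)
  (p_meas : forall T : R, 0 < T -> strongly_measurable a T p)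
  (p_bnd : forall T : R, 0 < T -> exists M : R, {ae mu, forall t, t \in `]0, T[ -> nrm (p t) <= M}).

(** The semilinear theory wants a forcing that is bounded and measurable at every time, whereas [p]
    is controlled only almost everywhere. The forcing is set to 0 on a Borel null set and at
    nonpositive times. *)
Lemma essential_forcing : exists (L : R -> X -> R) (A : set R),
  [/\ measurable A /\ mu A = 0%E,
      forall s k y z, L s (k *: y + z) = k * L s y + L s z,
      forall w, measurable_fun [set: R] (fun s => L s w),
      forall T : R, exists M : R, forall (s : R) w, s < T -> `|L s w| <= M * nrm w &
      forall s w, 0 < s -> ~ A s -> L s w = ell w + J (p s) w].
Proof.
have /choice[M Mp] : forall n : nat, exists M : R,
    {ae mu, forall t, t \in `]0, n.+1%:R[ -> nrm (p t) <= M}.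
  by move=> n; exact: p_bnd.
have /choice[s sP] : forall n : nat, exists s : nat -> R -> X, (forall k, simple_curve (s k)) /\
    {ae mu, forall t, t \in `]0, n.+1%:R[ -> nrm (s k t - p t) @[k --> \oo] --> 0}.
  by move=> n; exact: p_meas.
have ae1 : {ae mu, forall t, forall n, t \in `]0, n.+1%:R[ -> nrm (p t) <= M n}.
  by apply: ae_foralln => n; exact: Mp.
have ae2 : {ae mu, forall t, forall n, t \in `]0, n.+1%:R[ ->
    nrm (s n k t - p t) @[k --> \oo] --> 0}.
  by apply: ae_foralln => n; exact: (sP n).2.
have [A [mA A0 PA]] := ae_mono2 ae1 ae2 (fun t h1 h2 => conj h1 h2).
have good t : ~ A t -> (forall n, t \in `]0, n.+1%:R[ -> nrm (p t) <= M n) /\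
    (forall n, t \in `]0, n.+1%:R[ -> nrm (s n k t - p t) @[k --> \oo] --> 0).
  by move=> nAt; apply: contrapT => h; apply: nAt; exact: PA.
pose D := `]0, +oo[%classic `\` A.
pose Dn (n : nat) := `]0, n.+1%:R[%classic `\` A.
have mD : measurable D by apply: measurableD.
have mDn n : measurable (Dn n) by apply: measurableD.
have DDn t : D t -> forall n, t < n.+1%:R -> Dn n t.
  by move=> [+ nA] n tn; rewrite /= in_itv/= andbT => t0; split=> //=; rewrite in_itv/= t0.
exists (fun s w => \1_D s * (ell w + J (p s) w)), A; split=> //.
- by move=> t k y z; rewrite ell_lin J_lin2; ring.
(* Simple approximations exist on each []0, n + 1[] only; at a fixed time the restrictions to [Dn n]
   are eventually equal to the restriction to [D]. *)
- move=> w; apply: (@measurable_fun_cvg _ _ _ setT (fun n t => \1_(Dn n) t * (ell w + J (p t) w))).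
    move=> n; under eq_fun do rewrite mulrDr.
    apply: measurable_funD; first by apply: measurable_funM; [exact: measurable_indic|].
    apply: (@restricted_measurable _ _ _ (J ^~ w) (MJ * nrm w) (s n)) => //.
    + by move=> x; rewrite mulrAC.
    + exact: (sP n).1.
    + by move=> t [tn nA]; apply: (good t nA).2.
  move=> t _; apply: cvg_near_cst; near=> n.
  congr (_ * _); rewrite !indicE; congr (_%:R); congr nat_of_bool.
  have tn : t < n.+1%:R.
    apply: lt_trans (truncnS_gt t) _; rewrite ltr_nat ltnS.
    by near: n; exists (Num.truncn t).+1.
  apply/idP/idP => /set_mem.
    by move=> [t0 nA]; apply/mem_set; split=> //; move: t0; rewrite /= !in_itv/= => /andP[->].
  by move=> Dt; apply/mem_set; exact: DDn.
- move=> T; pose n := Num.truncn T; exists (M0 + MJ * `|M n|) => t w tT.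
  have w0 := seminorm_ge0 a w.
  apply: indic_mul_le => [|Dt]; first by rewrite mulr_ge0// addr_ge0// mulr_ge0.
  have [tn nA] := DDn t Dt n (lt_trans tT (truncnS_gt T)).
  rewrite mulrDl (le_trans (ler_normD _ _))// lerD//.
  rewrite (le_trans (J_bnd _ _))// ler_wpM2r// ler_wpM2l//.
  by rewrite (le_trans ((good t nA).1 n tn))// ler_norm.
- by move=> t w t0 nA; rewrite indicE mem_set ?mul1r//; split=> //=; rewrite in_itv/= t0.
Unshelve. all: by end_near. Qed.

End essential_forcing.

Lemma eq_ae_Rintegral {R : realType} (D : set R) (f g : R -> R) : measurable D ->
  measurable_fun D f -> measurable_fun D g ->
  {ae lebesgue_measure, forall t, D t -> f t = g t} ->
  \int[lebesgue_measure]_(t in D) f t = \int[lebesgue_measure]_(t in D) g t.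
Proof.
move=> mD mf mg fg; congr fine; apply: ae_eq_integral => //; try exact/measurable_EFinP.
by apply: (ae_mono fg) => t E Dt; rewrite E.
Qed.

Local Notation lebesgue := lebesgue_measure.

(** Measurability is Borel measurability, so arbitrary values on a null set could destroy it; here
    the values on [A] come from a function that is itself measurable. The lemma serves the solution
    that is redefined on a null set. *)
Lemma integrable_glue {R : realType} (D A : set R) (g1 g2 r : R -> R) :
  measurable D -> measurable A -> lebesgue A = 0%E ->
  lebesgue.-integrable D (EFin \o g1) -> lebesgue.-integrable D (EFin \o g2) ->
  (forall s, D s -> A s -> r s = g1 s) -> (forall s, D s -> ~ A s -> r s = g2 s) ->
  lebesgue.-integrable D (EFin \o r) /\
  forall D', measurable D' -> D' `<=` D ->
    \int[lebesgue]_(s in D') r s = \int[lebesgue]_(s in D') g2 s.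
Proof.
move=> mD mA A0 i1 i2 r1 r2.
have m1 : measurable_fun D g1 by apply/measurable_EFinP; exact: measurable_int i1.
have m2 : measurable_fun D g2 by apply/measurable_EFinP; exact: measurable_int i2.
have mr : measurable_fun D r.
  apply: (eq_measurable_fun (fun s => \1_A s * g1 s + \1_(~` A) s * g2 s)).
    move=> s; rewrite inE => Ds; rewrite !indicE in_setC.
    have [As|nAs] := pselect (A s).
      by rewrite mem_set// mul1r mul0r addr0 r1.
    by rewrite memNset// mul1r mul0r add0r r2.
  apply: measurable_funD; apply: measurable_funM => //; apply: measurable_funTS;
    apply: measurable_indic => //.
  exact: measurableC.
split=> [|D' mD' sub].
  apply: (@le_integrable _ _ _ lebesgue D mD _ (fun s => `|(g1 s)%:E| + `|(g2 s)%:E|)%E).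
  - exact/measurable_EFinP.
  - move=> s Ds; rewrite /= lee_fin [leRHS]ger0_norm ?addr_ge0//.
    have [As|nAs] := pselect (A s); first by rewrite (r1 s Ds As) lerDl.
    by rewrite (r2 s Ds nAs) lerDr.
  - by apply: integrableD => //; exact: integrable_abse.
apply: eq_ae_Rintegral => //; try by apply: measurable_funS sub _.
have aeA : {ae lebesgue, forall t, ~ A t} by exists A; split=> // t /contrapT.
by apply: (ae_mono aeA) => t nA Dt; rewrite r2//; exact: sub.
Qed.

Section uniqueness.
Context {R : realType} {X : lmodType R}.
Variable a : X -> X -> R.
Hypotheses (aP : semi_inner a) (complete : seq_complete a).
Local Notation nrm := (seminorm a).
Local Notation mu := (@lebesgue_measure R).

Variables (L : R -> X -> R) (B : X -> X -> X -> R) (K : X -> X -> R) (CB CK : R).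
Hypotheses
  (L_lin : forall s k y z, L s (k *: y + z) = k * L s y + L s z)
  (L_meas : forall w, measurable_fun [set: R] (fun s => L s w))
  (L_bnd : forall T : R, exists M : R, forall (s : R) w, s < T -> `|L s w| <= M * nrm w)
  (B_lin1 : forall k x y z w, B (k *: x + y) z w = k * B x z w + B y z w)
  (B_lin2 : forall k x y z w, B z (k *: x + y) w = k * B z x w + B z y w)
  (B_lin3 : forall k x y z w, B z w (k *: x + y) = k * B z w x + B z w y)
  (B_bnd : forall x y w, `|B x y w| <= CB * nrm x * nrm y * nrm w)
  (B_skew : forall x, B x x x = 0)
  (K_lin1 : forall k x y w, K (k *: x + y) w = k * K x w + K y w)
  (K_lin2 : forall k x y w, K w (k *: x + y) = k * K w x + K w y)
  (K_bnd : forall x w, `|K x w| <= CK * nrm x * nrm w)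
  (CB0 : 0 <= CB) (CK0 : 0 <= CK).
Local Notation rhs := (rhs L B K).

Lemma rhs_integrable C (T : R) (y : R -> X) w : lipschitz_curve a C y ->
  mu.-integrable `]0, T[ (EFin \o (fun s => rhs s (y s) w)).
Proof.
move=> yC; have [ML MLP] := L_bnd T; pose b := nrm (y 0) + `|C| * `|T|.
have b0 : 0 <= b by rewrite addr_ge0 ?seminorm_ge0 ?mulr_ge0.
have w0 := seminorm_ge0 a w.
apply: (@bounded_integrable _ _ _ (ML * nrm w + CB * b * b * nrm w + CK * b * nrm w)) => //.
- exact: itv_fin.
- exact: (rhs_measurable aP L_meas B_lin1 B_lin2 B_bnd K_lin1 K_bnd CB0 CK0 w yC).
move=> s; rewrite /= in_itv/= => sT; have [s0 sT'] := andP sT.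
have ys : nrm (y s) <= b by exact: lipschitz_curve_bounded yC sT.
have y0 := seminorm_ge0 a (y s).
apply: le_trans (ler_normD _ _) _; apply: lerD.
  apply: le_trans (ler_normD _ _) _; apply: lerD; first exact: MLP.
  by rewrite (le_trans (B_bnd _ _ _))// ler_wpM2r// ler_pM ?mulr_ge0// ler_wpM2l.
by rewrite (le_trans (K_bnd _ _))// ler_wpM2r// ler_wpM2l.
Qed.

(* The weak solution [q] agrees a.e. with the Lipschitz curve obtained by integrating
   its own right-hand side, which then solves the equation classically. *)
Lemma semilinear_ae_unique (T C M : R) (v0 : X) (y q : R -> X) (r : R -> X -> R) : 0 < T ->
  lipschitz_curve a C y ->
  (forall t w, 0 < t < T -> a (y t) w = a v0 w + \int[mu]_(s in `]0, t[) rhs s (y s) w) ->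
  strongly_measurable a T q -> {ae mu, forall t, t \in `]0, T[ -> nrm (q t) <= M} ->
  (forall w, measurable_fun `]0, T[ (r ^~ w)) ->
  {ae mu, forall t, t \in `]0, T[ -> forall w, r t w = rhs t (q t) w} ->
  (forall w, {ae mu, forall t, t \in `]0, T[ ->
     a (q t) w = a v0 w + \int[mu]_(s in `]0, t[) r s w}) ->
  {ae mu, forall t, t \in `]0, T[ -> nrm (q t - y t) = 0}.
Proof.
move=> T0 yC yE mq qM mr rq qE.
have [A [mA A0 PA]] := ae_mono2 qM rq (fun t h1 h2 => conj h1 h2).
have good t : ~ A t -> (t \in `]0, T[ -> nrm (q t) <= M) /\
    (t \in `]0, T[ -> forall w, r t w = rhs t (q t) w).
  by move=> nAt; apply: contrapT => h; apply: nAt; exact: PA.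
have aeA : {ae mu, forall t, ~ A t} by exists A; split=> // t /contrapT.
pose D := `]0, T[%classic `\` A.
have mD : measurable D by apply: measurableD.
have mT : measurable (`]0, T[%classic : set R) by exact: measurable_itv.
have [ML MLP] := L_bnd T.
(* [G] ignores its state argument: [picard_step] is used as plain integration of the right-hand side
   along [q]. *)
pose G (s : R) (x w : X) := \1_D s * rhs s (q s) w.
pose CG := `|ML| + CB * `|M| * `|M| + CK * `|M|.
have CG0 : 0 <= CG by rewrite !addr_ge0// !mulr_ge0.
have G_lin s x k w z : G s x (k *: w + z) = k * G s x w + G s x z.
  by rewrite /G rhs_lin//; ring.
have G_bnd s x w : `|G s x w| <= CG * nrm w.
  have w0 := seminorm_ge0 a w; apply: indic_mul_le => [|[sT nA]]; first exact: mulr_ge0.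
  have q0 := seminorm_ge0 a (q s).
  have qs : nrm (q s) <= `|M| by rewrite (le_trans ((good s nA).1 sT))// ler_norm.
  rewrite /CG !mulrDl; apply: le_trans (ler_normD _ _) _; apply: lerD.
    apply: le_trans (ler_normD _ _) _; apply: lerD.
      have sT' : s < T by move: sT; rewrite /= in_itv/= => /andP[].
      by rewrite (le_trans (MLP s w sT'))// ler_wpM2r// ler_norm.
    by rewrite (le_trans (B_bnd _ _ _))// ler_wpM2r// ler_pM ?mulr_ge0// ler_wpM2l.
  by rewrite (le_trans (K_bnd _ _))// ler_wpM2r// ler_wpM2l.
have GE w : (fun s => G s (q s) w) = (r ^~ w) \_ D.
  apply/funext => s; rewrite patch_indic /= /G mulrC indicE.
  have [Ds|nDs] := pselect (D s); last by rewrite memNset// !mulr0.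
  by rewrite mem_set// (good s Ds.2).2//; exact: Ds.1.
have G_meas w : measurable_fun [set: R] (fun s => G s (q s) w).
  rewrite GE; apply/(measurable_restrictT _ mD).
  have DT : D `<=` `]0, T[%classic by move=> s [].
  refine (measurable_funS mT DT (mr w)).
have [x [xC xE]] := picard_step aP complete v0 CG0 G_lin G_bnd G_meas.
have Gr t w : t \in `]0, T[ -> \int[mu]_(s in `]0, t[) G s (q s) w = \int[mu]_(s in `]0, t[) r s w.
  rewrite in_itv/= => /andP[t0 tT].
  have sub : `]0, t[%classic `<=` (`]0, T[%classic : set R).
    by move=> s; rewrite /= !in_itv/= => /andP[-> st]; rewrite (lt_trans st tT).
  apply: eq_ae_Rintegral => //.
  - exact: measurable_funTS.
  - exact: (measurable_funS mT sub (mr w)).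
  - apply: (ae_mono aeA) => s nA /sub sT; rewrite /G indicE mem_set ?mul1r.
      by rewrite (good s nA).2.
    by split.
have mx : strongly_measurable a T x := lipschitz_strongly_measurable T0 xC.
(* For each [w] the equations of [q] and [x] have the same right-hand side; strong measurability
   then removes the dependence of the null set on [w]. *)
have qx : {ae mu, forall t, t \in `]0, T[ -> nrm (q t - x t) = 0}.
  apply: ae_seminorm_eq0 mq mx _ => // w.
  apply: (ae_mono (qE w)) => t E tT.
  by rewrite (ipBl aP) (E tT) xE (Gr t w tT) subrr.
have xsol t w : 0 < t < T -> a (x t) w = a v0 w + \int[mu]_(s in `]0, t[) rhs s (x s) w.
  move=> tT; rewrite xE; congr (_ + _); have [t0 tT'] := andP tT.
  have sub : `]0, t[%classic `<=` (`]0, T[%classic : set R).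
    by move=> s; rewrite /= !in_itv/= => /andP[-> st]; rewrite (lt_trans st tT').
  apply: eq_ae_Rintegral => //.
  - exact: measurable_funTS.
  - apply: (measurable_funS mT sub).
    exact: (rhs_measurable aP L_meas B_lin1 B_lin2 B_bnd K_lin1 K_bnd CB0 CK0 w xC).
  - apply: (ae_mono2 aeA qx) => s nA qxs /sub sT; rewrite /G indicE mem_set ?mul1r; last by split.
    by apply: rhs_eq0 (qxs sT).
have xy := semilinear_unique aP L_meas L_bnd B_lin1 B_lin2 B_bnd K_lin1 K_bnd CB0 CK0
  xC yC xsol yE.
apply: (ae_mono qx) => t qxt tT; apply/eqP; rewrite eq_le seminorm_ge0 andbT.
by rewrite (le_trans (ler_seminorm_dist aP _ (x t) _))// qxt// xy ?addr0//.
Qed.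

End uniqueness.

Lemma val_elements_lin (R : realType) (E : lmodType R) (S : submodule E) (k : R)
  (x y : elements S) : val (k *: x + y) = k *: val x + val y.
Proof. by rewrite linearP. Qed.

(** * Fields of [V] as elements of a module *)

Section fields.
Variable R : realType.
Local Notation mu := (@torus_measure R).
Local Notation ip := (@integral_mul _ (mplane R) R mu).
Local Notation n2 := (seminorm ip).
Local Notation N := (seminorm (@form R 1)).
Implicit Types (u v w phi psi : field R) (i j : 'I_2) (z : plane R).

Lemma dotL2_ae u u' w : L2_field u -> L2_field u' -> L2_field w ->
  field_ae_eq u u' -> dotL2 u w = dotL2 u' w.
Proof.
move=> hu hu' hw uu'; apply: eq_bigr => i _.
have sw := L2_sqint (hw i).
exact: (integral_mul_eq (L2_sqint (hu i)) (L2_sqint (hu' i)) sw sw (uu' i) (ae_eq_refl mu setT _)).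
Qed.

Lemma L2_fieldP (k : R) u v : L2_field u -> L2_field v -> L2_field (k *: u + v).
Proof. by move=> hu hv i; exact: (L2P k (hu i) (hv i)). Qed.

Lemma H1_fieldP (k : R) u v : H1_field u -> H1_field v -> H1_field (k *: u + v).
Proof. by move=> hu hv i; exact: (H1P k (hu i) (hv i)). Qed.

Lemma dotL2_lin (k : R) u v w : L2_field u -> L2_field v -> L2_field w ->
  dotL2 (k *: u + v) w = k * dotL2 u w + dotL2 v w.
Proof. by move=> hu hv hw; exact: (in_linear (dotL2_semi_inner R) k hu hv hw). Qed.

Lemma dotL2_linr (k : R) u v w : L2_field u -> L2_field v -> L2_field w ->
  dotL2 w (k *: u + v) = k * dotL2 w u + dotL2 w v.
Proof.
move=> hu hv hw; have hs := in_C (dotL2_semi_inner R).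
rewrite (hs _ _ hw (L2_fieldP k hu hv)) (hs _ _ hw hu) (hs _ _ hw hv).
exact: dotL2_lin.
Qed.

Lemma dot_grad_lin (k : R) u v w : H1_field u -> H1_field v -> H1_field w ->
  dot_grad (k *: u + v) w = k * dot_grad u w + dot_grad v w.
Proof. by move=> hu hv hw; exact: (in_linear (dot_grad_semi_inner R) k hu hv hw). Qed.

Lemma dot_grad_linr (k : R) u v w : H1_field u -> H1_field v -> H1_field w ->
  dot_grad w (k *: u + v) = k * dot_grad w u + dot_grad w v.
Proof.
move=> hu hv hw; have hs := in_C (dot_grad_semi_inner R).
rewrite (hs _ _ hw (H1_fieldP k hu hv)) (hs _ _ hw hu) (hs _ _ hw hv).
exact: dot_grad_lin.
Qed.

Lemma dotL20 w : dotL2 (0 : field R) w = 0.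
Proof.
apply: big1 => i _; apply: etrans (torus_integral_cst 0).
by apply: eq_Rintegral => z _; exact: mul0r.
Qed.

Lemma normL2_eq0_ae u v : L2_field u -> L2_field v -> normL2 (u - v) = 0 -> field_ae_eq u v.
Proof.
move=> hu hv uv i; have su := L2_sqint (hu i); have sv := L2_sqint (hv i).
have n0 : n2 (u i - v i) = 0.
  have le := n2_le_normL2 (u - v) i; rewrite uv in le.
  by apply/eqP; rewrite eq_le le n2_ge0.
have E := subfE (u i) (v i).
have Z : ip (u i - v i) (u i - v i) = 0 by rewrite -sqr_n2 n0 expr0n.
rewrite E in Z; apply: ae_eq_subr; exact: integral_sqr_eq0 (sqintP (-1) sv su) Z.
Qed.

Lemma V_form_semi_inner (c : R) : 0 <= c -> semi_inner_in (V_submodule R) (form c).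
Proof.
move=> c0; have F := form_semi_inner c0; split.
- by move=> x y hx hy; exact: (in_C F hx.1 hy.1).
- by move=> k x y z hx hy hz; exact: (in_linear F k hx.1 hy.1 hz.1).
- by move=> x hx; exact: (in_ge0 F hx.1).
Qed.

Local Notation X := (elements (V_submodule R)).

Lemma val_lin (k : R) (x y : X) : val (k *: x + y) = k *: val x + val y.
Proof. exact: val_elements_lin. Qed.

Lemma valV (x : X) : V (val x). Proof. exact (elementsP x). Qed.

(** Fields outside [V] are sent to 0: a solution takes values in [V] only almost everywhere, but its
    lifted curve has to be total. *)
Definition lift u : X :=
  if pselect (V u) is left h then to_elements (S := V_submodule R) h else 0.

Lemma liftE u : V u -> val (lift u) = u.
Proof. by move=> hu; rewrite /lift; case: pselect. Qed.

Lemma val_simple n (A : 'I_n -> set R) (c : 'I_n -> X) (t : R) i z :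
  val (\sum_(k < n) \1_(A k) t *: c k) i z = \sum_(k < n) \1_(A k) t * val (c k) i z.
Proof.
elim: n A c => [|n IH] A c; first by rewrite !big_ord0 raddf0.
by rewrite !big_ord_recl val_lin -IH.
Qed.

Lemma simple_curve_V (s : R -> X) : simple_curve s -> V_simple (fun t => val (s t)).
Proof.
move=> [n [A [c [mA sE]]]]; exists n, A, (fun k => val (c k)); split=> //.
  by move=> k; exact: valV.
by move=> t i z; rewrite sE val_simple.
Qed.

Lemma V_simple_curve (s : R -> field R) : V_simple s ->
  exists2 x : R -> X, simple_curve x & forall t, val (x t) = s t.
Proof.
move=> [n [A [c [mA cV sE]]]].
exists (fun t => \sum_(k < n) \1_(A k) t *: to_elements (S := V_submodule R) (cV k)).
  by exists n, A, (fun k => to_elements (S := V_submodule R) (cV k)).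
by move=> t; apply/funext => i; apply/funext => z; rewrite sE val_simple.
Qed.

End fields.

(** * Equivalence of the regularised norm with the gradient norm *)

Section voigt_norm.
Variables (R : realType) (alpha : R).
Hypothesis alpha_gt0 : 0 < alpha.
Local Notation N := (seminorm (@form R 1)).
Local Notation X := (elements (V_submodule R)).
Local Notation a := (restrict_form (S := V_submodule R) (form (alpha ^+ 2))).
Local Notation nrm := (seminorm a).
Local Notation mu := (@lebesgue_measure R).

Let c0 : 0 <= alpha ^+ 2 := sqr_ge0 alpha.

Lemma voigt_semi_inner : semi_inner a.
Proof. exact: restrict_form_semi_inner (V_form_semi_inner c0). Qed.

Lemma voigt_complete : seq_complete a.
Proof. by apply: V_complete; rewrite exprn_gt0. Qed.

Lemma nrmE (x : X) : nrm x = seminorm (form (alpha ^+ 2)) (val x).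
Proof. by []. Qed.

Let sqrt_c : Num.sqrt (alpha ^+ 2) = alpha.
Proof. by rewrite sqrtr_sqr gtr0_norm. Qed.

Lemma normL2_voigt (x : X) : normL2 (val x) <= nrm x.
Proof. by rewrite nrmE; exact: normL2_le_form. Qed.

Lemma norm_grad_voigt (x : X) : norm_grad (val x) <= alpha^-1 * nrm x.
Proof.
have E := norm_grad_le_form (val x) c0; rewrite sqrt_c in E.
by rewrite ler_pdivlMl.
Qed.

Lemma N_voigt (x : X) : N (val x) <= (1 + alpha^-1) * nrm x.
Proof.
have E := form_le (val x) ler01; rewrite sqrtr1 mul1r in E.
have E2 := lerD (normL2_voigt x) (norm_grad_voigt x).
by rewrite mulrDl mul1r; exact: le_trans E E2.
Qed.

(** Poincare's inequality enters here: [Linfty_V] speaks of gradients alone, and this carries its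
    bounds and its strong measurability over to the norm of [a]. *)
Lemma voigt_norm_le (x : X) : nrm x <= (1 + alpha) * norm_grad (val x).
Proof.
have E := form_le (val x) c0; rewrite sqrt_c in E; rewrite nrmE.
apply: le_trans E _; rewrite mulrDl mul1r lerD2r.
exact: V_poincare (valV x).
Qed.

Lemma lift_measurable (T : R) (u : R -> field R) :
  V_strongly_measurable T u -> {ae mu, forall t, t \in `]0, T[ -> V (u t)} ->
  strongly_measurable a T (fun t => lift (u t)).
Proof.
move=> [s [sV su]] uV.
have /choice[x xP] : forall n, exists x : R -> X, simple_curve x /\ forall t, val (x t) = s n t.
  by move=> n; have [x sx xE] := V_simple_curve (sV n); exists x.
exists x; split=> [n|]; first exact: (xP n).1.
apply: (ae_mono2 su uV) => t cvg_t Vt tT.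
have B n : 0 <= nrm (x n t - lift (u t)) <= (1 + alpha) * norm_grad (s n t - u t).
  rewrite seminorm_ge0/=; have E := voigt_norm_le (x n t - lift (u t)).
  by rewrite raddfB/= (xP n).2 (liftE (Vt tT)) in E.
apply: (@squeeze_cvgr _ _ _ _ (fun=> 0) (fun n => (1 + alpha) * norm_grad (s n t - u t))).
- exact: nearW.
- exact: cvg_cst.
- by rewrite -(mulr0 (1 + alpha)); apply: cvgM; [exact: cvg_cst|exact: cvg_t tT].
Qed.

Lemma lift_bounded (T M : R) (u : R -> field R) :
  {ae mu, forall t, t \in `]0, T[ -> norm_grad (u t) <= M} ->
  {ae mu, forall t, t \in `]0, T[ -> V (u t)} ->
  {ae mu, forall t, t \in `]0, T[ -> nrm (lift (u t)) <= (1 + alpha) * M}.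
Proof.
move=> uM uV; apply: (ae_mono2 uM uV) => t Mt Vt tT.
apply: le_trans (voigt_norm_le _) _; rewrite (liftE (Vt tT)).
by apply: ler_wpM2l (Mt tT); rewrite addr_ge0// ltW.
Qed.

(** [v] need only be at distance 0 from the measurable curve [y], since global solutions are glued
    from Lipschitz curves up to norm 0. *)
Lemma V_measurable (T : R) (y : R -> X) (v : R -> field R) : strongly_measurable a T y ->
  {ae mu, forall t, t \in `]0, T[ -> exists2 x : X, v t = val x & nrm (x - y t) = 0} ->
  V_strongly_measurable T v.
Proof.
move=> [s [ss sy]] vy; exists (fun n t => val (s n t)); split=> [n|].
  exact: simple_curve_V.
apply: (ae_mono2 sy vy) => t cvg_t vt tT; have [x -> xy] := vt tT.
have aP := voigt_semi_inner.
have i0 : 0 <= alpha^-1 by rewrite invr_ge0 ltW.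
have B n : 0 <= norm_grad (val (s n t) - val x) <= alpha^-1 * nrm (s n t - y t).
  apply/andP; split; first exact: sqrtr_ge0.
  have E := norm_grad_voigt (s n t - x); rewrite raddfB/= in E.
  have F := ler_seminorm_dist aP (s n t) (y t) x.
  rewrite (seminormBC aP (y t) x) xy addr0 in F.
  exact: le_trans E (ler_wpM2l i0 F).
apply: (@squeeze_cvgr _ _ _ _ (fun=> 0) (fun n => alpha^-1 * nrm (s n t - y t))).
- exact: nearW.
- exact: cvg_cst.
- by rewrite -(mulr0 alpha^-1); apply: cvgM; [exact: cvg_cst|exact: cvg_t tT].
Qed.

End voigt_norm.

(** * The data assimilation system *)

Lemma voigt_rhs_arith (R : comRingType) (f m iu iv c n g : R) :
  f + m * (iu - iv) - c - n * g = f + m * iu + - c + (- (m * iv) - n * g).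
Proof. ring. Qed.

Lemma oppr_lin (R : comRingType) (k a b : R) : - (k * a + b) = k * - a + - b.
Proof. ring. Qed.

Lemma damping_lin (R : comRingType) (m n k a b p q : R) :
  - (m * (k * a + b)) - n * (k * p + q) = k * (- (m * a) - n * p) + (- (m * b) - n * q).
Proof. ring. Qed.

Lemma mulr_lin (R : comRingType) (m k a b : R) : m * (k * a + b) = k * (m * a) + m * b.
Proof. ring. Qed.

Lemma ler_prod3 (R : realDomainType) (k x y z a b c : R) : 0 <= k -> 0 <= x -> 0 <= y -> 0 <= z ->
  x <= a -> y <= b -> z <= c -> 8 * x * y * z <= 8 * a * b * c.
Proof.
move=> k0 x0 y0 z0 xa yb zc; apply: ler_pM => //; first by rewrite !mulr_ge0.
by apply: ler_pM => //; [rewrite mulr_ge0|rewrite ler_wpM2l].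
Qed.

Lemma scaled_prod3 (R : comRingType) (k x y z : R) :
  8 * (k * x) * (k * y) * (k * z) = 8 * k ^+ 3 * x * y * z.
Proof. ring. Qed.

Lemma eq_refl_le (R : numDomainType) (x y : R) : x = y -> x <= y.
Proof. by move=> ->. Qed.

Section data_assimilation.
Variables (R : realType) (nu alpha h mu c1 : R) (Ih : field R -> field R) (f : field R).
Hypotheses (nu_gt0 : 0 < nu) (f_H1 : H1_field f) (alpha_gt0 : 0 < alpha) (h_gt0 : 0 < h)
  (mu_gt0 : 0 < mu) (c1_gt0 : 0 < c1) (Ih_interpolant : interpolant c1 h Ih).
Local Notation N := (seminorm (@form R 1)).
Local Notation X := (elements (V_submodule R)).
Local Notation a := (restrict_form (S := V_submodule R) (form (alpha ^+ 2))).
Local Notation nrm := (seminorm a).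
Local Notation leb := (@lebesgue_measure R).
Implicit Types (phi psi : field R) (k : R) (x y z w : X).

Lemma Ih_L2 phi : H1_field phi -> L2_field (Ih phi).
Proof. by move=> hp; have [h1 _ _] := Ih_interpolant; exact: h1. Qed.

Lemma Ih_lin k phi psi (w : field R) : H1_field phi -> H1_field psi -> L2_field w ->
  dotL2 (Ih (k *: phi + psi)) w = k * dotL2 (Ih phi) w + dotL2 (Ih psi) w.
Proof.
move=> h1 h2 hw; have [_ L _] := Ih_interpolant.
rewrite -(dotL2_lin k (Ih_L2 h1) (Ih_L2 h2) hw).
have h3 := L2_fieldP k (Ih_L2 h1) (Ih_L2 h2).
exact: dotL2_ae (Ih_L2 (H1_fieldP k h1 h2)) h3 hw (L k phi psi h1 h2).
Qed.

(** The 1 is Poincare's constant, for [phi] itself; [c1 * h] is the interpolation error. *)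
Lemma Ih_bound phi : V phi -> normL2 (Ih phi) <= (1 + c1 * h) * norm_grad phi.
Proof.
move=> hp; have [_ _ B] := Ih_interpolant.
have h1 := Ih_L2 hp.1; have h2 := H1_L2_field hp.1.
have E := ler_seminorm_dist_in (dotL2_semi_inner R) h1 h2 (submodule0 (L2_submodule R)).
rewrite !subr0 (seminormBC_in (dotL2_semi_inner R) h1 h2) in E.
rewrite mulrDl mul1r addrC.
exact: le_trans E (lerD (B phi hp.1) (V_poincare hp)).
Qed.

(** Compares the H1 norm with the norm of [a]. It is finite because [alpha > 0], and each factor of
    the convection estimate costs one power of it. *)
Let kap : R := 1 + alpha^-1.
Let kap0 : 0 <= kap. Proof. by rewrite addr_ge0// invr_ge0 ltW. Qed.
Let ch0 : 0 <= 1 + c1 * h. Proof. by rewrite addr_ge0// mulr_ge0// ltW. Qed.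
Let gap (x : X) : norm_grad (val x) <= kap * nrm x.
Proof. exact: le_trans (norm_grad_le_N (val x)) (N_voigt alpha_gt0 x). Qed.

Definition observation (x w : X) : R := mu * dotL2 (Ih (val x)) (val w).
Definition forcing (w : X) : R := dotL2 f (val w).
Definition advection (x y w : X) : R := - convection (val x) (val y) (val w).
(** The part of the equation linear in the solution, nudging included. It is only estimated in size:
    nudging against [I_h] has no definite sign for arbitrary [mu] and [h]. *)
Definition damping (x w : X) : R := - observation x w - nu * dot_grad (val x) (val w).

Lemma observation_lin1 k x y w : observation (k *: x + y) w = k * observation x w + observation y w.
Proof.
rewrite /observation val_lin (Ih_lin k (valV x).1 (valV y).1 (H1_L2_field (valV w).1)).
exact: mulr_lin.
Qed.

Lemma observation_lin2 k x y w : observation w (k *: x + y) = k * observation w x + observation w y.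
Proof.
rewrite /observation val_lin.
rewrite (dotL2_linr k (H1_L2_field (valV x).1) (H1_L2_field (valV y).1) (Ih_L2 (valV w).1)).
exact: mulr_lin.
Qed.

Let CJ : R := mu * ((1 + c1 * h) * kap).
Let CJ0 : 0 <= CJ. Proof. by rewrite mulr_ge0 ?(ltW mu_gt0)// mulr_ge0. Qed.

Lemma observation_bound x w : `|observation x w| <= CJ * nrm x * nrm w.
Proof.
rewrite /observation normrM (gtr0_norm mu_gt0) /CJ -!mulrA; apply: ler_wpM2l; first exact: ltW.
have E := cauchy_schwarz_in (dotL2_semi_inner R) (Ih_L2 (valV x).1) (H1_L2_field (valV w).1).
apply: le_trans E _; rewrite !mulrA.
have F := le_trans (Ih_bound (valV x)) (ler_wpM2l ch0 (gap x)).
rewrite mulrA in F.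
exact: ler_pM (seminorm_ge0 _ _) (seminorm_ge0 _ _) F (normL2_voigt alpha w).
Qed.

Lemma forcing_lin k x y : forcing (k *: x + y) = k * forcing x + forcing y.
Proof.
rewrite /forcing val_lin.
exact: (dotL2_linr k (H1_L2_field (valV x).1) (H1_L2_field (valV y).1) (H1_L2_field f_H1)).
Qed.

Lemma forcing_bound x : `|forcing x| <= normL2 f * nrm x.
Proof.
have E := cauchy_schwarz_in (dotL2_semi_inner R) (H1_L2_field f_H1) (H1_L2_field (valV x).1).
exact: le_trans E (ler_wpM2l (sqrtr_ge0 _) (normL2_voigt alpha x)).
Qed.

Lemma advection_lin1 k x y z w : advection (k *: x + y) z w = k * advection x z w + advection y z w.
Proof.
rewrite /advection val_lin (convection_lin1 k (valV x) (valV y) (valV z) (valV w)).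
exact: oppr_lin.
Qed.

Lemma advection_lin2 k x y z w : advection z (k *: x + y) w = k * advection z x w + advection z y w.
Proof.
rewrite /advection val_lin (convection_lin2 k (valV z) (valV x) (valV y) (valV w)).
exact: oppr_lin.
Qed.

Lemma advection_lin3 k x y z w : advection z w (k *: x + y) = k * advection z w x + advection z w y.
Proof.
rewrite /advection val_lin (convection_lin3 k (valV z) (valV w) (valV x) (valV y)).
exact: oppr_lin.
Qed.

Let CB : R := 8 * kap ^+ 3.
Let CB0 : 0 <= CB. Proof. by rewrite mulr_ge0// exprn_ge0. Qed.

Lemma advection_bound x y w : `|advection x y w| <= CB * nrm x * nrm y * nrm w.
Proof.
rewrite /advection normrN; apply: le_trans (convection_bound (valV x) (valV y) (valV w)) _.
have E := ler_prod3 kap0 (seminorm_ge0 _ _) (seminorm_ge0 _ _) (seminorm_ge0 _ _)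
  (N_voigt alpha_gt0 x) (N_voigt alpha_gt0 y) (N_voigt alpha_gt0 w).
exact: le_trans E (eq_refl_le (scaled_prod3 kap (nrm x) (nrm y) (nrm w))).
Qed.

Lemma advection_skew x : advection x x x = 0.
Proof. by rewrite /advection (convection_skew (valV x)) oppr0. Qed.

Lemma damping_lin1 k x y w : damping (k *: x + y) w = k * damping x w + damping y w.
Proof.
rewrite /damping /observation val_lin (dot_grad_lin k (valV x).1 (valV y).1 (valV w).1).
rewrite (Ih_lin k (valV x).1 (valV y).1 (H1_L2_field (valV w).1)).
exact: damping_lin.
Qed.

Lemma damping_lin2 k x y w : damping w (k *: x + y) = k * damping w x + damping w y.
Proof.
rewrite /damping /observation val_lin (dot_grad_linr k (valV x).1 (valV y).1 (valV w).1).
rewrite (dotL2_linr k (H1_L2_field (valV x).1) (H1_L2_field (valV y).1) (Ih_L2 (valV w).1)).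
exact: damping_lin.
Qed.

Let CK : R := CJ + nu * kap ^+ 2.
Let CK0 : 0 <= CK. Proof. by rewrite addr_ge0// mulr_ge0 ?sqr_ge0// ltW. Qed.

Lemma damping_bound x w : `|damping x w| <= CK * nrm x * nrm w.
Proof.
rewrite /damping /CK -mulrA mulrDl; apply: le_trans (ler_normB _ _) _; rewrite normrN.
apply: lerD; first by rewrite mulrA; exact: observation_bound.
rewrite normrM (gtr0_norm nu_gt0) -mulrA; apply: ler_wpM2l; first exact: ltW.
have E := cauchy_schwarz_in (dot_grad_semi_inner R) (valV x).1 (valV w).1.
apply: le_trans E _; rewrite expr2 mulrACA.
exact: ler_pM (seminorm_ge0 _ _) (seminorm_ge0 _ _) (gap x) (gap w).
Qed.

(** Splits [I_h(u) - I_h(v)] by linearity: the observed part joins the forcing, a function of time,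
    and the rest joins [damping]. *)
Lemma voigt_rhsE (L : R -> X -> R) (s : R) (us : field R) (x w : X) : V us ->
  L s w = forcing w + observation (lift us) w ->
  dotL2 f (val w) + mu * dotL2 (Ih us - Ih (val x)) (val w)
    - convection (val x) (val x) (val w) - nu * dot_grad (val x) (val w) =
  rhs L advection damping s x w.
Proof.
move=> hu LE; rewrite /rhs LE /forcing /advection /damping /observation (liftE hu).
have -> : Ih us - Ih (val x) = -1 *: Ih (val x) + Ih us by rewrite scaleN1r addrC.
rewrite (dotL2_lin (-1) (Ih_L2 (valV x).1) (Ih_L2 hu.1) (H1_L2_field (valV w).1)).
rewrite mulN1r [X in mu * X]addrC.
exact: voigt_rhs_arith.
Qed.

Lemma seminorm_eq0_ip (x y w : X) : nrm (x - y) = 0 -> a x w = a y w.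
Proof.
have aP := voigt_semi_inner alpha; move=> xy; have E := cauchy_schwarz aP (x - y) w.
rewrite xy mul0r (ipBl aP) normr_le0 subr_eq0 in E; exact/eqP.
Qed.

Lemma seminorm_eq0_le (x y : X) : nrm (x - y) = 0 -> nrm x <= nrm y.
Proof.
have aP := voigt_semi_inner alpha; move=> xy; have E := ler_seminormD aP (x - y) y.
by rewrite subrK xy add0r in E.
Qed.

Definition voigt_rhs (us vs w : field R) : R :=
  dotL2 f w + mu * dotL2 (Ih us - Ih vs) w - convection vs vs w - nu * dot_grad vs w.

(** Where the solution is redefined to be [u] the nudging cancels, and the right-hand side is that
    of Navier-Stokes, whose integrability belongs to [NSE_solution]. *)
Lemma voigt_rhs_self (us w : field R) :
  voigt_rhs us us w = dotL2 f w - convection us us w - nu * dot_grad us w.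
Proof. by rewrite /voigt_rhs subrr dotL20 mulr0 addr0. Qed.

Lemma voigt_wellposed (u0 v0 : field R) (u : R -> field R) : V v0 ->
  NSE_solution nu f u0 u ->
  exists v : R -> field R, forall T : R, 0 < T ->
    Voigt_assimilation_solution alpha nu mu Ih f u v0 T v /\
    forall v' : R -> field R, Voigt_assimilation_solution alpha nu mu Ih f u v0 T v' ->
      {ae leb, forall t, t \in `]0, T[ -> field_ae_eq (v' t) (v t)}.
Proof.
move=> v0V uN; have aP := voigt_semi_inner alpha; have cpl := voigt_complete alpha_gt0.
have pm (T : R) : 0 < T -> strongly_measurable a T (fun t => lift (u t)).
  by move=> T0; have [[uV um _] _] := uN T T0; exact: lift_measurable um uV.
have pb (T : R) : 0 < T -> exists M : R, {ae leb, forall t, t \in `]0, T[ -> nrm (lift (u t)) <= M}.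
  move=> T0; have [[uV _ [M uM]] _] := uN T T0.
  by exists ((1 + alpha) * M); exact: lift_bounded uM uV.
have [L [A [[mA A0] LL Lm Lb LE]]] := essential_forcing forcing_lin forcing_bound
  observation_lin1 observation_lin2 observation_bound (sqrtr_ge0 _) CJ0 pm pb.
have uVn : {ae leb, forall t, forall n, t \in `]0, n.+1%:R[ -> V (u t)}.
  apply: ae_foralln => n; have n0 : (0 : R) < n.+1%:R by rewrite ltr0Sn.
  by have [[uV _ _] _] := uN _ n0.
have [A1 [mA1 A10 PA1]] := uVn.
have uVg t : 0 < t -> ~ A1 t -> V (u t).
  move=> t0 nA; apply: contrapT => nV; apply: nA; apply: PA1 => H; apply: nV.
  by apply: (H (Num.truncn t)); rewrite in_itv/= t0 truncnS_gt.
(* [A] collects the times where [L] may differ from the true forcing, [A1] the positive times where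
   [u] may leave [V]. As both are Borel, so is their union. *)
pose E := A `|` A1.
have mE : measurable E by exact: measurableU.
have E0 : leb E = 0%E by rewrite /E measureU0.
have aeE : {ae leb, forall t, ~ E t} by exists E; split=> // t /contrapT.
have [Y YP] := semilinear_global aP cpl LL Lm Lb advection_lin1 advection_lin2 advection_lin3
  advection_bound advection_skew damping_lin1 damping_lin2 damping_bound CB0 CK0
  (to_elements (S := V_submodule R) v0V).
(* Neither [E] nor [Y] refers to [T], so this one curve serves every horizon. *)
pose v t := if pselect (E t) then u t else val (Y t).
have vE t : E t -> v t = u t by move=> Et; rewrite /v; case: pselect.
have vY t : ~ E t -> v t = val (Y t) by move=> Et; rewrite /v; case: pselect.
exists v => T T0.
have [y [C [yC Yy yE]]] := YP T T0; have [_ uE] := uN T T0.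
have posT t : t \in `]0, T[ -> 0 < t < T by rewrite in_itv.
have Yt t : t \in `]0, T[ -> nrm (Y t - y t) = 0 by move=> /posT; exact: Yy.
have rhs_val t (x w : X) : t \in `]0, T[ -> ~ E t ->
    voigt_rhs (u t) (val x) (val w) = rhs L advection damping t x w.
  move=> /posT/andP[t0 _] nE.
  have Vt : V (u t) by apply: uVg => // A1t; apply: nE; right.
  by apply: voigt_rhsE => //; apply: LE => // At; apply: nE; left.
have rhs_Y t w : t \in `]0, T[ -> rhs L advection damping t (Y t) w = rhs L advection damping t (y t) w.
  move=> tT.
  exact: (rhs_eq0 L advection_lin1 advection_lin2 advection_bound damping_lin1 damping_bound CB0 t w (Yt t tT)).
split; first split; first split.
- by apply: (ae_mono aeE) => t nE _; rewrite (vY t nE); exact: valV.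
- apply: (V_measurable alpha_gt0 (lipschitz_strongly_measurable T0 yC)).
  by apply: (ae_mono aeE) => t nE tT; exists (Y t); [exact: vY|exact: Yt].
- exists (alpha^-1 * (nrm (y 0) + `|C| * `|T|)); apply: (ae_mono aeE) => t nE tT.
  rewrite (vY t nE); apply: le_trans (norm_grad_voigt alpha_gt0 (Y t)) _.
  have i0 : 0 <= alpha^-1 by rewrite invr_ge0 ltW.
  have B := lipschitz_curve_bounded aP yC (posT t tT).
  have G := le_trans (seminorm_eq0_le (Yt t tT)) B.
  exact: (ler_wpM2l i0 G).
- move=> w hw; pose w' := to_elements (S := V_submodule R) hw.
  have [iu _] := uE w hw.
  have iy := rhs_integrable aP Lm Lb advection_lin1 advection_lin2 advection_bound damping_lin1
    damping_bound CB0 CK0 T w' yC.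
  (* On [E] the right-hand side is the integrable one of Navier-Stokes; off [E] it is [rhs] along
     [Y], equal to [rhs] along the Lipschitz curve [y]. *)
  have [ir rE] := @integrable_glue R `]0, T[%classic E
    (fun t => dotL2 f w - convection (u t) (u t) w - nu * dot_grad (u t) w)
    (fun t => rhs L advection damping t (y t) w') (fun t => voigt_rhs (u t) (v t) w)
    (measurable_itv _) mE E0 iu iy
    (fun t _ Et => etrans (congr1 (fun vt => voigt_rhs (u t) vt w) (vE t Et)) (voigt_rhs_self (u t) w))
    (fun t tT nE => etrans (congr1 (fun vt => voigt_rhs (u t) vt w) (vY t nE))
       (etrans (rhs_val t (Y t) w' tT nE) (rhs_Y t w' tT))).
  split; first exact: ir.
  apply: (ae_mono aeE) => t nE tT; rewrite (vY t nE).
  have sub : `]0, t[%classic `<=` (`]0, T[%classic : set R).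
    have [_ t1] := andP (posT t tT).
    by move=> s; rewrite /= !in_itv/= => /andP[-> st]; rewrite (lt_trans st t1).
  have e1 := etrans (seminorm_eq0_ip w' (Yt t tT)) (yE t w' (posT t tT)).
  rewrite -(rE _ (measurable_itv _) sub) in e1; exact: e1.
move=> v' [[v'V v'm [M v'M]] v'E].
(* The competitor's own right-hand side plays the role of [r]: its integrability is part of being a
   solution, and off [E] it coincides with [rhs] along the lifted curve. *)
have q := semilinear_ae_unique aP cpl LL Lm Lb advection_lin1 advection_lin2 advection_lin3
  advection_bound damping_lin1 damping_lin2 damping_bound CB0 CK0
  (r := fun t w => voigt_rhs (u t) (v' t) (val w)) T0 yC yE
  (lift_measurable alpha_gt0 v'm v'V) (lift_bounded alpha_gt0 v'M v'V).
have qy : {ae leb, forall t, t \in `]0, T[ -> nrm (lift (v' t) - y t) = 0}.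
  apply: q => [w||w].
  - by have [iv _] := v'E _ (valV w); apply/measurable_EFinP; exact: measurable_int iv.
  - apply: (ae_mono2 aeE v'V) => t nE Vt tT w.
    by rewrite -(rhs_val t (lift (v' t)) w tT nE) (liftE (Vt tT)).
  - have [_ ev] := v'E _ (valV w); apply: (ae_mono2 ev v'V) => t et Vt tT.
    have F := et tT; rewrite -{1 2}(liftE (Vt tT)) in F; exact: F.
apply: (ae_mono2 aeE (ae_mono2 qy v'V (fun t h1 h2 => conj h1 h2))) => t nE [qt Vt] tT.
rewrite (vY t nE); have Vv := Vt tT.
(* Distance 0 in the norm of [a] bounds the L2 distance by 0, which is equality almost everywhere on
   the torus. *)
apply: normL2_eq0_ae (H1_L2_field Vv.1) (H1_L2_field (valV (Y t)).1) _.
have D : nrm (lift (v' t) - Y t) <= 0.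
  have F := ler_seminorm_dist aP (lift (v' t)) (y t) (Y t).
  by rewrite (qt tT) (seminormBC aP (y t) (Y t)) (Yt t tT) addr0 in F.
have G := le_trans (normL2_voigt alpha (lift (v' t) - Y t)) D.
rewrite raddfB/= (liftE Vv) in G.
by apply/eqP; rewrite eq_le G; exact: sqrtr_ge0.
Qed.

End data_assimilation.

Theorem theorem1p1 (R : realType) (nu : R) (f u0 v0 : field R)
    (u : R -> field R) (alpha h mu c1 : R) (Ih : field R -> field R)
    (nu_gt0 : 0 < nu) (f_H1 : H1_field f) (u0_V : V u0) (v0_V : V v0)
    (u_NSE : NSE_solution nu f u0 u)
    (alpha_gt0 : 0 < alpha) (h_gt0 : 0 < h) (mu_gt0 : 0 < mu)
    (c1_gt0 : 0 < c1) (Ih_interpolant : interpolant c1 h Ih) :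
  exists v : R -> field R,
    forall T : R, 0 < T ->
      Voigt_assimilation_solution alpha nu mu Ih f u v0 T v /\
      forall v' : R -> field R,
        Voigt_assimilation_solution alpha nu mu Ih f u v0 T v' ->
        {ae lebesgue_measure, forall t, t \in `]0, T[ -> field_ae_eq (v' t) (v t)}.
Proof.
exact: (voigt_wellposed nu_gt0 f_H1 alpha_gt0 h_gt0 mu_gt0 c1_gt0 Ih_interpolant v0_V u_NSE).
Qed.
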